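(* Let $(W,G)$ be a Berglund-Hübsch potential and group with associated data $M,N,\Delta,\Delta^\vee,K_N,K_N^\vee,\deg,\deg^\vee$. The $A$ ring $\bigoplus_{g\in G}\mathcal L_g^G$ of the Berglund-Hübsch construction, with its components $\mathcal L_g^G$ twisted by (tensored with) certain one-dimensional spaces, is naturally isomorphic to the cohomology of $$\mathbb C[(K_N^\vee\oplus K_N)_0]\otimes\Lambda^*(M_{\mathbb C})$$ with respect to $$d^A=\sum_{m\in\Delta}[m]\otimes(\wedge m)+\sum_{n\in\Delta^\vee}[n]\otimes({\rm contr.}\,n).$$ Under this isomorphism, the gradings $Q^A_+$ and $Q^A_-$ of the $A$ ring come from the cohomological and the conformal grading on the complex respectively, where these gradings assign to $[m\oplus n]\otimes P$ the degrees $$m\cdot\deg^\vee+\deg\cdot n-\deg\cdot\deg^\vee\quad\text{and}\quad -m\cdot\deg^\vee+\deg\cdot n+\deg(P)-\deg\cdot\deg^\vee$$ respectively.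
   Context: **Berglund-Hübsch data.** Let $(a_{ij})$ be an invertible $d\times d$ matrix of nonnegative integers and $W=\sum_{i=1}^d\prod_{j=1}^d x_j^{a_{ij}}$. Assume there are positive rationals $q_j$ with $\sum_j a_{ij}q_j=1$ for all $i$, and that $W$ is nondegenerate: the hypersurface $W=0$ in $\mathbb C^d$ is smooth away from the origin. ${\rm Aut}(W)$ is the finite group of diagonal $\gamma=(\gamma_j)\in(\mathbb C^* )^d$ preserving $W$ under $x_j\mapsto\gamma_jx_j$, and $G\subseteq{\rm Aut}(W)$ is a subgroup. Let $M_0=\bigoplus_i\mathbb Z u_i$, $N_0=\bigoplus_j\mathbb Z v_j$ with the pairing $u_i\cdot v_j=a_{ij}$, extended bilinearly. Put $N=\{\sum_jt_jv_j\in N_0\otimes\mathbb Q:(e^{2\pi i t_j})_j\in G\}$ and $M=\{m\in M_0\otimes\mathbb Q: m\cdot n\in\mathbb Z\ \forall n\in N\}$, dual lattices of rank $d$. Let $\deg\in M_{\mathbb Q}$, $\deg^\vee\in N_{\mathbb Q}$ be defined by $\deg\cdot v_j=1$, $u_i\cdot\deg^\vee=1$ for all $i,j$; then $\deg\cdot\deg^\vee=\sum_jq_j$. Put $\Delta=\{u_i\}$, $\Delta^\vee=\{v_j\}$, $K_N=\sum_j\mathbb Q_{\ge0}v_j$, $K_N^\vee=\{m\in M_{\mathbb Q}:m\cdot n\ge0\ \forall n\in K_N\}$. **The complex.** $\mathbb C[(K_N^\vee\oplus K_N)_0]$ is the vector space with basis $[m\oplus n]$ (also written $[m+n]$) indexed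 by pairs of lattice points $m\in K_N^\vee\cap M$, $n\in K_N\cap N$ with $m\cdot n=0$. It is a module over the semigroup ring $\mathbb C[K_N^\vee\oplus K_N]$, being its quotient by the ideal spanned by monomials $[m\oplus n]$ with $m\cdot n>0$. The operator $\wedge m$ is exterior multiplication and ${\rm contr.}\,n$ is contraction by $n$ on $\Lambda^*(M_{\mathbb C})$; $\deg(P)$ is the exterior degree of $P$. **$B$ ring and $A$ ring as bigraded vector spaces.** For $g\in G$ write $g=(e^{2\pi ih_j})_j$ with $0\le h_j<1$. Let $\mathcal L_g$ be the Milnor ring $\mathbb C[x_j:h_j=0]/\langle\partial_{x_j}W_g:h_j=0\rangle$ of the restriction $W_g$ of $W$ to $\{x_j=0\text{ if }h_j\ne0\}$, shifted by (multiplied by) the product $\prod_{h_j=0}x_j$; $G$ acts diagonally, including on this product, and $\mathcal L_g^G$ is the $G$-invariant part. The $B$ ring is $\bigoplus_{g\in G}\mathcal L_g^G$. An element $(\prod_{h_j=0}x_j)\,p$ of $\mathcal L_g^G$ with $p$ homogeneous of degree $\delta$ ($x_j$ having degree $q_j$) has $$(Q^B_+,Q^B_-)=\Big(\sum_{h_j\ne0}(h_j-q_j)+\delta,\ \sum_{h_j\ne0}(1-h_j-q_j)+\delta\Big).$$ The $A$ ring has the same underlying vector space, with $Q^A_+=Q^B_+$ and $Q^A_-=d-2\deg\cdot\deg^\vee-Q^B_-$. The one-dimensional twisting spaces are placed in bidegree $(0,0)$. *)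

(* Defs.v *)
From HB Require Import structures.
From mathcomp Require Import all_boot all_order all_algebra finmap.
From mathcomp Require Import generic_quotient ring_quotient.
From mathcomp Require Import boolp classical_sets reals trigo complex.
From mathcomp Require Import monalg mpoly.

Set Implicit Arguments.
Unset Strict Implicit.
Unset Printing Implicit Defensive.

Import Order.TTheory GRing.Theory Num.Theory.
Local Open Scope ring_scope.
Local Open Scope quotient_scope.

Section LinearQuotient.
Variables (K : pzRingType) (V : lmodType K) (B : submodClosed V).

Definition submod_pred : {pred V} := B.
HB.instance Definition _ := GRing.isZmodClosed.Build V submod_pred
  (GRing.submod_closedB (submodClosedP B)).

Definition lquot := Quotient.quot submod_pred.
HB.instance Definition _ := EqQuotient.on lquot.
HB.instance Definition _ := GRing.Zmodule.on lquot.
HB.instance Definition _ := ZmodQuotient.on lquot.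

Definition lquot_scale (c : K) (x : lquot) : lquot := \pi_lquot (c *: repr x).

Lemma lquot_eqP (v w : V) :
  reflect (\pi_lquot v = \pi_lquot w) (v - w \in B).
Proof.
have /= -> : (v - w \in B) = (v == w %[mod lquot]).
  exact: (Quotient.idealrBE submod_pred v w).
exact: eqP.
Qed.

Lemma lquot_piD (v w : V) : \pi_lquot (v + w) = \pi_lquot v + \pi_lquot w.
Proof. by rewrite !piE. Qed.

Lemma lquot_piZ c (v : V) : \pi_lquot (c *: v) = lquot_scale c (\pi_lquot v).
Proof.
apply/lquot_eqP; rewrite -scalerBr; apply: rpredZ.
by apply/lquot_eqP; rewrite reprK.
Qed.

Fact lquot_scaleA c e x :
  lquot_scale c (lquot_scale e x) = lquot_scale (c * e) x.
Proof. by rewrite -[x]reprK -(lquot_piZ e) -!lquot_piZ scalerA. Qed.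

Fact lquot_scale1 : left_id 1 lquot_scale.
Proof. by move=> x; rewrite -[x]reprK -lquot_piZ scale1r. Qed.

Fact lquot_scaleDr : right_distributive lquot_scale +%R.
Proof.
move=> c x y; rewrite -[x]reprK -[y]reprK -lquot_piD -!lquot_piZ.
by rewrite scalerDr lquot_piD.
Qed.

Fact lquot_scaleDl x : {morph lquot_scale^~ x : c e / c + e}.
Proof.
by move=> c e; rewrite -[x]reprK -!lquot_piZ scalerDl lquot_piD.
Qed.

HB.instance Definition _ := GRing.Zmodule_isLmodule.Build K lquot
  lquot_scaleA lquot_scale1 lquot_scaleDr lquot_scaleDl.

End LinearQuotient.

(* [subquot Z B] is Z / (Z :&: B), realised as the image of Z in V / B. *)
Section Subquotient.
Variables (K : pzRingType) (V : lmodType K) (Z B : submodClosed V).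

Definition subquot_pred : {pred lquot B} :=
  [pred x | `[< exists2 z, z \in Z & x = \pi_(lquot B) z >]].

Fact subquot_closed : submod_closed subquot_pred.
Proof.
split=> [|c x y].
  by rewrite inE; exists 0; rewrite ?(rpred0 Z) // !piE.
rewrite !inE => -[v vZ ->] [w wZ ->].
exists (c *: v + w); first by apply: rpredD; [exact: rpredZ|].
by rewrite lquot_piD lquot_piZ.
Qed.

HB.instance Definition _ :=
  GRing.isSubmodClosed.Build K (lquot B) subquot_pred subquot_closed.

Record subquot := Subquot {
  subquot_val :> lquot B; _ : subquot_val \in subquot_pred }.
HB.instance Definition _ := [isSub for subquot_val].
HB.instance Definition _ := [Choice of subquot by <:].
HB.instance Definition _ := [SubChoice_isSubZmodule of subquot by <:].
HB.instance Definition _ := [SubZmodule_isSubLmodule of subquot by <:].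

(* The class of z; only meaningful when z lies in Z. *)
Definition quot_class (z : V) : subquot := insubd 0 (\pi_(lquot B) z).

End Subquotient.

Section DirectSum.
Variables (K : pzRingType) (I : finType) (V : I -> lmodType K).

Definition dirsum := forall i, V i.
HB.instance Definition _ := gen_eqMixin dirsum.
HB.instance Definition _ := gen_choiceMixin dirsum.

Let extD (x y : dirsum) : (forall i, x i = y i) -> x = y.
Proof. exact: functional_extensionality_dep. Qed.

Definition dirsum_zero : dirsum := fun i => 0.
Definition dirsum_opp (x : dirsum) : dirsum := fun i => - x i.
Definition dirsum_add (x y : dirsum) : dirsum := fun i => x i + y i.
Definition dirsum_scale c (x : dirsum) : dirsum := fun i => c *: x i.

Fact dirsum_addA : associative dirsum_add.
Proof. by move=> x y z; apply: extD => i; exact: addrA. Qed.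
Fact dirsum_addC : commutative dirsum_add.
Proof. by move=> x y; apply: extD => i; exact: addrC. Qed.
Fact dirsum_add0 : left_id dirsum_zero dirsum_add.
Proof. by move=> x; apply: extD => i; exact: add0r. Qed.
Fact dirsum_addN : left_inverse dirsum_zero dirsum_opp dirsum_add.
Proof. by move=> x; apply: extD => i; exact: addNr. Qed.

HB.instance Definition _ := GRing.isZmodule.Build dirsum
  dirsum_addA dirsum_addC dirsum_add0 dirsum_addN.

Fact dirsum_scaleA c e x :
  dirsum_scale c (dirsum_scale e x) = dirsum_scale (c * e) x.
Proof. by apply: extD => i; exact: scalerA. Qed.
Fact dirsum_scale1 : left_id 1 dirsum_scale.
Proof. by move=> x; apply: extD => i; exact: scale1r. Qed.
Fact dirsum_scaleDr : right_distributive dirsum_scale +%R.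
Proof. by move=> c x y; apply: extD => i; exact: scalerDr. Qed.
Fact dirsum_scaleDl x : {morph dirsum_scale^~ x : c e / c + e}.
Proof. by move=> c e; apply: extD => i; exact: scalerDl. Qed.

HB.instance Definition _ := GRing.Zmodule_isLmodule.Build K dirsum
  dirsum_scaleA dirsum_scale1 dirsum_scaleDr dirsum_scaleDl.

End DirectSum.

(* Elements of M_Q (resp. N_Q) are row vectors of coordinates in the basis    *)
(* u_i (resp. v_j), and the pairing has matrix a in these bases.              *)
Section Lattices.
Variables (R : realType) (d : nat) (a : 'M[nat]_d).
Local Notation C := R[i].
Local Notation Cx := (mpoly.mpoly d C).

Definition ratmx : 'M[rat]_d := map_mx (fun n => n%:R) a.

Definition pairing (m n : 'rV[rat]_d) : rat :=
  \sum_i \sum_j m 0 i * (a i j)%:R * n 0 j.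

Definition ugen (i : 'I_d) : 'rV[rat]_d := delta_mx 0 i.
Definition vgen (j : 'I_d) : 'rV[rat]_d := delta_mx 0 j.

Definition cexp2pi (t : rat) : C :=
  (cos (2 * pi * ratr t) +i* sin (2 * pi * ratr t))%C.

Definition potential : Cx := \sum_i \prod_j 'X_j ^+ a i j.

Definition diag_act (g : 'rV[C]_d) (f : Cx) : Cx :=
  f \mPo [tuple g 0 j *: 'X_j | j < d].

Definition Aut_potential (g : 'rV[C]_d) : Prop :=
  (forall j, g 0 j != 0) /\ diag_act g potential = potential.

Definition subgroup_Aut (G : {fset 'rV[C]_d}) : Prop :=
  [/\ forall g, g \in G -> Aut_potential g,
      const_mx 1 \in G,
      forall g k, g \in G -> k \in G -> \row_j (g 0 j * k 0 j) \in G
    & forall g, g \in G -> \row_j (g 0 j)^-1 \in G].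

(* Jacobian criterion for smoothness of W = 0 away from the origin. *)
Definition nondegenerate_potential : Prop :=
  forall x : 'I_d -> C, (exists j, x j != 0) -> potential.@[x] = 0 ->
    exists j, (potential^`M(j)).@[x] != 0.

Variable G : {fset 'rV[C]_d}.

Definition latticeN (n : 'rV[rat]_d) : Prop := \row_j cexp2pi (n 0 j) \in G.
Definition latticeM (m : 'rV[rat]_d) : Prop :=
  forall n, latticeN n -> pairing m n \is a Num.int.
Definition coneK (n : 'rV[rat]_d) : Prop := forall j, 0 <= n 0 j.
Definition dual_coneK (m : 'rV[rat]_d) : Prop :=
  forall n, coneK n -> 0 <= pairing m n.

Definition basis_pred (k : 'rV[rat]_d * 'rV[rat]_d) : Prop :=
  [/\ dual_coneK k.1, latticeM k.1, coneK k.2, latticeN k.2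
    & pairing k.1 k.2 = 0].
Definition basis_index := {k : 'rV[rat]_d * 'rV[rat]_d | `[< basis_pred k >]}.
HB.instance Definition _ := Choice.on basis_index.

(* C[(K_N^v (+) K_N)_0] *)
Definition cone_module := monalg.malg basis_index C.
HB.instance Definition _ := GRing.Lmodule.on cone_module.

(* [m (+) n], which is 0 in the quotient C[(K_N^v (+) K_N)_0] of the          *)
(* semigroup ring when m.n > 0.                                               *)
Definition mono (m n : 'rV[rat]_d) : cone_module :=
  if insub (m, n) is Some k then monalg.mkmalgU k (1 : C) else 0.

(* Multiplication by the monomial [m (+) n] of the semigroup ring. *)
Definition mono_mul (m n : 'rV[rat]_d) (x : cone_module) : cone_module :=
  \sum_(k <- monalg.msupp x)
     monalg.mcoeff k x *: mono (m + (val k).1) (n + (val k).2).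

(* ext V = V (x) Lambda^*(M_C): the coefficient of P : ext V at S is that of  *)
(* u_S = u_(i1) /\ ... /\ u_(ik), where S = {i1 < ... < ik}.                  *)
Local Notation ext V := {ffun {set 'I_d} -> V}.

Definition ext_sign (S : {set 'I_d}) (i : 'I_d) : C :=
  (-1) ^+ #|[set k in S | (k < i)%N]|.

Definition wedge (V : lmodType C) (m : 'rV[rat]_d) (P : ext V) : ext V :=
  [ffun S : {set 'I_d} => \sum_(i in S) (ext_sign S i * ratr (m 0 i)) *: P (S :\ i)].

Definition contr (V : lmodType C) (n : 'rV[rat]_d) (P : ext V) : ext V :=
  [ffun S : {set 'I_d} => \sum_(i in ~: S)
     (ext_sign S i * ratr (pairing (ugen i) n)) *: P (i |: S)].

Definition ext_map (V : lmodType C) (f : V -> V) (P : ext V) : ext V :=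
  [ffun S : {set 'I_d} => f (P S)].

Definition tensor (V : lmodType C) (v : V) (w : ext C^o) : ext V :=
  [ffun S : {set 'I_d} => w S *: v].

(* C[(K_N^v (+) K_N)_0] (x) Lambda^*(M_C) *)
Local Notation cplx := (ext cone_module).

Definition dA_wedge (P : cplx) : cplx :=
  \sum_i ext_map (mono_mul (ugen i) 0) (wedge (ugen i) P).
Definition dA_contr (P : cplx) : cplx :=
  \sum_j ext_map (mono_mul 0 (vgen j)) (contr (vgen j) P).
Definition dA (P : cplx) : cplx := dA_wedge P + dA_contr P.

Fact mono_mul_is_linear m n : linear (mono_mul m n).
Proof.
move=> c x y; pose F (k : basis_index) := mono (m + (val k).1) (n + (val k).2).
pose D := (monalg.msupp x `|` monalg.msupp y `|` monalg.msupp (c *: x + y))%fset.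
have E z : (monalg.msupp z `<=` D)%fset ->
    mono_mul m n z = \sum_(k <- D) monalg.mcoeff k z *: F k.
  move=> sD; rewrite /mono_mul; apply: big_fset_incl => // k _ kz.
  by rewrite monalg.mcoeff_outdom // scale0r.
have xD : (monalg.msupp x `<=` D)%fset.
  by rewrite /D -fsetUA fsubsetUl.
have yD : (monalg.msupp y `<=` D)%fset.
  by rewrite /D (fsetUC (monalg.msupp x)) -fsetUA fsubsetUl.
rewrite !E ?fsubsetUr // scaler_sumr -big_split /=; apply: eq_bigr => k _.
by rewrite monalg.mcoeffD monalg.mcoeffZ scalerDl scalerA.
Qed.

Fact wedge_is_linear (V : lmodType C) m : linear (@wedge V m).
Proof.
move=> c P Q; apply/ffunP => S; rewrite !ffunE scaler_sumr -big_split /=.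
by apply: eq_bigr => i _; rewrite !ffunE scalerDr !scalerA mulrC.
Qed.

Fact contr_is_linear (V : lmodType C) n : linear (@contr V n).
Proof.
move=> c P Q; apply/ffunP => S; rewrite !ffunE scaler_sumr -big_split /=.
by apply: eq_bigr => i _; rewrite !ffunE scalerDr !scalerA mulrC.
Qed.

Fact ext_map_is_linear (V : lmodType C) (f : V -> V) :
  linear f -> linear (ext_map f).
Proof. by move=> lf c P Q; apply/ffunP => S; rewrite !ffunE lf. Qed.

Fact dA_wedge_is_linear : linear dA_wedge.
Proof.
move=> c P Q; rewrite /dA_wedge scaler_sumr -big_split; apply: eq_bigr => i _.
by rewrite wedge_is_linear ext_map_is_linear //; exact: mono_mul_is_linear.
Qed.

Fact dA_contr_is_linear : linear dA_contr.
Proof.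
move=> c P Q; rewrite /dA_contr scaler_sumr -big_split; apply: eq_bigr => j _.
by rewrite contr_is_linear ext_map_is_linear //; exact: mono_mul_is_linear.
Qed.

Fact dA_is_linear : linear dA.
Proof.
move=> c P Q.
by rewrite /dA dA_wedge_is_linear dA_contr_is_linear scalerDr addrACA.
Qed.

HB.instance Definition _ :=
  GRing.isLinear.Build C cplx cplx *:%R dA dA_is_linear.

Definition cocycle : {pred cplx} := [pred P | dA P == 0].
Definition coboundary : {pred cplx} := [pred P | `[< exists Q, P = dA Q >]].

Fact cocycle_closed : submod_closed cocycle.
Proof.
split=> [|c P Q]; first by rewrite inE linear0.
by rewrite !inE => /eqP dP /eqP dQ; rewrite dA_is_linear dP dQ scaler0 addr0.
Qed.
HB.instance Definition _ :=
  GRing.isSubmodClosed.Build C cplx cocycle cocycle_closed.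

Fact coboundary_closed : submod_closed coboundary.
Proof.
split=> [|c P Q].
  by rewrite inE; exists 0; rewrite linear0.
rewrite !inE => -[P' ->] [Q' ->].
by exists (c *: P' + Q'); rewrite dA_is_linear.
Qed.
HB.instance Definition _ :=
  GRing.isSubmodClosed.Build C cplx coboundary coboundary_closed.

Definition cohomology := subquot cocycle coboundary.
HB.instance Definition _ := GRing.Lmodule.on cohomology.

(* The h_j in [0, 1) with g = (e^{2 pi i h_j})_j. *)
Definition age (g : 'rV[C]_d) (j : 'I_d) : rat :=
  xget 0 [set h : rat | 0 <= h < 1 /\ cexp2pi h = g 0 j].

Definition box_point (g : 'rV[C]_d) : 'rV[rat]_d := \row_j age g j.

Definition fixed (g : 'rV[C]_d) : pred 'I_d := fun j => age g j == 0.

Section Sector.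
Variable g : 'rV[C]_d.

(* p lies in C[x_j : h_j = 0] *)
Definition in_fixed_ring (p : Cx) : Prop :=
  forall e, p@_e != 0 -> forall j, ~~ fixed g j -> e j = 0%N.

Definition restricted_potential : Cx :=
  potential \mPo [tuple if fixed g j then 'X_j else 0 | j < d].

Definition shift_mono : Cx := \prod_(j | fixed g j) 'X_j.

Definition sector_poly : {pred Cx} :=
  [pred f | `[< exists2 p, in_fixed_ring p & f = shift_mono * p >]].

Definition sector_jac : {pred Cx} :=
  [pred f | `[< exists2 c : 'I_d -> Cx,
                  forall j, in_fixed_ring (c j)
                & f = shift_mono * \sum_(j | fixed g j)
                        c j * restricted_potential^`M(j) >]].

Fact in_fixed_ring0 : in_fixed_ring 0.
Proof. by move=> e; rewrite mcoeff0 eqxx. Qed.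

Fact in_fixed_ringP c p r :
  in_fixed_ring p -> in_fixed_ring r -> in_fixed_ring (c *: p + r).
Proof.
move=> Pp Pr e; rewrite mcoeffD mcoeffZ => nz j Fj.
have [p0|/Pp->//] := eqVneq p@_e 0.
by move: nz; rewrite p0 mulr0 add0r => /Pr->.
Qed.

Fact sector_poly_closed : submod_closed sector_poly.
Proof.
split=> [|c f k].
  rewrite inE; exists 0; [exact: in_fixed_ring0|by rewrite mulr0].
rewrite !inE => -[p Pp ->] [r Pr ->].
by exists (c *: p + r); [exact: in_fixed_ringP|rewrite mulrDr scalerAr].
Qed.
HB.instance Definition _ :=
  GRing.isSubmodClosed.Build C Cx sector_poly sector_poly_closed.

Fact sector_jac_closed : submod_closed sector_jac.
Proof.
split=> [|c f k].
  rewrite inE; exists (fun=> 0) => [j|].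
    exact: in_fixed_ring0.
  by rewrite big1 ?mulr0 // => j _; rewrite mul0r.
rewrite !inE => -[p Pp ->] [r Pr ->].
exists (fun j => c *: p j + r j) => [j|]; first exact: in_fixed_ringP.
rewrite scalerAr -mulrDr scaler_sumr -big_split /=; congr (_ * _).
by apply: eq_bigr => j _; rewrite mulrDl scalerAl.
Qed.
HB.instance Definition _ :=
  GRing.isSubmodClosed.Build C Cx sector_jac sector_jac_closed.

(* L_g: the Milnor ring of W_g multiplied by the product of the fixed x_j. *)
Definition milnor := subquot sector_poly sector_jac.
HB.instance Definition _ := GRing.Lmodule.on milnor.

Definition milnor_class (f : Cx) : milnor :=
  quot_class sector_poly sector_jac f.

(* l lies in L_g^G, for the action of G induced on the quotient L_g. *)
Definition milnor_invariant (l : milnor) : Prop :=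
  forall y f, y \in G -> f \in sector_poly -> l = milnor_class f ->
    milnor_class (diag_act y f) = l.

(* T_g = Lambda^top(s_g) where s_g = {m in M_C : m . v_j = 0 if h_j <> 0},    *)
(* of dimension #{j : h_j = 0}; the subalgebra Lambda^*(s_g) consists of the  *)
(* forms killed by all contr. v_j with h_j <> 0.                              *)
Definition twist (w : ext C^o) : Prop :=
  (forall S, w S != 0 -> #|S| = #|fixed g|) /\
  (forall j, ~~ fixed g j -> contr (vgen j) w = 0).

(* L_g^G (x) T_g, as the span of its pure tensors in L_g (x) Lambda^*(M_C). *)
Definition sector_pred : {pred ext milnor} :=
  [pred P | `[< exists2 s : seq (milnor * ext C^o),
                  forall t, t \in s -> milnor_invariant t.1 /\ twist t.2
                & P = \sum_(t <- s) tensor t.1 t.2 >]].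

Fact twistZ c w : twist w -> twist (c *: w).
Proof.
move=> [w1 w2]; split=> [S|j Fj]; last first.
  have := @contr_is_linear C^o (vgen j) c w 0.
  have -> : contr (vgen j) (0 : ext C^o) = 0.
    by apply/ffunP => S; rewrite !ffunE big1 // => i _; rewrite ffunE scaler0.
  by rewrite !addr0 w2 // scaler0 => ->.
rewrite ffunE => nz; apply: w1; apply: contraNneq nz => ->.
by rewrite scaler0.
Qed.

Fact sector_closed : submod_closed sector_pred.
Proof.
split=> [|c P Q].
  by rewrite inE; exists [::] => //; rewrite big_nil.
rewrite !inE => -[s Ps ->] [r Pr ->].
exists ([seq (t.1, c *: t.2) | t <- s] ++ r) => [t|].
  rewrite mem_cat => /orP[/mapP[u us ->]|/Pr//].
  by have [? ?] := Ps _ us; split=> //; exact: twistZ.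
rewrite big_cat /= big_map scaler_sumr; congr (_ + _).
by apply: eq_bigr => t _; apply/ffunP => S; rewrite !ffunE scalerA.
Qed.
HB.instance Definition _ :=
  GRing.isSubmodClosed.Build C (ext milnor) sector_pred sector_closed.

Record sector := Sector {
  sector_val :> ext milnor; _ : sector_val \in sector_pred }.
HB.instance Definition _ := [isSub for sector_val].
HB.instance Definition _ := [Choice of sector by <:].
HB.instance Definition _ := [SubChoice_isSubZmodule of sector by <:].
HB.instance Definition _ := [SubZmodule_isSubLmodule of sector by <:].

(* The linear map x^e |-> [m (+) n], where m . v_j = e_j for all j and        *)
(* n = \sum_j h_j v_j.                                                        *)
Definition sector_image (f : Cx) : cone_module :=
  \sum_(e <- msupp f)
     f@_e *: mono ((\row_j (e j)%:R) *m invmx ratmx) (box_point g).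

End Sector.

(* The underlying space is also that of the B ring.  G is finite, so the      *)
(* direct sum is the product.                                                 *)
Definition A_ring := dirsum (fun g : G => sector (val g)).
HB.instance Definition _ := GRing.Lmodule.on A_ring.

Section Gradings.
Variables (q : 'I_d -> rat) (deg degv : 'rV[rat]_d).

Definition weighted_homog (delta : rat) (p : Cx) : Prop :=
  forall e, p@_e != 0 -> \sum_j (e j)%:R * q j = delta.

Definition QB_plus (g : 'rV[C]_d) (delta : rat) : rat :=
  \sum_(j | ~~ fixed g j) (age g j - q j) + delta.
Definition QB_minus (g : 'rV[C]_d) (delta : rat) : rat :=
  \sum_(j | ~~ fixed g j) (1 - age g j - q j) + delta.
Definition QA_plus := QB_plus.
Definition QA_minus (g : 'rV[C]_d) (delta : rat) : rat :=
  d%:R - 2 * pairing deg degv - QB_minus g delta.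

(* F is homogeneous of bidegree (Q^A_+, Q^A_-) = (r, s); the twisting spaces  *)
(* have bidegree (0, 0), so only the coefficients in L_g matter.              *)
Definition A_bihomog (r s : rat) (F : A_ring) : Prop :=
  forall (g : G) (S : {set 'I_d}),
    sector_val (F g) S = 0 \/
    exists p delta, [/\ in_fixed_ring (val g) p, weighted_homog delta p,
      sector_val (F g) S = milnor_class (val g) (shift_mono (val g) * p),
      QA_plus (val g) delta = r & QA_minus (val g) delta = s].

Definition coh_deg (k : 'rV[rat]_d * 'rV[rat]_d) : rat :=
  pairing k.1 degv + pairing deg k.2 - pairing deg degv.
Definition conf_deg (k : 'rV[rat]_d * 'rV[rat]_d) (S : {set 'I_d}) : rat :=
  - pairing k.1 degv + pairing deg k.2 + #|S|%:R - pairing deg degv.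

Definition cplx_bihomog (r s : rat) (P : cplx) : Prop :=
  forall S k, monalg.mcoeff k (P S) != 0 ->
    coh_deg (val k) = r /\ conf_deg (val k) S = s.

Definition coh_bihomog (r s : rat) (c : cohomology) : Prop :=
  exists P, [/\ P \in cocycle, cplx_bihomog r s P
              & c = quot_class cocycle coboundary P].

End Gradings.

End Lattices.

(* Main.v *)
Require Import Defs.
From HB Require Import structures.
From mathcomp Require Import all_boot all_order all_algebra finmap.
From mathcomp Require Import generic_quotient.
From mathcomp Require Import boolp classical_sets reals complex.
From mathcomp Require Import ssrcomplements monalg mpoly.
From mathcomp Require Import trigo ring lra zify finset.

Set Implicit Arguments.
Unset Strict Implicit.
Unset Printing Implicit Defensive.

Import Order.TTheory GRing.Theory Num.Theory.
Local Open Scope ring_scope.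

(** Let theta_j be the basis of M_C dual to the v_j. A basis element [[m + n]] of
    the complex is read as a pair of the monomial x^e with e_j = m.v_j and of the
    point n, where e_j n_j = 0 for all j. In the basis of the theta_j the operator
    d^A becomes the sum of two anticommuting Koszul differentials: wedging with
    theta_j while multiplying by the logarithmic derivative x_j d_j W, and
    contracting theta_j while multiplying by y_j, that is, adding v_j to n
    ([dA_basis_change]).

    Dividing by y_j gives a homotopy for the second differential. The
    anticommutator of the two is diagonal ([homotopy]): on [[m + n]] (x) theta_S its
    eigenvalue is the number of j outside S with n_j >= 1, plus the number of j in
    S with e_j = 0. Since the first differential preserves n and the homotopy
    lowers it, a perturbation argument replaces every class by one carried by the
    basis elements of eigenvalue 0 ([reduction]). For these all n_j are in
    [[0, 1)], so that n is the box point of a unique g in G, and x_j divides x^e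
    for j in S.

    On the reduced part the complex is therefore the direct sum over g of the
    G-invariant part of a logarithmic Koszul complex in the variables with
    h_j = 0, on which only the monomials of W_g act; dividing by the product of the
    x_j with j in S ([log_form]) turns it into the ordinary Koszul complex of the
    derivatives of W_g. Nondegeneracy of W implies that every variable with
    h_j = 0 has a power in the Jacobian ideal of W_g ([var_power_in_jacobian]). The
    powers of the variables form a regular sequence, hence this Koszul complex is
    exact below the top degree ([koszul_exact]), and what remains in top degree is
    the Milnor ring: the invariant part of L_g, times the top form that generates
    the twisting space. This is bijectivity ([cone_surjective],
    [cone_injective]).

    That a power of x_j is in the Jacobian ideal is proved without the
    Nullstellensatz: as the matrix of exponents is invertible, all the monomials of
    W_g are in the ideal, and a descending induction on sets T of variables with
    h_j = 0 shows that the product of the variables in T is in its radical. The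
    induction would only stop at a set T for which W has a singular point
    supported on T, whose coordinates can be taken to be roots of unity
    ([nondegenerate_pointing]).

    As for the gradings, d^A raises the cohomological degree by one and preserves
    the conformal degree, so the projections to the bihomogeneous parts commute
    with it up to this shift; on the chosen cocycles the two degrees are those of
    the A ring, which is checked on monomials ([shift_bidegE]). *)

(** * Exterior algebra over a coordinate basis *)

Section ExteriorOperators.
Variables (K : comNzRingType) (d : nat).
Implicit Types (V W : lmodType K) (S T : {set 'I_d}) (i j : 'I_d).
Local Notation ext V := {ffun {set 'I_d} -> V}.

Definition below S i : nat := #|[set k in S | (k < i)%N]|.

Lemma below_setD1 S i j : i \in S -> below S j = ((i < j)%N + below (S :\ i) j)%N.
Proof.
move=> iS; rewrite /below (cardsD1 i) !inE iS /=; congr (_ + _)%N.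
by apply: eq_card => k; rewrite !inE andbA.
Qed.

Lemma below_setU1 S i j : i \notin S -> below (i |: S) j = ((i < j)%N + below S j)%N.
Proof. by move=> iS; rewrite (below_setD1 _ (setU11 i S)) setU1K. Qed.

Definition edelta V S (v : V) : ext V := [ffun T => if T == S then v else 0].

(** Wedging with, and contracting by, the [j]-th basis vector: the sign counts
    the earlier basis vectors that it has to cross. *)
Definition create V j (P : ext V) : ext V :=
  [ffun S : {set 'I_d} => if j \in S then (-1) ^+ below S j *: P (S :\ j) else 0].

Definition annih V j (P : ext V) : ext V :=
  [ffun S : {set 'I_d} => if j \in S then 0 else (-1) ^+ below S j *: P (j |: S)].

Definition emap V W (f : V -> W) (P : ext V) : ext W := [ffun S => f (P S)].

Fact create_is_linear V j : linear (@create V j).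
Proof.
move=> c P Q; apply/ffunP => S; rewrite !ffunE.
by case: ifP => _; rewrite ?scaler0 ?addr0 // scalerDr !scalerA mulrC.
Qed.
HB.instance Definition _ V j :=
  GRing.isLinear.Build K (ext V) (ext V) *:%R (create j) (@create_is_linear V j).

Fact annih_is_linear V j : linear (@annih V j).
Proof.
move=> c P Q; apply/ffunP => S; rewrite !ffunE.
by case: ifP => _; rewrite ?scaler0 ?addr0 // scalerDr !scalerA mulrC.
Qed.
HB.instance Definition _ V j :=
  GRing.isLinear.Build K (ext V) (ext V) *:%R (annih j) (@annih_is_linear V j).

Fact emap_is_linear V W (f : {linear V -> W}) : linear (emap f).
Proof. by move=> c P Q; apply/ffunP => S; rewrite !ffunE linearP. Qed.
HB.instance Definition _ V W (f : {linear V -> W}) :=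
  GRing.isLinear.Build K (ext V) (ext W) *:%R (emap f) (emap_is_linear f).

Fact edelta_is_linear V S : linear (@edelta V S).
Proof.
move=> c v w; apply/ffunP => T; rewrite !ffunE.
by case: ifP; rewrite ?scaler0 ?addr0.
Qed.
HB.instance Definition _ V S :=
  GRing.isLinear.Build K V (ext V) *:%R (edelta S) (@edelta_is_linear V S).

Lemma ext_sum_edelta V (P : ext V) : P = \sum_S edelta S (P S).
Proof.
apply/ffunP => T; rewrite sum_ffunE (bigD1 T) //= ffunE eqxx big1 ?addr0 //.
by move=> S /negPf ST; rewrite ffunE eq_sym ST.
Qed.

Lemma ext_linear_eq V W (f g : {linear ext V -> W}) :
  (forall S v, f (edelta S v) = g (edelta S v)) -> f =1 g.
Proof.
move=> fg P; rewrite [P]ext_sum_edelta !raddf_sum.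
by apply: eq_bigr => S _; exact: fg.
Qed.

Lemma emap_edelta V W (f : {linear V -> W}) S v :
  emap f (edelta S v) = edelta S (f v).
Proof. by apply/ffunP => T; rewrite !ffunE; case: ifP; rewrite ?linear0. Qed.

Lemma create_edelta V j S (v : V) : create j (edelta S v) =
  if j \in S then 0 else edelta (j |: S) ((-1) ^+ below S j *: v).
Proof.
apply/ffunP => T; rewrite ffunE; case: ifP => [jT|jT].
  rewrite ffunE (fun_if (fun P : ext V => P T)) !ffunE.
  case: ifP => [/eqP <-|TS]; first by rewrite setD11 setD1K // eqxx (below_setD1 _ jT) ltnn.
  rewrite scaler0; case: ifP => // jS; case: ifP => // /eqP TE.
  by move: TS; rewrite TE setU1K ?jS // eqxx.
rewrite (fun_if (fun P : ext V => P T)) !ffunE; case: ifP => // _.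
by case: eqP => // TE; move: jT; rewrite TE setU11.
Qed.

Lemma annih_edelta V j S (v : V) : annih j (edelta S v) =
  if j \in S then edelta (S :\ j) ((-1) ^+ below S j *: v) else 0.
Proof.
apply/ffunP => T; rewrite ffunE; case: ifP => [jT|jT].
  rewrite (fun_if (fun P : ext V => P T)) !ffunE; case: ifP => // _.
  by case: eqP => // TE; move: jT; rewrite TE setD11.
rewrite ffunE (fun_if (fun P : ext V => P T)) !ffunE.
case: ifP => [/eqP <-|TS].
  by rewrite setU11 setU1K ?jT // eqxx below_setU1 ?jT // ltnn.
rewrite scaler0; case: ifP => // jS; case: ifP => // /eqP TE.
by move: TS; rewrite TE setD1K // eqxx.
Qed.

Lemma emap_create V W (f : {linear V -> W}) j P : emap f (create j P) = create j (emap f P).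
Proof.
by apply/ffunP => S; rewrite !ffunE; case: ifP; rewrite ?linear0 ?linearZ.
Qed.

Lemma emap_annih V W (f : {linear V -> W}) j P : emap f (annih j P) = annih j (emap f P).
Proof.
by apply/ffunP => S; rewrite !ffunE; case: ifP; rewrite ?linear0 ?linearZ.
Qed.

(** Exchanging two basis vectors changes one crossing number by one. *)
Let sgnC (V : lmodType K) (m n p q : nat) (v : V) : odd (m + n) != odd (p + q) ->
  (-1) ^+ m *: ((-1) ^+ n *: v) = - ((-1) ^+ p *: ((-1) ^+ q *: v)).
Proof.
move=> mn; rewrite !scalerA -!exprD -scaleNr.
by rewrite -[in LHS]signr_odd -[in RHS]signr_odd; case: odd mn; case: odd;
  rewrite // ?expr0 ?expr1 ?opprK.
Qed.

Lemma createC V i j (P : ext V) : create i (create j P) = - create j (create i P).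
Proof.
apply/ffunP => S; rewrite !ffunE !inE; have [->|ij] := eqVneq i j.
  by rewrite /= scaler0 if_same oppr0.
rewrite /=; case: ifP => iS; case: ifP => jS; rewrite ?scaler0 ?oppr0 //.
rewrite (setDDl S [set i]) setUC -setDDl; apply: sgnC.
rewrite (below_setD1 i jS) (below_setD1 j iS) !oddD.
have : (i < j)%N != (j < i)%N.
  by move: ij; rewrite -val_eqE /=; case: ltngtP.
by rewrite !oddb; case: (i < j)%N; case: (j < i)%N => //= _; do 2!case: odd.
Qed.

Lemma create2 V i (P : ext V) : create i (create i P) = 0.
Proof.
by apply/ffunP => S; rewrite !ffunE !inE eqxx /= scaler0 if_same.
Qed.

Lemma annihC V i j (P : ext V) : annih i (annih j P) = - annih j (annih i P).
Proof.
apply/ffunP => S; rewrite !ffunE !inE; have [->|ij] := eqVneq i j.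
  by rewrite /= scaler0 if_same oppr0.
rewrite /=; case: ifP => iS; case: ifP => jS; rewrite ?scaler0 ?oppr0 //.
rewrite setUCA; apply: sgnC; rewrite !below_setU1 ?iS ?jS // !oddD.
have : (i < j)%N != (j < i)%N.
  by move: ij; rewrite -val_eqE /=; case: ltngtP.
by rewrite !oddb; case: (i < j)%N; case: (j < i)%N => //= _; do 2!case: odd.
Qed.

Lemma annih2 V i (P : ext V) : annih i (annih i P) = 0.
Proof.
by apply/ffunP => S; rewrite !ffunE !inE eqxx /= scaler0 if_same.
Qed.

Lemma annih_create V i j (P : ext V) : i != j -> annih i (create j P) = - create j (annih i P).
Proof.
move=> ij; apply/ffunP => S; rewrite !ffunE !inE (negPf ij) eq_sym (negPf ij) /=.
case: ifP => iS; case: ifP => jS; rewrite ?scaler0 ?oppr0 //.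
have -> : (i |: S) :\ j = i |: S :\ j.
  apply/setP => k; rewrite !inE; case: (eqVneq k i) => [->|//].
  by rewrite ij.
apply: sgnC; rewrite (below_setD1 i jS) below_setU1 ?iS // !oddD.
have : (i < j)%N != (j < i)%N.
  by move: ij; rewrite -val_eqE /=; case: ltngtP.
by rewrite !oddb; case: (i < j)%N; case: (j < i)%N => //= _; do 2!case: odd.
Qed.

Lemma annih_createD V i (P : ext V) : annih i (create i P) + create i (annih i P) = P.
Proof.
apply/ffunP => S; rewrite !ffunE !inE eqxx /=; case: ifP => iS.
  by rewrite add0r scalerA -exprD (below_setD1 _ iS) ltnn addnn -signr_odd odd_double scale1r setD1K.
rewrite addr0 setU1K ?iS // scalerA -exprD below_setU1 ?iS // ltnn addnn.
by rewrite -signr_odd odd_double scale1r.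
Qed.

Definition emaps V W (F : {set 'I_d} -> {linear V -> W}) (P : ext V) : ext W :=
  [ffun S => F S (P S)].

Fact emaps_is_linear V W (F : {set 'I_d} -> {linear V -> W}) : linear (emaps F).
Proof. by move=> c P Q; apply/ffunP => S; rewrite !ffunE linearP. Qed.
HB.instance Definition _ V W (F : {set 'I_d} -> {linear V -> W}) :=
  GRing.isLinear.Build K (ext V) (ext W) *:%R (emaps F) (emaps_is_linear F).

Lemma emaps_edelta V W (F : {set 'I_d} -> {linear V -> W}) S v :
  emaps F (edelta S v) = edelta S (F S v).
Proof. by apply/ffunP => T; rewrite !ffunE; case: eqP => [->|_]; rewrite ?linear0. Qed.

Lemma emapE V W (f : V -> W) P S : emap f P S = f (P S).
Proof. by rewrite ffunE. Qed.

Lemma emapsE V W (F : {set 'I_d} -> {linear V -> W}) P S : emaps F P S = F S (P S).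
Proof. by rewrite ffunE. Qed.

Lemma edeltaE V S (v : V) T : edelta S v T = if T == S then v else 0.
Proof. by rewrite ffunE. Qed.

Lemma ext0E V S : (0 : ext V) S = 0.
Proof. by rewrite ffunE. Qed.

Lemma extDE V (P Q : ext V) S : (P + Q) S = P S + Q S.
Proof. by rewrite ffunE. Qed.

Lemma extBE V (P Q : ext V) S : (P - Q) S = P S - Q S.
Proof. by rewrite !ffunE. Qed.

Lemma extZE V c (P : ext V) S : (c *: P) S = c *: P S.
Proof. by rewrite ffunE. Qed.

End ExteriorOperators.

(** * Change of basis in the exterior algebra *)

Lemma sum_alternating (W : zmodType) (d : nat) (F : 'I_d -> 'I_d -> W) :
  (forall i j, F i j = - F j i) -> (forall i, F i i = 0) -> \sum_i \sum_j F i j = 0.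
Proof.
move=> FC Fii; have -> : \sum_i \sum_j F i j =
    \sum_(i < d) (\sum_(j < d | (i < j)%N) F i j + \sum_(j < d | (j < i)%N) F i j).
  apply: eq_bigr => i _; rewrite (bigD1 i) //= Fii add0r.
  rewrite (bigID (fun j : 'I_d => (i < j)%N)) /=; congr (_ + _); apply: eq_bigl => j;
    by rewrite -val_eqE /=; case: ltngtP.
rewrite big_split /= (exchange_big_dep predT) //= -big_split big1 //= => i _.
by rewrite -big_split big1 //= => j _; rewrite FC addNr.
Qed.

Section ChangeOfBasis.
Variables (K : comNzRingType) (d : nat).
Implicit Types (V W : lmodType K) (S T : {set 'I_d}) (i j : 'I_d).
Implicit Types (a b : 'M[K]_d) (m n : 'rV[K]_d).
Local Notation ext V := {ffun {set 'I_d} -> V}.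

Definition ewedge V m (P : ext V) : ext V := \sum_i m 0 i *: create i P.
Definition econtr V n (P : ext V) : ext V := \sum_i n 0 i *: annih i P.

Fact ewedge_is_linear V m : linear (@ewedge V m).
Proof.
move=> c P Q; rewrite /ewedge scaler_sumr -big_split /=; apply: eq_bigr => i _.
by rewrite linearP scalerDr !scalerA mulrC.
Qed.
HB.instance Definition _ V m :=
  GRing.isLinear.Build K (ext V) (ext V) *:%R (ewedge m) (@ewedge_is_linear V m).

Fact econtr_is_linear V n : linear (@econtr V n).
Proof.
move=> c P Q; rewrite /econtr scaler_sumr -big_split /=; apply: eq_bigr => i _.
by rewrite linearP scalerDr !scalerA mulrC.
Qed.
HB.instance Definition _ V n :=
  GRing.isLinear.Build K (ext V) (ext V) *:%R (econtr n) (@econtr_is_linear V n).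

Lemma ewedgeC V m n (P : ext V) : ewedge m (ewedge n P) = - ewedge n (ewedge m P).
Proof.
rewrite /ewedge; under eq_bigr do rewrite linear_sum scaler_sumr.
rewrite exchange_big -sumrN; apply: eq_bigr => i _ /=.
rewrite linear_sum scaler_sumr -sumrN; apply: eq_bigr => j _ /=.
by rewrite !linearZ /= createC !scalerN !scalerA mulrC.
Qed.

Lemma ewedge2 V m (P : ext V) : ewedge m (ewedge m P) = 0.
Proof.
rewrite {2}/ewedge linear_sum /=; under eq_bigr do rewrite linearZ /=.
rewrite /ewedge; under eq_bigr do rewrite scaler_sumr.
apply: sum_alternating => [i j|i]; last by rewrite create2 !scaler0.
by rewrite createC !scalerN !scalerA mulrC.
Qed.

Lemma econtr_ewedge V m n (P : ext V) :
  econtr n (ewedge m P) + ewedge m (econtr n P) = (\sum_i m 0 i * n 0 i) *: P.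
Proof.
rewrite /econtr; under eq_bigr do rewrite linear_sum scaler_sumr.
rewrite linear_sum -big_split scaler_suml; apply: eq_bigr => i _ /=.
rewrite linearZ /= /ewedge scaler_sumr -big_split (bigD1 i) //= big1 => [|j ji].
  rewrite addr0 linearZ /= !scalerA (mulrC (n 0 i)) -scalerDr.
  by rewrite annih_createD.
by rewrite linearZ /= annih_create 1?eq_sym // scalerN scalerN addNr.
Qed.

(** The basis of the exterior algebra induced by the rows of [b]. *)
Definition theta b S : ext K^o :=
  foldr (fun j => ewedge (row j b)) (edelta set0 1) (enum S).

Lemma theta0 b : theta b set0 = edelta set0 1.
Proof. by rewrite /theta enum_set0. Qed.

Lemma theta_min b i S : i \notin S -> (forall k, k \in S -> (i < k)%N) ->
  theta b (i |: S) = ewedge (row i b) (theta b S).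
Proof.
move=> iS Sgt; rewrite /theta; suff -> : enum (i |: S) = i :: enum S by [].
pose lt := relpre (val : 'I_d -> nat) ltn.
have lt_trans : transitive lt by move=> x y z; exact: ltn_trans.
have sorted_enum (T : {set 'I_d}) : sorted lt (enum T).
  rewrite /enum_mem -enumT; apply: sorted_filter => //.
  by rewrite -sorted_map val_enum_ord; exact: iota_ltn_sorted.
apply: (irr_sorted_eq lt_trans (fun x : 'I_d => ltnn x)) => [||k].
- exact: sorted_enum.
- rewrite /= (path_sortedE lt_trans) sorted_enum andbT.
  by apply/allP => k; rewrite mem_enum => /Sgt.
- by rewrite in_cons !mem_enum !inE.
Qed.

Lemma set_minimum S : S != set0 ->
  exists2 i, i \in S & forall k, k \in S :\ i -> (i < k)%N.
Proof.
case/set0Pn => i0 iS0; case: (arg_minnP (fun i : 'I_d => i : nat) iS0) => i iS le_i.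
exists i => // k; rewrite !inE => /andP[ki kS].
by rewrite ltn_neqAle le_i // andbT eq_sym.
Qed.

(** The new vector is moved past the minimum of [S], by induction, until it is
    itself the minimum. *)
Lemma ewedge_theta b j S : ewedge (row j b) (theta b S) =
  if j \in S then 0 else (-1) ^+ below S j *: theta b (j |: S).
Proof.
have [n] := ubnP #|S|; elim: n => // n IHn in S j *; rewrite ltnS => Sn.
have Smin : j \notin S -> (forall k, k \in S -> (j < k)%N) ->
    ewedge (row j b) (theta b S) = (-1) ^+ below S j *: theta b (j |: S).
  move=> jS Sgt; rewrite theta_min //; suff -> : below S j = 0%N by rewrite scale1r.
  apply: eq_card0 => k; rewrite !inE; apply/negP => /andP[/Sgt]; lia.
have [S0|/set_minimum[i iS iminS]] := eqVneq S set0.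
  by rewrite Smin S0 ?inE // => k; rewrite inE.
have [ij|ji|/val_inj ij] := ltngtP i j; last 2 first.
- have jS : j \notin S.
    apply/negP => jS; have /iminS : j \in S :\ i by rewrite !inE jS -val_eqE /= ltn_eqF.
    by lia.
  rewrite (negPf jS) Smin // => k kS; have [->//|ki] := eqVneq k i.
  by apply: ltn_trans ji _; apply: iminS; rewrite !inE ki.
- by rewrite -ij iS -(setD1K iS) theta_min ?setD11 // ewedge2.
have iS' : i \notin S :\ i by rewrite setD11.
rewrite -{1}(setD1K iS) (@theta_min b i _ iS') // ewedgeC IHn; last first.
  by rewrite (cardsD1 i S) iS in Sn.
have ji : j != i by rewrite -val_eqE /= gtn_eqF.
rewrite !inE ji /=; case: ifP => jS; first by rewrite linear0 oppr0.
rewrite linearZ /= -theta_min; first 1 last.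
- by rewrite !inE eq_sym (negPf ji) eqxx.
- by move=> k; rewrite !inE => /orP[/eqP->//|kS]; apply: iminS; rewrite !inE.
rewrite (below_setD1 j iS) ij exprD expr1 -scalerA scaleN1r; congr (- (_ *: theta b _)).
by rewrite setUCA setD1K.
Qed.

Lemma card_theta b S T : theta b S T != 0 -> #|T| = #|S|.
Proof.
rewrite [#|S|]cardE /theta; elim: (enum S) T => [|j s IHs] T /=.
  by rewrite ffunE; case: (T =P set0) => [->|_]; rewrite ?cards0 ?eqxx.
rewrite sum_ffunE; have [//|nz] := eqVneq #|T| (size s).+1.
rewrite big1 ?eqxx // => i _; rewrite !ffunE; case: ifP => iT; rewrite ?scaler0 //.
set x := (X in _ *: (_ *: X)); have [->|x0] := eqVneq x 0; first by rewrite !scaler0.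
by move: nz; rewrite (cardsD1 i T) iT (IHs _ x0) eqxx.
Qed.

Lemma econtr_theta_eq0 b n S :
  (forall i, i \in S -> \sum_k b i k * n 0 k = 0) -> econtr n (theta b S) = 0.
Proof.
have [k] := ubnP #|S|; elim: k => // k IHk in S *; rewrite ltnS => Sk bn.
have [->|/set_minimum[i iS iminS]] := eqVneq S set0.
  rewrite theta0 /econtr big1 // => i _.
  by rewrite annih_edelta inE scaler0.
rewrite -(setD1K iS) theta_min ?setD11 //.
have := econtr_ewedge (row i b) n (theta b (S :\ i)).
under eq_bigr do rewrite mxE.
rewrite bn // scale0r IHk ?linear0 ?addr0 // => [|i']; first by rewrite (cardsD1 i S) iS in Sk.
by rewrite inE => /andP[_]; exact: bn.
Qed.

(** Once the [j]-th vector is at the front, the Clifford relation removes it;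
    the others pair to zero with [n]. *)
Lemma econtr_theta b n j S :
  (forall i, \sum_k b i k * n 0 k = (i == j)%:R) ->
  econtr n (theta b S) = if j \in S then (-1) ^+ below S j *: theta b (S :\ j) else 0.
Proof.
move=> bn; case: ifP => jS; last first.
  by apply: econtr_theta_eq0 => i iS; rewrite bn; case: eqP => // ij; rewrite -ij iS in jS.
have := ewedge_theta b j (S :\ j); rewrite setD11 setD1K // => E.
have := econtr_ewedge (row j b) n (theta b (S :\ j)).
under eq_bigr do rewrite mxE.
rewrite bn eqxx scale1r E econtr_theta_eq0 ?linear0 ?addr0 => [|i]; last first.
  by rewrite !inE bn => /andP[/negPf->].
rewrite linearZ /= => <-; rewrite scalerA -exprD (below_setD1 j jS) ltnn addnn.
by rewrite -signr_odd odd_double scale1r.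
Qed.

(** [pure v w] is the element v (x) w. *)
Definition pure V (v : V) (w : ext K^o) : ext V := [ffun S : {set 'I_d} => w S *: v].

Lemma pureZ V c (v : V) w : pure v (c *: w) = pure (c *: v) w.
Proof. by apply/ffunP => S; rewrite !ffunE scalerA mulrC. Qed.

Lemma pureP V c (v v' : V) w : pure (c *: v + v') w = c *: pure v w + pure v' w.
Proof. by apply/ffunP => S; rewrite !ffunE scalerDr !scalerA mulrC. Qed.

Lemma pure0 V w : pure (0 : V) w = 0.
Proof. by apply/ffunP => S; rewrite !ffunE scaler0. Qed.

Lemma ewedge_pure V m (v : V) w : ewedge m (pure v w) = pure v (ewedge m w).
Proof.
apply/ffunP => S; rewrite !ffunE !sum_ffunE scaler_suml; apply: eq_bigr => i _.
by rewrite !ffunE; case: ifP => _; rewrite ?scaler0 ?scale0r // !scalerA.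
Qed.

Lemma econtr_pure V n (v : V) w : econtr n (pure v w) = pure v (econtr n w).
Proof.
apply/ffunP => S; rewrite !ffunE !sum_ffunE scaler_suml; apply: eq_bigr => i _.
by rewrite !ffunE; case: ifP => _; rewrite ?scaler0 ?scale0r // !scalerA.
Qed.

Definition basis_change V b (P : ext V) : ext V :=
  [ffun T => \sum_S theta b S T *: P S].

Fact basis_change_is_linear V b : linear (@basis_change V b).
Proof.
move=> c P Q; apply/ffunP => T; rewrite !ffunE scaler_sumr -big_split /=.
by apply: eq_bigr => S _; rewrite !ffunE scalerDr !scalerA mulrC.
Qed.
HB.instance Definition _ V b := GRing.isLinear.Build K (ext V) (ext V) *:%R
  (basis_change b) (@basis_change_is_linear V b).

Lemma basis_change_edelta V b S (v : V) :
  basis_change b (edelta S v) = pure v (theta b S).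
Proof.
apply/ffunP => T; rewrite !ffunE (bigD1 S) //= ffunE eqxx big1 ?addr0 // => S' /negPf E.
by rewrite ffunE E scaler0.
Qed.

Lemma basis_change_create V b j (P : ext V) :
  basis_change b (create j P) = ewedge (row j b) (basis_change b P).
Proof.
rewrite -[LHS]/((basis_change b \o create j) P) -[RHS]/((ewedge _ \o basis_change b) P).
apply: ext_linear_eq => S v /=; rewrite create_edelta basis_change_edelta.
rewrite ewedge_pure ewedge_theta; case: ifP => _.
  by rewrite linear0; apply/ffunP => T; rewrite !ffunE scale0r.
rewrite basis_change_edelta; apply/ffunP => T.
by rewrite !ffunE !scalerA mulrC.
Qed.

Lemma basis_change_annih V b n j (P : ext V) :
  (forall i, \sum_k b i k * n 0 k = (i == j)%:R) ->
  basis_change b (annih j P) = econtr n (basis_change b P).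
Proof.
move=> bn.
rewrite -[LHS]/((basis_change b \o annih j) P) -[RHS]/((econtr _ \o basis_change b) P).
apply: ext_linear_eq => S v /=; rewrite annih_edelta basis_change_edelta.
rewrite econtr_pure (econtr_theta _ bn); case: ifP => _; last first.
  by rewrite linear0; apply/ffunP => T; rewrite !ffunE scale0r.
rewrite basis_change_edelta; apply/ffunP => T.
by rewrite !ffunE !scalerA mulrC.
Qed.

Lemma emap_basis_change V W (f : {linear V -> W}) b (P : ext V) :
  emap f (basis_change b P) = basis_change b (emap f P).
Proof.
apply/ffunP => T; rewrite !ffunE linear_sum; apply: eq_bigr => S _.
by rewrite linearZ /= !ffunE.
Qed.

(** The composite commutes with every [create j], because [a *m b = 1] says
    that it fixes the basis vectors, and these generate the exterior algebra
    from its degree 0 part. *)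
Lemma basis_changeK V a b : a *m b = 1%:M ->
  cancel (@basis_change V a) (basis_change b).
Proof.
move=> ab P; rewrite -[LHS]/((basis_change b \o basis_change a) P).
rewrite -[RHS]/(@idfun (ext V) P); apply: ext_linear_eq => S v /=.
have step j Q : basis_change b (basis_change a (create j Q)) =
    create j (basis_change b (basis_change a Q)) :> ext V.
  rewrite basis_change_create linear_sum /=.
  under eq_bigr do rewrite linearZ /= basis_change_create.
  rewrite /ewedge; under eq_bigr do rewrite scaler_sumr.
  rewrite exchange_big /= (bigD1 j) //= [X in _ + X]big1 => [|i ij].
    under eq_bigr do rewrite scalerA !mxE; rewrite -scaler_suml.
    have := congr1 (fun M : 'M_d => M j j) ab; rewrite !mxE eqxx => ->.
    by rewrite scale1r addr0.
  under eq_bigr do rewrite scalerA !mxE; rewrite -scaler_suml.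
  have := congr1 (fun M : 'M_d => M j i) ab; rewrite !mxE eq_sym (negPf ij) => ->.
  by rewrite scale0r.
have [k] := ubnP #|S|; elim: k => // k IHk in S *; rewrite ltnS => Sk.
have [->|/set0Pn[i iS]] := eqVneq S set0.
  rewrite basis_change_edelta theta0.
  suff -> : pure v (edelta set0 1) = edelta set0 v by rewrite basis_change_edelta theta0;
    apply/ffunP => T; rewrite !ffunE; case: ifP; rewrite ?scale1r ?scale0r.
  by apply/ffunP => T; rewrite !ffunE; case: ifP; rewrite ?scale1r ?scale0r.
have := create_edelta i (S :\ i) v; rewrite setD11 setD1K // => E.
have -> : edelta S v = (-1) ^+ below (S :\ i) i *: create i (edelta (S :\ i) v).
  rewrite E linearZ /= scalerA -exprD addnn -signr_odd odd_double.
  by rewrite scale1r.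
rewrite !linearZ /= step IHk //.
by rewrite (cardsD1 i S) iS in Sk.
Qed.

End ChangeOfBasis.

Lemma sum_indicator_scale (K : nzRingType) (W : lmodType K) (I : finType) (b : pred I) (v : W) :
  \sum_i (b i)%:R *: v = #|[set i | b i]|%:R *: v.
Proof.
rewrite -scaler_suml -natr_sum; congr (_%:R *: _).
by rewrite -big_mkcond /= sum1_card; apply: eq_card => j; rewrite inE.
Qed.

(** * Operators of Koszul type *)

Section OperatorKoszul.
Variables (K : comNzRingType) (d : nat) (V : lmodType K).
Local Notation ext := {ffun {set 'I_d} -> V}.
Implicit Types (f g : 'I_d -> {linear V -> V}) (P Q : ext) (S : {set 'I_d}).

Definition lincomb (c : 'I_d -> K) f (x : V) : V := \sum_i c i *: f i x.

Fact lincomb_is_linear c f : linear (lincomb c f).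
Proof.
move=> e x y; rewrite /lincomb scaler_sumr -big_split; apply: eq_bigr => i _ /=.
by rewrite linearP scalerDr !scalerA mulrC.
Qed.
HB.instance Definition _ c f :=
  GRing.isLinear.Build K V V *:%R (lincomb c f) (lincomb_is_linear c f).

Lemma lincombC c f (h : {linear V -> V}) x :
  (forall i, h (f i x) = f i (h x)) -> h (lincomb c f x) = lincomb c f (h x).
Proof.
move=> fh; rewrite /lincomb linear_sum; apply: eq_bigr => i _.
by rewrite linearZ /= fh.
Qed.

(** Differentials of Koszul type: the operators [f j] act on the coefficients
    while the [j]-th basis vector is wedged or contracted. *)
Definition wedge_op f P : ext := \sum_j create j (emap (f j) P).
Definition contr_op g P : ext := \sum_j annih j (emap (g j) P).

Fact wedge_op_is_linear f : linear (wedge_op f).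
Proof.
move=> c P Q; rewrite /wedge_op scaler_sumr -big_split; apply: eq_bigr => j _ /=.
by rewrite !linearP.
Qed.
HB.instance Definition _ f :=
  GRing.isLinear.Build K ext ext *:%R (wedge_op f) (wedge_op_is_linear f).

Fact contr_op_is_linear f : linear (contr_op f).
Proof.
move=> c P Q; rewrite /contr_op scaler_sumr -big_split; apply: eq_bigr => j _ /=.
by rewrite !linearP.
Qed.
HB.instance Definition _ g :=
  GRing.isLinear.Build K ext ext *:%R (contr_op g) (contr_op_is_linear g).

Lemma emapC (f g : V -> V) P : (forall x, f (g x) = g (f x)) ->
  emap f (emap g P) = emap g (emap f P).
Proof. by move=> fg; apply/ffunP => S; rewrite !ffunE fg. Qed.

Lemma wedge_op2 f P : (forall i j x, f i (f j x) = f j (f i x)) ->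
  wedge_op f (wedge_op f P) = 0.
Proof.
move=> fC; rewrite /wedge_op; under eq_bigr do rewrite !linear_sum.
apply: sum_alternating => [j l|j] /=; rewrite !emap_create; last exact: create2.
by rewrite createC (emapC (g := f l)).
Qed.

Lemma contr_op2 g P : (forall i j x, g i (g j x) = g j (g i x)) ->
  contr_op g (contr_op g P) = 0.
Proof.
move=> gC; rewrite /contr_op; under eq_bigr do rewrite !linear_sum.
apply: sum_alternating => [j l|j] /=; rewrite !emap_annih; last exact: annih2.
by rewrite annihC (emapC (g := g l)).
Qed.

(** The terms with two distinct indices cancel by anticommutation. *)
Lemma contr_wedge_op f g P : (forall i j x, i != j -> g i (f j x) = f j (g i x)) ->
  contr_op g (wedge_op f P) + wedge_op f (contr_op g P) =
  \sum_j (annih j (create j (emap (g j) (emap (f j) P))) +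
          create j (annih j (emap (f j) (emap (g j) P)))).
Proof.
move=> fg; rewrite /wedge_op /contr_op; under eq_bigr do rewrite !linear_sum.
under [X in _ + X]eq_bigr do rewrite !linear_sum.
rewrite [X in _ + X]exchange_big -big_split; apply: eq_bigr => j _ /=.
rewrite -big_split (bigD1 j) //= [X in _ + X]big1 => [|l lj].
  by rewrite addr0 emap_annih emap_create.
rewrite emap_annih emap_create annih_create 1?eq_sym //.
by rewrite (emapC (g := f l)) ?addNr // => x; rewrite fg // eq_sym.
Qed.

Lemma wedge_op_edelta f S v : wedge_op f (edelta S v) =
  \sum_j if j \in S then 0 else (-1) ^+ below S j *: edelta (j |: S) (f j v).
Proof.
by apply: eq_bigr => j _; rewrite emap_edelta create_edelta; case: ifP; rewrite // linearZ.
Qed.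

Lemma contr_op_edelta f S v : contr_op f (edelta S v) =
  \sum_j if j \in S then (-1) ^+ below S j *: edelta (S :\ j) (f j v) else 0.
Proof.
by apply: eq_bigr => j _; rewrite emap_edelta annih_edelta; case: ifP; rewrite // linearZ.
Qed.

Lemma annih_create_edelta j S (v : V) :
  annih j (create j (edelta S v)) = if j \in S then 0 else edelta S v.
Proof.
rewrite create_edelta; case: ifPn => [_|jS]; first by rewrite linear0.
rewrite annih_edelta setU11 setU1K // scalerA -exprD below_setU1 // ltnn addnn.
by rewrite -signr_odd odd_double scale1r.
Qed.

Lemma create_annih_edelta j S (v : V) :
  create j (annih j (edelta S v)) = if j \in S then edelta S v else 0.
Proof.
rewrite annih_edelta; case: ifPn => [jS|_]; last by rewrite linear0.
rewrite create_edelta setD11 setD1K // scalerA -exprD (below_setD1 j jS) ltnn addnn.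
by rewrite -signr_odd odd_double scale1r.
Qed.

Lemma contr_wedge_op_edelta f g S v : (forall i j x, i != j -> g i (f j x) = f j (g i x)) ->
  contr_op g (wedge_op f (edelta S v)) + wedge_op f (contr_op g (edelta S v)) =
  \sum_j edelta S (if j \in S then f j (g j v) else g j (f j v)).
Proof.
move=> fg; rewrite contr_wedge_op //; apply: eq_bigr => j _.
rewrite !emap_edelta annih_create_edelta create_annih_edelta.
by case: ifP; rewrite ?add0r ?addr0.
Qed.

End OperatorKoszul.

(** * Exactness of the Koszul complex *)

Section KoszulDepth.
Variables (A : comNzRingType) (d : nat).
Implicit Types (p q : A) (zs ys : seq A).
Local Notation ext := {ffun {set 'I_d} -> A^o}.

(** Membership in the ideal generated by [zs], with the same recursion as
    [regular_seq]; working with congruences avoids the quotient rings. *)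
Fixpoint in_ideal zs p : Prop :=
  if zs is z :: zs' then exists q, in_ideal zs' (p - z * q) else p = 0.

(** Regularity of the sequence read from its last entry to its first. *)
Fixpoint regular_seq zs : Prop :=
  if zs is z :: zs' then
    regular_seq zs' /\ (forall p, in_ideal zs' (z * p) -> in_ideal zs' p)
  else True.

Lemma in_ideal0 zs : in_ideal zs 0.
Proof. by elim: zs => //= z zs IH; exists 0; rewrite mulr0 subr0. Qed.

Lemma in_idealD zs p q : in_ideal zs p -> in_ideal zs q -> in_ideal zs (p + q).
Proof.
elim: zs p q => [|z zs IH] p q /=; first by move=> -> ->; rewrite addr0.
move=> [p' Pp] [q' Qq]; exists (p' + q').
by rewrite mulrDr opprD addrACA; exact: IH.
Qed.

Lemma in_idealM zs p q : in_ideal zs q -> in_ideal zs (p * q).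
Proof.
elim: zs p q => [|z zs IH] p q /=; first by move=> ->; rewrite mulr0.
by move=> [q' Qq]; exists (p * q'); rewrite mulrCA -mulrBr; exact: IH.
Qed.

Lemma in_ideal_sum (I : finType) zs (F : I -> A) :
  (forall i, in_ideal zs (F i)) -> in_ideal zs (\sum_i F i).
Proof.
by move=> PF; apply: big_ind => //; [exact: in_ideal0|exact: in_idealD].
Qed.

Lemma ewedge_in_ideal zs (m : 'rV[A]_d) (w : ext) (S : {set 'I_d}) :
  (forall T : {set 'I_d}, (#|T| < #|S|)%N -> in_ideal zs (w T)) -> in_ideal zs (ewedge m w S).
Proof.
move=> Pw; rewrite sum_ffunE; apply: in_ideal_sum => i; rewrite !ffunE.
apply: in_idealM; case: ifP => iS; last exact: in_ideal0.
by apply: in_idealM; apply: Pw; rewrite (cardsD1 i S) iS.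
Qed.

Lemma econtr_in_ideal zs (n : 'rV[A]_d) (w : ext) (S : {set 'I_d}) :
  (forall T : {set 'I_d}, (#|T| <= #|S|.+1)%N -> in_ideal zs (w T)) -> in_ideal zs (econtr n w S).
Proof.
move=> Pw; rewrite sum_ffunE; apply: in_ideal_sum => i; rewrite !ffunE.
apply: in_idealM; case: ifP => iS; first exact: in_ideal0.
by apply: in_idealM; apply: Pw; rewrite cardsU1 iS.
Qed.

(** Let z = m.n be the last entry of [ys]. By the Clifford relation, contraction
    by [n] is a homotopy for multiplication by z, so modulo [zs] one has
    z w = m ^ (n . w). Hence [n . w] is closed modulo z and [zs], and is by
    induction of the form m ^ v + z b. Then z (w - m ^ b) vanishes modulo [zs],
    and z can be cancelled. *)
Lemma koszul_exact_mod (m : 'rV[A]_d) ys zs :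
  {in ys, forall y, exists n : 'rV[A]_d, y = \sum_i m 0 i * n 0 i} ->
  regular_seq (ys ++ zs) ->
  forall w : ext, (forall S : {set 'I_d}, (#|S| <= size ys)%N -> in_ideal zs (ewedge m w S)) ->
  exists v : ext, forall S : {set 'I_d}, (#|S| < size ys)%N -> in_ideal zs (w S - ewedge m v S).
Proof.
elim/last_ind: ys zs => [|ys z IH] zs ysI reg w Pw; first by exists 0.
rewrite cat_rcons in reg.
have {reg}[reg_zs reg_z] : regular_seq (ys ++ z :: zs) /\
    (forall p, in_ideal zs (z * p) -> in_ideal zs p).
  by split=> //; elim: ys reg {IH ysI Pw} => [[]|y ys IH [/IH]].
have [|n zE] := ysI z; first by rewrite mem_rcons mem_head.
rewrite size_rcons in Pw *.
have clif S : econtr n (ewedge m w) S + ewedge m (econtr n w) S = z * w S.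
  have := congr1 (fun P : ext => P S) (econtr_ewedge m n w).
  by rewrite !ffunE -zE.
have Pw' (S : {set 'I_d}) : (#|S| <= size ys)%N -> in_ideal zs (z * w S - ewedge m (econtr n w) S).
  by move=> Ss; rewrite -clif addrK; apply: econtr_in_ideal => T Ts; apply: Pw; lia.
have [|S Ss|v Pv] := IH (z :: zs) _ reg_zs (econtr n w).
- by move=> y ys_y; apply: ysI; rewrite mem_rcons inE ys_y orbT.
- exists (w S) => /=; rewrite -opprB -mulN1r; apply: in_idealM; exact: Pw'.
have [b Pb] : exists b : ext, forall S : {set 'I_d}, (#|S| < size ys)%N ->
    in_ideal zs (econtr n w S - ewedge m v S - z * b S).
  have /choice[b Pb] : forall S : {set 'I_d}, exists x : A, (#|S| < size ys)%N ->
      in_ideal zs (econtr n w S - ewedge m v S - z * x).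
    by move=> S; case: (ltnP #|S| (size ys)) => [/Pv[x Px]|_]; [exists x|exists 0].
  by exists [ffun S => b S] => S Ss; rewrite ffunE; exact: Pb.
exists b => S; rewrite ltnS => Ss; apply: reg_z.
have -> : z * (w S - ewedge m b S) = (z * w S - ewedge m (econtr n w) S) +
    ewedge m (econtr n w - ewedge m v - z *: b) S.
  rewrite !linearB linearZ /= ewedge2 !ffunE subr0 addrA subrK mulrBr //.
apply: in_idealD; first exact: Pw'.
by apply: ewedge_in_ideal => T TS; rewrite !ffunE; apply: Pb; lia.
Qed.

(** The regular sequence is only required to lie in the ideal of the entries of
    [m]: powers of variables will do. *)
Lemma koszul_exact (m : 'rV[A]_d) zs :
  {in zs, forall z, exists n : 'rV[A]_d, z = \sum_i m 0 i * n 0 i} ->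
  regular_seq zs -> forall w : ext, ewedge m w = 0 ->
  exists v : ext, forall S : {set 'I_d}, (#|S| < size zs)%N -> w S = ewedge m v S.
Proof.
move=> zsI reg w w0; have [||v Pv] := @koszul_exact_mod m zs [::] zsI _ w.
- by rewrite cats0.
- by move=> S _; rewrite w0 ffunE.
by exists v => S /Pv /= /eqP; rewrite subr_eq0 => /eqP.
Qed.

End KoszulDepth.

(** * Roots of unity *)

Section RootsOfUnity.
Variable R : realType.
Local Notation C := R[i].
Local Notation cexp := (cexp2pi R).
Implicit Types s t : rat.

Lemma cexp2pi0 : cexp 0 = 1.
Proof. by rewrite /cexp2pi rmorph0 mulr0 cos0 sin0. Qed.

Lemma cexp2piD s t : cexp (s + t) = cexp s * cexp t.
Proof.
rewrite /cexp2pi rmorphD mulrDr cosD sinD.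
by apply/eqP; rewrite eq_complex /= eqxx /=; apply/eqP; ring.
Qed.

Lemma cexp2pi_neq0 t : cexp t != 0.
Proof.
apply/negP => /eqP t0; have := cexp2piD t (- t).
by rewrite subrr cexp2pi0 t0 mul0r => /eqP; rewrite oner_eq0.
Qed.

Lemma cexp2pi_mulrn t n : cexp (t *+ n) = cexp t ^+ n.
Proof.
by elim: n => [|n IH]; rewrite ?mulr0n ?cexp2pi0 // mulrS cexp2piD IH exprS.
Qed.

Lemma cexp2pi_sum (I : finType) (P : pred I) (F : I -> rat) :
  cexp (\sum_(i | P i) F i) = \prod_(i | P i) cexp (F i).
Proof. by apply: (big_morph _ cexp2piD cexp2pi0). Qed.

Lemma cexp2pi_int t : t \is a Num.int -> cexp t = 1.
Proof.
have one : cexp 1 = 1.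
  by rewrite /cexp2pi rmorph1 mulr1 mulr_natl cos2pi sin2pi.
case/intrP => -[n|n] ->; first by rewrite -pmulrn cexp2pi_mulrn one expr1n.
have := cexp2piD (Negz n)%:~R (1 *+ n.+1).
by rewrite NegzE mulrNz addNr cexp2pi0 cexp2pi_mulrn one expr1n mulr1 => <-.
Qed.

(** On [[0, 1)] the half-angle [sin (pi * f)] vanishes only at 0. *)
Lemma cexp2pi_eq1 t : cexp t = 1 -> t \is a Num.int.
Proof.
move=> t1; have [f f0 f1] : exists2 f, t - (Num.floor t)%:~R = f & 0 <= f < 1.
  eexists; first by []; rewrite subr_ge0 floor_le /= ltrBlDl.
  by have := floorD1_gt t; rewrite intrD addrC addrC.
have : cexp f = 1 by rewrite -f0 cexp2piD t1 mul1r cexp2pi_int // rpredN intr_int.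
suff sf : cexp f = 1 -> f = 0.
  by move=> /sf fE; move: f0; rewrite fE => /eqP; rewrite subr_eq0 => /eqP->; exact: intr_int.
case/eqP: (f0) => _; move/eqP; rewrite eq_complex /= => /andP[/eqP c1 _].
case/andP: f1 => f_ge0 f_lt1; apply/eqP; rewrite eq_le f_ge0 andbT leNgt; apply/negP => f_gt0.
have : 0 < sin (pi * ratr f : R).
  apply: sin_gt0_pi; rewrite mulr_gt0 ?pi_gt0 ?ltr0q //=.
  by rewrite gtr_pMr ?pi_gt0 // -[1](@rmorph1 _ _ (@ratr R)) ltr_rat.
suff -> : sin (pi * ratr f : R) = 0 by rewrite ltxx.
move: c1; rewrite -mulrA mulr_natl cos_mulr2n cos2sin2 => E.
by apply/eqP; rewrite -sqrf_eq0; apply/eqP; lra.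
Qed.

Lemma cexp2pi_inj s t : 0 <= s < 1 -> 0 <= t < 1 -> cexp s = cexp t -> s = t.
Proof.
move=> /andP[s0 s1] /andP[t0 t1] st; have : cexp (s - t) = 1.
  by apply: (mulIf (cexp2pi_neq0 t)); rewrite -cexp2piD subrK mul1r.
move/cexp2pi_eq1/intrP => [n nE].
have n1 : (n%:~R : rat) < 1%:~R by rewrite -nE; lra.
have n2 : (-1)%:~R < (n%:~R : rat) by rewrite -nE; lra.
move: n1 n2; rewrite !ltr_int => n1 n2; have n0 : n = 0 by lia.
by move/eqP: nE; rewrite n0 subr_eq0 => /eqP.
Qed.

(** The [n] values [cexp (k / n)] already exhaust the roots of 'X^n - 1. *)
Lemma unity_root_cexp2pi (z : C) n : (0 < n)%N -> z ^+ n = 1 ->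
  exists2 h, 0 <= h < 1 & cexp h = z.
Proof.
move=> n0 zn; pose rs := [seq cexp (k%:R / n%:R) | k <- iota 0 n].
have n0' : 0 < n%:R :> rat by rewrite ltr0n.
have k01 k : k \in iota 0 n -> 0 <= (k%:R / n%:R : rat) < 1.
  by rewrite mem_iota /= => kn; rewrite divr_ge0 ?ler0n //= ltr_pdivrMr // mul1r ltr_nat.
have [/mapP[k kn ->]|zrs] := boolP (z \in rs); first by exists (k%:R / n%:R); rewrite ?k01.
suff : (size (z :: rs) <= n)%N by rewrite /= size_map size_iota ltnn.
apply: max_unity_roots => //=; last first.
  rewrite zrs map_inj_in_uniq ?iota_uniq // => k l kn ln /cexp2pi_inj.
  move=> /(_ (k01 _ kn) (k01 _ ln)) /(mulIf _) kl; apply/eqP; rewrite -(eqr_nat rat).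
  by apply/eqP/kl; rewrite invr_eq0 lt0r_neq0.
apply/andP; split; first by rewrite unity_rootE zn.
apply/allP => _ /mapP[k _ ->]; rewrite unity_rootE -cexp2pi_mulrn.
by rewrite -[_ / _ *+ n]mulr_natr mulfVK ?lt0r_neq0 // cexp2pi_int ?natr_int.
Qed.

Lemma cexp2pi_sum_roots m : (1 < m)%N -> \sum_(r < m) cexp (r%:R / m%:R) = 0.
Proof.
move=> m1; have m0 : m%:R != 0 :> rat by rewrite pnatr_eq0; lia.

pose z := cexp m%:R^-1; have z1 : z - 1 != 0.
  rewrite subr_eq0; apply/negP => /eqP/cexp2pi_eq1/intrP[n nE].
  have n0 : (0%:~R : rat) < n%:~R by rewrite -nE invr_gt0 ltr0n; lia.
  have n1 : (n%:~R : rat) < 1%:~R by rewrite -nE invf_lt1 ?ltr1n // ltr0n; lia.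
  by move: n0 n1; rewrite !ltr_int; lia.
apply: (mulfI z1); rewrite mulr0.
under eq_bigr do rewrite mulr_natl cexp2pi_mulrn.
rewrite -subrX1 -cexp2pi_mulrn -[_ *+ m]mulr_natr mulVf // cexp2pi_int ?subrr //.
Qed.

End RootsOfUnity.

(** * The Jacobian ideal of a restricted potential *)

Section JacobianIdeal.
Variables (R : realType) (d : nat) (a : 'M[nat]_d) (F : pred 'I_d).
Local Notation C := R[i].
Local Notation Cx := (mpoly.mpoly d C).
Implicit Types (p r : Cx) (e : 'X_{1..d}) (T : {set 'I_d}).

Definition rowm i : 'X_{1..d} := [multinom a i j | j < d].

Lemma potentialE : potential R a = \sum_i 'X_[rowm i].
Proof.
by apply: eq_bigr => i _; rewrite mpolyXE_id; apply: eq_bigr => j _; rewrite mnmE.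
Qed.

(** The rows of [a] whose monomial survives the restriction. *)
Definition inner i := [forall j, (0 < a i j)%N ==> F j].

Lemma innerP i : reflect (forall j, (0 < a i j)%N -> F j) (inner i).
Proof.
by apply: (iffP forallP) => H j; [exact: implyP (H j)|apply/implyP/H].
Qed.

Definition restricted : Cx := \sum_(i | inner i) 'X_[rowm i].

Definition in_jacobian p : Prop :=
  exists c : 'I_d -> Cx, p = \sum_(j | F j) c j * restricted^`M(j).

Lemma in_jacobian0 : in_jacobian 0.
Proof. by exists (fun=> 0); rewrite big1 // => j _; rewrite mul0r. Qed.

Lemma in_jacobianD p r : in_jacobian p -> in_jacobian r -> in_jacobian (p + r).
Proof.
move=> [c ->] [c' ->]; exists (fun j => c j + c' j).
by rewrite -big_split; apply: eq_bigr => j _; rewrite mulrDl.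
Qed.

Lemma in_jacobianM p r : in_jacobian r -> in_jacobian (p * r).
Proof.
move=> [c ->]; exists (fun j => p * c j).
by rewrite mulr_sumr; apply: eq_bigr => j _; rewrite mulrA.
Qed.

Lemma in_jacobian_deriv j : F j -> in_jacobian restricted^`M(j).
Proof.
move=> Fj; exists (fun k => (k == j)%:R); rewrite (bigD1 j) //= eqxx mul1r.
by rewrite big1 ?addr0 // => k /andP[_ /negPf->]; rewrite mul0r.
Qed.

Lemma mulX_deriv j : 'X_j * restricted^`M(j) = \sum_(i | inner i) (a i j)%:R *: 'X_[rowm i].
Proof.
rewrite (raddf_sum (mderiv j)) mulr_sumr; apply: eq_bigr => i _ /=.
rewrite mderivX mnmE -scalerAr -mpolyXD.
have [->|aij] := posnP (a i j); first by rewrite !scale0r.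
congr (_ *: 'X_[_]); apply/mnmP => k; rewrite mnmDE mnmBE mnm1E mnmE.
by case: eqP => [<-|]; lia.
Qed.

(** Inverting the matrix turns the logarithmic derivatives of the potential into
    its single monomials. *)
Lemma in_jacobian_row i : ratmx a \in unitmx -> inner i -> in_jacobian 'X_[rowm i].
Proof.
move=> aU Fi; pose b := invmx (ratmx a).
exists (fun j => (ratr (b j i) : C) *: 'X_j).
under eq_bigr do rewrite -scalerAl mulX_deriv scaler_sumr.
rewrite exchange_big (bigD1 i) //= [X in _ + X]big1 => [|k /andP[Fk ki]].
  rewrite addr0; under eq_bigr do rewrite scalerA; rewrite -scaler_suml.
  suff -> : \sum_(j | F j) ratr (b j i) * (a i j)%:R = 1 :> C by rewrite scale1r.
  have := congr1 (fun M : 'M_d => ratr (M i i) : C) (mulmxV aU).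
  rewrite !mxE eqxx rmorph1 rmorph_sum => E; rewrite -[RHS]E [RHS](bigID F) /=.
  rewrite [X in _ = _ + X]big1 ?addr0 => [|j Fj].
    by apply: eq_bigr => j _; rewrite rmorphM mulrC mxE rmorph_nat.
  by rewrite mxE; case: (posnP (a i j)) => [->|/(innerP _ Fi)]; rewrite ?mul0r ?rmorph0 ?(negPf Fj).
under eq_bigr do rewrite scalerA; rewrite -scaler_suml.
suff -> : \sum_(j | F j) ratr (b j i) * (a k j)%:R = 0 :> C by rewrite scale0r.
have := congr1 (fun M : 'M_d => ratr (M k i) : C) (mulmxV aU).
rewrite !mxE (negPf ki) rmorph0 rmorph_sum => E; rewrite -[RHS]E [RHS](bigID F) /=.
rewrite [X in _ = _ + X]big1 ?addr0 => [|j Fj].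
  by apply: eq_bigr => j _; rewrite rmorphM mulrC mxE rmorph_nat.
by rewrite mxE; case: (posnP (a k j)) => [->|/(innerP _ Fk)]; rewrite ?mul0r ?rmorph0 ?(negPf Fj).
Qed.

Definition in_radical p : Prop := exists n, in_jacobian (p ^+ n).

Lemma in_radical_jacobian p : in_jacobian p -> in_radical p.
Proof. by exists 1%N; rewrite expr1. Qed.

Lemma in_radicalM p r : in_radical r -> in_radical (p * r).
Proof. by case=> n Pn; exists n; rewrite exprMn; exact: in_jacobianM. Qed.

Lemma in_radicalX p n : in_radical (p ^+ n) -> in_radical p.
Proof. by case=> m Pm; exists (n * m)%N; rewrite exprM. Qed.

Lemma in_radicalD p r : in_radical p -> in_radical r -> in_radical (p + r).
Proof.
case=> m Pm [n Pn]; exists (m + n)%N; rewrite exprDn.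
elim/big_ind: _ => [||i _]; [exact: in_jacobian0|exact: in_jacobianD|].
rewrite -mulr_natl; apply: in_jacobianM; case: (leqP n i) => ni.
  by apply: in_jacobianM; rewrite -(subnK ni) exprD; apply: in_jacobianM.
rewrite mulrC; apply: in_jacobianM; have mi : (m <= m + n - i)%N by lia.
by rewrite -(subnK mi) exprD; apply: in_jacobianM.
Qed.

Definition setm T : 'X_{1..d} := [multinom (j \in T : nat) | j < d].

(** A power of the squarefree monomial of [T] is a multiple of 'X_[e]. *)
Lemma in_radical_setm e T : (forall j, (0 < e j)%N -> j \in T) ->
  in_radical 'X_[e] -> in_radical 'X_[setm T].
Proof.
move=> eT /(in_radicalM 'X_[setm T *+ mdeg e - e]); rewrite -mpolyXD.
have -> : (setm T *+ mdeg e - e + e = setm T *+ mdeg e)%MM.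
  apply/mnmP => j; rewrite mnmDE mnmBE mulmnE mnmE subnK //.
  have [->//|/eT->] := posnP (e j); rewrite mul1n.
  by rewrite mdegE (bigD1 j) //= leq_addr.
by rewrite -mpolyXn; exact: in_radicalX.
Qed.

Hypothesis a_unit : ratmx a \in unitmx.
Hypothesis W_nondeg : nondegenerate_potential R a.
(** The coordinates outside F carry a nontrivial character, so no monomial is
    linear in exactly one of them. *)
Hypothesis F_partner : forall i k, ~~ F k -> a i k = 1%N ->
  exists2 l, l != k & (0 < a i l)%N && ~~ F l.

(** At a point supported on [T], these rows give the only terms that can be
    nonzero in the [k]-th derivative, for [k] outside [T]. *)
Definition pointing T k : {set 'I_d} :=
  [set i | (a i k == 1%N) && [forall l, (l != k) && (0 < a i l)%N ==> (l \in T)]].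

Lemma pointingP T k i : reflect
  (a i k = 1%N /\ forall l, l != k -> (0 < a i l)%N -> l \in T) (i \in pointing T k).
Proof.
rewrite inE; apply: (iffP andP) => [[/eqP ak /forallP aT]|[-> aT]]; split=> //.
  by move=> l lk al; have := aT l; rewrite lk al.
by apply/forallP => l; apply/implyP => /andP[]; exact: aT.
Qed.

(** Otherwise the potential has a singular point supported on [T]. All its
    monomials vanish there, since each involves a variable outside [T]; so do the
    derivatives along [T], and for [k] outside [T] the [k]-th derivative is the
    sum of the terms of [pointing T k], whose number is not 1. As the matrix is
    invertible, the arguments of the coordinates can be chosen to make these
    terms proportional to all the roots of unity of that order, whose sum is
    zero. The choices are compatible because a row points to at most one variable
    outside [T]. *)
Lemma nondegenerate_pointing T : T != set0 ->
  (exists i, forall j, (0 < a i j)%N -> j \in T) \/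
  (exists2 k, k \notin T & #|pointing T k| = 1%N).
Proof.
move=> /set0Pn[j0 Tj0]; apply/not_notP => /not_orP[noT nopt].
have outT i : exists2 l, l \notin T & (0 < a i l)%N.
  apply/not_notP => H; apply: noT; exists i => j aij.
  by apply/negP => /negP jT; apply: H; exists j.
have card_pt k : k \notin T -> #|pointing T k| != 1%N.
  by move=> kT; apply/negP => /eqP ?; apply: nopt; exists k.
(* The phases are distributed over all the roots of unity. *)
pose ph i k : rat := (index i (enum (pointing T k)))%:R / #|pointing T k|%:R.
pose s := \col_i (if [pick k | (k \notin T) && (i \in pointing T k)] is Some k
                  then ph i k else 0 : rat).
(* The arguments of the coordinates that give the monomials these phases. *)
pose t := invmx (ratmx a) *m s.
have tE i : \sum_j (a i j)%:R * t j 0 = s i 0.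
  have : (ratmx a *m t) i 0 = s i 0 by rewrite mulKVmx.
  by rewrite [X in X = _]mxE => <-; apply: eq_bigr => j _; rewrite [ratmx a i j]mxE.
have sE i k : k \notin T -> i \in pointing T k -> s i 0 = ph i k.
  move=> kT ik; rewrite mxE; case: pickP => [l /andP[lT il]|/(_ k)]; last by rewrite kT ik.
  suff -> : l = k by [].
  apply/eqP; apply: contraNT lT => lk; case/pointingP: ik => _; apply=> //.
  by case/pointingP: il => ->.
pose x j : C := if j \in T then cexp2pi R (t j 0) else 0.
have ev0 (e : 'X_{1..d}) l : l \notin T -> (0 < e l)%N -> ('X_[e]).@[x] = 0.
  by move=> lT el; rewrite mevalX (bigD1 l) //= /x (negPf lT) expr0n gtn_eqF // mul0r.
have [||k] := W_nondeg (x := x).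
- by exists j0; rewrite /x Tj0 cexp2pi_neq0.
- rewrite potentialE linear_sum big1 //= => i _; have [l lT il] := outT i.
  by rewrite (ev0 _ l) // mnmE.
apply/negP; rewrite negbK potentialE; apply/eqP.
rewrite (raddf_sum (mderiv k)) (raddf_sum (meval x)) /=.
under eq_bigr do rewrite mderivX mevalZ mnmE.
have ev_out i : i \notin pointing T k ->
    (a i k)%:R * ('X_[rowm i - U_(k)]).@[x] = 0 :> C.
  move=> ik; have [->|ak] := posnP (a i k); first by rewrite mul0r.
  suff [l lT el] : exists2 l, l \notin T & (0 < (rowm i - U_(k))%MM l)%N.
    by rewrite (ev0 _ l) ?mulr0.
  have [l lT al] := outT i.
  have [lk|lk] := eqVneq l k; last first.
    by exists l => //; rewrite mnmBE mnm1E mnmE eq_sym (negPf lk) subn0.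
  rewrite lk in lT al; have [a1|a2] := eqVneq (a i k) 1%N; last first.
    by exists k => //; rewrite mnmBE mnm1E mnmE eqxx; lia.
  apply/not_notP => H; case/negP: ik; apply/pointingP; split=> // l' l'k al'.
  apply/negP => /negP l'T; apply: H; exists l' => //.
  by rewrite mnmBE mnm1E mnmE eq_sym (negPf l'k) subn0.
have [kT|kT] := boolP (k \in T).
  rewrite big1 // => i _; apply: ev_out; apply/negP => /pointingP[_ aT].
  have [l lT al] := outT i; case/negP: (lT); apply: aT => //.
  by apply: contraNneq lT => ->.
rewrite (bigID (mem (pointing T k))) /= [X in _ + X]big1 ?addr0; last by move=> i /ev_out.
transitivity (\sum_(i in pointing T k) cexp2pi R (- t k 0) * cexp2pi R (ph i k)).
  apply: eq_bigr => i ik; have [ak aT] := pointingP _ _ _ ik.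
  rewrite ak mul1r mevalX -cexp2piD.
  rewrite -(sE _ _ kT ik) -tE [X in cexp2pi R (_ + X)](bigD1 k) //= ak mul1r addKr cexp2pi_sum.
  rewrite [LHS](bigD1 k) //= mnmBE mnm1E mnmE ak eqxx subnn expr0 mul1r.
  apply: eq_bigr => l lk; rewrite mnmBE mnm1E mnmE eq_sym (negPf lk) subn0.
  rewrite mulr_natl cexp2pi_mulrn; have [->|/(aT _ lk) lT] := posnP (a i l).
    by rewrite !expr0.
  by rewrite /x lT.
rewrite -mulr_sumr; apply/eqP; rewrite mulf_eq0; apply/orP; right; apply/eqP.
have -> : \sum_(i in pointing T k) cexp2pi R (ph i k) =
    \sum_(r < #|pointing T k|) cexp2pi R (r%:R / #|pointing T k|%:R).
  rewrite -big_enum /= (big_nth j0) big_mkord -cardE; apply: eq_bigr => r _.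
  by rewrite /ph index_uniq ?enum_uniq // -cardE.
case: (ltngtP #|pointing T k| 1) (card_pt k kT) => // [c0|c1] _; last exact: cexp2pi_sum_roots.
by apply: big1 => -[r rk] _; move: rk; lia.
Qed.

(** Descending induction on [T]. If a monomial of the potential only involves
    variables of [T], it is in the Jacobian ideal. Otherwise some [k]-th derivative
    has a single term in the variables of [T]; the other terms involve variables
    outside [T], and multiplied by those of [T] they are in the radical by
    induction. So is the single term. *)
Lemma in_radical_subset T : T != set0 -> {subset T <= F} -> in_radical 'X_[setm T].
Proof.
have [n] := ubnP #|~: T|; elim: n => // n IHn in T *; rewrite ltnS => Tn T0 TF.
have IHl l e : l \notin T -> F l -> (0 < e l)%N -> in_radical ('X_[setm T] * 'X_[e]).
  move=> lT Fl el; have -> : e = (e - U_(l) + U_(l))%MM.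
    by apply/mnmP => j; rewrite mnmDE mnmBE mnm1E; case: eqP => [<-|]; lia.
  rewrite mpolyXD mulrCA; apply: in_radicalM; rewrite -mpolyXD.
  have -> : (setm T + U_(l) = setm (l |: T))%MM.
    apply/mnmP => j; rewrite mnmDE mnm1E !mnmE !inE eq_sym.
    by case: (j =P l) => [->|_]; rewrite ?(negPf lT) ?addn0.
  apply: IHn; last by move=> j; rewrite !inE => /orP[/eqP->|/TF].
    apply: leq_trans Tn; rewrite setCU [X in (_ < X)%N](cardsD1 l) inE lT /= ltnS.
    by apply: subset_leq_card; apply/fintype.subsetP => j; rewrite !inE.
  by apply/set0Pn; exists l; rewrite setU11.
have [[i iT]|[k kT /eqP/cards1P[i ptE]]] := nondegenerate_pointing T0.
  apply: (@in_radical_setm (rowm i)) => [j|]; first by rewrite mnmE; exact: iT.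
  by apply/in_radical_jacobian/in_jacobian_row => //; apply/innerP => j /iT/TF.
have ik : i \in pointing T k by rewrite ptE set11.
have [ak aT] := pointingP _ _ _ ik.
have Fk : F k.
  apply: contraT => Fk; have [l lk /andP[al]] := F_partner Fk ak.
  by move/negP; case; exact: TF (aT _ lk al).
have Fi : inner i.
  apply/innerP => l al; have [->//|lk] := eqVneq l k.
  by apply: TF; exact: aT.
apply: (@in_radical_setm (setm T + (rowm i - U_(k)))) => [j|].
  rewrite mnmDE mnmBE mnm1E !mnmE; have [//|jT] := boolP (j \in T).
  case: eqP => [<-|/eqP kj]; first by rewrite ak.
  by rewrite subn0 /= add0n => /(aT _ _); rewrite eq_sym (negPf jT) => /(_ kj).
rewrite mpolyXD; have -> : 'X_[rowm i - U_(k)] = restricted^`M(k) +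
    \sum_(i' | inner i' && (i' != i)) (- (a i' k)%:R) *: 'X_[rowm i' - U_(k)] :> Cx.
  rewrite (raddf_sum (mderiv k)) /= (bigD1 i) //= mderivX mnmE ak scale1r -addrA -big_split /=.
  rewrite big1 ?addr0 // => i' _; rewrite mderivX mnmE scaleNr.
  by rewrite addrN.
rewrite mulrDr; apply: in_radicalD; first exact/in_radicalM/in_radical_jacobian/in_jacobian_deriv.
rewrite mulr_sumr; elim/big_ind: _ => [||i' /andP[Fi' i'i]].
- exact/in_radical_jacobian/in_jacobian0.
- exact: in_radicalD.
have [->|ak'] := posnP (a i' k).
  by rewrite oppr0 scale0r mulr0; exact/in_radical_jacobian/in_jacobian0.
rewrite -scalerAr -mul_mpolyC; apply: in_radicalM.
suff [l lT /andP[Fl el]] : exists2 l, l \notin T & F l && (0 < (rowm i' - U_(k))%MM l)%N.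
  exact: (IHl l).
have [a1|a2] := eqVneq (a i' k) 1%N; last first.
  by exists k => //; rewrite Fk mnmBE mnm1E mnmE eqxx; lia.
have : i' \notin pointing T k by rewrite ptE inE.
rewrite inE a1 /= negb_forall => /existsP[l]; rewrite negb_imply => /andP[/andP[lk al] lT].
exists l => //; rewrite mnmBE mnm1E mnmE eq_sym (negPf lk) subn0 al andbT.
by apply: (innerP _ Fi').
Qed.

Lemma var_power_in_jacobian j : F j -> exists n, in_jacobian ('X_j ^+ n).
Proof.
move=> Fj; have := @in_radical_subset [set j]; rewrite /in_radical.
have -> : setm [set j] = U_(j)%MM by apply/mnmP => k; rewrite mnmE inE mnm1E eq_sym.
apply; last by move=> k /set1P->.
by apply/set0Pn; exists j; rewrite set11.
Qed.

End JacobianIdeal.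

(** * The basis of the cone module *)

Section MonomialAlgebra.
Variables (K : choiceType) (C : nzRingType).
Local Notation malg := (monalg.malg K C).

Definition gen (k : K) : malg := monalg.mkmalgU k 1.

Lemma malg_sum_gen (x : malg) : x = \sum_(k <- monalg.msupp x) monalg.mcoeff k x *: gen k.
Proof.
rewrite {1}[x]monalg.monalgE; apply: eq_bigr => k _.
apply/monalg.malgP => l; rewrite monalg.mcoeffZ !monalg.mcoeffU.
by case: eqP; rewrite ?mulr1 ?mulr0.
Qed.

Lemma mcoeff_gen k l : monalg.mcoeff l (gen k) = (k == l)%:R.
Proof. by rewrite monalg.mcoeffU; case: eqP. Qed.

Lemma malg_linear_eq (W : lmodType C) (f g : {linear malg -> W}) :
  (forall k, f (gen k) = g (gen k)) -> f =1 g.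
Proof.
move=> fg x; rewrite [x]malg_sum_gen !raddf_sum.
by apply: eq_bigr => k _; rewrite /= !linearZ /= fg.
Qed.

Section LinearExtension.
Variables (W : lmodType C) (phi : K -> W).

Definition malg_lin (x : malg) : W :=
  \sum_(k <- monalg.msupp x) monalg.mcoeff k x *: phi k.

Lemma malg_linEw (D : {fset K}) (x : malg) : (monalg.msupp x `<=` D)%fset ->
  malg_lin x = \sum_(k <- D) monalg.mcoeff k x *: phi k.
Proof.
move=> sD; apply: big_fset_incl => // k _ kx.
by rewrite monalg.mcoeff_outdom // scale0r.
Qed.

Fact malg_lin_is_linear : linear malg_lin.
Proof.
move=> c x y.
pose D := (monalg.msupp x `|` monalg.msupp y `|` monalg.msupp (c *: x + y))%fset.
have xD : (monalg.msupp x `<=` D)%fset by rewrite /D -fsetUA fsubsetUl.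
have yD : (monalg.msupp y `<=` D)%fset.
  by rewrite /D (fsetUC (monalg.msupp x)) -fsetUA fsubsetUl.
rewrite !(@malg_linEw D) ?fsubsetUr // scaler_sumr -big_split /=; apply: eq_bigr => k _.
by rewrite monalg.mcoeffD monalg.mcoeffZ scalerDl scalerA.
Qed.
HB.instance Definition _ :=
  GRing.isLinear.Build C malg W *:%R malg_lin malg_lin_is_linear.

Lemma malg_lin_gen k : malg_lin (gen k) = phi k.
Proof.
rewrite (@malg_linEw [fset k]%fset) ?monalg.msuppU_le //.
by rewrite big_seq_fset1 mcoeff_gen eqxx scale1r.
Qed.

End LinearExtension.

End MonomialAlgebra.

Section Pairing.
Variables (d : nat) (a : 'M[nat]_d).
Implicit Types m n : 'rV[rat]_d.

(** [m] is read as a monomial with these exponents, u_i being the [i]-th monomial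
    of the potential. *)
Definition expo m j : rat := pairing a m (vgen j).

Lemma expoE m j : expo m j = (m *m ratmx a) 0 j.
Proof.
rewrite mxE; apply: eq_bigr => i _; rewrite (bigD1 j) //= big1 => [|k kj].
  by rewrite addr0 !mxE !eqxx mulr1.
by rewrite !mxE (negPf kj) andbF mulr0.
Qed.

Lemma pairing_expo m n : pairing a m n = \sum_j expo m j * n 0 j.
Proof.
rewrite /pairing exchange_big; apply: eq_bigr => j _.
by rewrite expoE mxE mulr_suml; apply: eq_bigr => i _; rewrite mxE.
Qed.

Lemma expoD m m' j : expo (m + m') j = expo m j + expo m' j.
Proof. by rewrite !expoE mulmxDl mxE. Qed.

Lemma expo_ugen i j : expo (ugen i) j = (a i j)%:R.
Proof. by rewrite expoE -rowE !mxE. Qed.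

Lemma pairing_ugen_vgen i j : pairing a (ugen i) (vgen j) = (a i j)%:R.
Proof. exact: expo_ugen. Qed.

Lemma pairingDl m m' n : pairing a (m + m') n = pairing a m n + pairing a m' n.
Proof.
rewrite !pairing_expo -big_split; apply: eq_bigr => j _.
by rewrite expoD mulrDl.
Qed.

Lemma dual_coneKP m : dual_coneK a m <-> forall j, 0 <= expo m j.
Proof.
split=> [Hm j|Hm n Hn].
  by apply: Hm => k; rewrite mxE ler0n.
by rewrite pairing_expo; apply: sumr_ge0 => j _; apply: mulr_ge0.
Qed.

Lemma orthogonalP m n : (forall j, 0 <= expo m j) -> (forall j, 0 <= n 0 j) ->
  (pairing a m n = 0 <-> forall j, expo m j * n 0 j = 0).
Proof.
move=> Hm Hn; rewrite pairing_expo; split=> [mn0 j|mn0]; last by rewrite big1.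
apply/eqP; apply: contraTT isT => /negPf nz; have : \sum_j expo m j * n 0 j == 0 by rewrite mn0.
by rewrite psumr_eq0 => [/allP/(_ j (mem_index_enum _))|k _]; rewrite ?nz ?mulr_ge0.
Qed.

End Pairing.

Section ConeModule.
Variables (R : realType) (d : nat) (a : 'M[nat]_d) (G : {fset 'rV[R[i]]_d}).
Local Notation C := R[i].
Local Notation V := (cone_module a G).
Local Notation expo := (expo a).
Implicit Types (m n : 'rV[rat]_d) (k : basis_index a G) (S : {set 'I_d}).
Hypothesis G_subgroup : subgroup_Aut a G.
Hypothesis a_unit : ratmx a \in unitmx.

Lemma rowm_inj : injective (rowm a).
Proof.
move=> i i' ii'; have E : row i (ratmx a) = row i' (ratmx a).
  apply/rowP => j; rewrite !mxE; have := congr1 (fun e : 'X_{1..d} => e j) ii'.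
  by rewrite !mnmE => ->.
have := congr1 (fun r => r *m invmx (ratmx a)) E; rewrite -!row_mul mulmxV //.
by move/rowP/(_ i); rewrite !mxE eqxx; case: eqP => // _ /eqP; rewrite oner_eq0.
Qed.

Lemma diag_actX (g : 'rV[C]_d) (e : 'X_{1..d}) :
  diag_act g 'X_[e] = (\prod_j g 0 j ^+ e j) *: 'X_[e].
Proof.
rewrite /diag_act comp_mpolyX.
transitivity (\prod_j (g 0 j *: 'X_j : mpoly.mpoly d C) ^+ e j).
  by apply: eq_bigr => j _; congr (_ ^+ _); exact: tnth_mktuple.
by under eq_bigr do rewrite exprZn; rewrite scaler_prod [in RHS]mpolyXE_id.
Qed.

Fact diag_act_is_linear (g : 'rV[C]_d) : linear (@diag_act R d g).
Proof. by move=> c p r; rewrite /diag_act linearP. Qed.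
HB.instance Definition _ g := GRing.isLinear.Build C
  (mpoly.mpoly d C) (mpoly.mpoly d C) *:%R (@diag_act R d g) (diag_act_is_linear g).

(** The rows of [a] are distinct, so the invariance of the potential is that of
    each of its monomials. *)
Lemma row_invariant g i : g \in G -> \prod_j g 0 j ^+ a i j = 1.
Proof.
move=> gG; have [/(_ g gG)[_ gW] _ _ _] := G_subgroup.
have := congr1 (mcoeff (rowm a i)) gW.
rewrite potentialE (raddf_sum (diag_act g)) !(raddf_sum (mcoeff _)) /=.
rewrite (bigD1 i) //= big1 => [|i' i'i]; last first.
  by rewrite diag_actX mcoeffZ mcoeffX (inj_eq rowm_inj) (negPf i'i) mulr0.
rewrite (bigD1 i) //= [X in _ = _ + X]big1 => [|i' i'i]; last first.
  by rewrite mcoeffX (inj_eq rowm_inj) (negPf i'i).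
rewrite diag_actX mcoeffZ mcoeffX eqxx mulr1 !addr0 => E.
by rewrite -[RHS]E; apply: eq_bigr => j _; rewrite mnmE.
Qed.

Lemma latticeN_shift n n' : (forall j, n' 0 j \is a Num.int) ->
  latticeN G (n' + n) <-> latticeN G n.
Proof.
move=> n'Z; rewrite /latticeN; set x := \row_j _; set y := \row_j _.
suff -> : x = y by [].
by apply/rowP => j; rewrite !mxE cexp2piD cexp2pi_int ?mul1r.
Qed.

Lemma pairing_ugen_int i n : latticeN G n -> pairing a (ugen i) n \is a Num.int.
Proof.
move=> /(row_invariant i) E; apply: (@cexp2pi_eq1 R).
rewrite pairing_expo cexp2pi_sum -[RHS]E; apply: eq_bigr => j _.
by rewrite expo_ugen mxE mulr_natl cexp2pi_mulrn.
Qed.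

Lemma latticeM_shift m i : latticeM a G (ugen i + m) <-> latticeM a G m.
Proof.
split=> mM n nN; have := mM n nN; first rewrite pairingDl.
  by rewrite rpredDl //; exact: pairing_ugen_int.
by move=> mn; rewrite pairingDl rpredD //; exact: pairing_ugen_int.
Qed.

(** The support condition on a pair; the rest of [basis_pred] is about lattices. *)
Definition disjoint_pair m n : Prop :=
  forall j, [/\ 0 <= expo m j, 0 <= n 0 j & expo m j * n 0 j = 0].

Lemma basis_predP m n : basis_pred a G (m, n) <->
  [/\ latticeM a G m, latticeN G n & disjoint_pair m n].
Proof.
split=> [[/dual_coneKP mK mM nK nN /orthogonalP mn]|[mM nN mn]].
  by split=> // j; split=> //; exact: mn.
have mK j : 0 <= expo m j by have [] := mn j.
have nK j : 0 <= n 0 j by have [] := mn j.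
split=> //; first exact/dual_coneKP.
by apply/orthogonalP => // j; have [] := mn j.
Qed.

Lemma mono_val k : mono a G (val k).1 (val k).2 = gen C k.
Proof. by rewrite /mono -surjective_pairing valK. Qed.

Lemma monoP m n : mono a G m n = 0 /\ ~ basis_pred a G (m, n) \/
  (exists2 k : basis_index a G, val k = (m, n) & mono a G m n = gen C k).
Proof.
rewrite /mono; case: insubP => [k _ kE|/asboolPn nb]; [right|by left].
by exists k.
Qed.

Lemma mono_eq0 m n : ~ basis_pred a G (m, n) -> mono a G m n = 0.
Proof.
move=> nb; have [[]//|[k kE _]] := monoP m n.
by case: nb; rewrite -kE; apply/asboolP; exact: (valP k).
Qed.

Lemma val_basis_pred k : basis_pred a G ((val k).1, (val k).2).
Proof. by rewrite -surjective_pairing; apply/asboolP; exact: (valP k). Qed.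

HB.instance Definition _ m n := GRing.isLinear.Build C V V *:%R
  (@mono_mul R d a G m n) (@mono_mul_is_linear R d a G m n).

Lemma mono_mul_gen m n k :
  mono_mul m n (gen C k) = mono a G (m + (val k).1) (n + (val k).2).
Proof.
exact: (malg_lin_gen (fun k => mono a G (m + (val k).1) (n + (val k).2)) k).
Qed.

(** The hypothesis says that a product of monomials is zero as soon as its second
    factor is. *)
Lemma mono_mul_mono m n m' n' :
  (basis_pred a G (m + m', n + n') -> basis_pred a G (m', n')) ->
  mono_mul m n (mono a G m' n') = mono a G (m + m') (n + n').
Proof.
move=> H; have [[-> nb]|[k kE ->]] := monoP m' n'; last by rewrite mono_mul_gen kE.
by rewrite linear0 mono_eq0 // => /H.
Qed.

End ConeModule.

(** * Reduction along the contraction part of the differential *)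

Section Reduction.
Variables (C : numFieldType) (d : nat) (B : choiceType) (V : lmodType C).
Local Notation ext V := {ffun {set 'I_d} -> V}.
Variables (gen : B -> V) (coef : B -> {linear V -> C^o}) (basis_supp : V -> seq B).
Hypothesis coef_gen : forall k l, coef l (gen k) = (k == l)%:R.
Hypothesis sum_gen : forall x, x = \sum_(k <- basis_supp x) coef k x *: gen k.
Hypothesis basis_suppP : forall x k, k \in basis_supp x -> coef k x != 0.
Variable scale_gen : (B -> C) -> {linear V -> V}.
Hypothesis scale_genE : forall w k, scale_gen w (gen k) = w k *: gen k.

(** A basis element stands for a product of a monomial in variables x_j and one
    in variables y_j, with these exponents and without common index. *)
Variables (xe ye : B -> 'I_d -> rat).
Hypothesis xe_ge0 : forall k j, 0 <= xe k j.
Hypothesis ye_ge0 : forall k j, 0 <= ye k j.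
Hypothesis xye0 : forall k j, xe k j * ye k j = 0.

Variables (a : 'M[nat]_d) (mulx muly divy : 'I_d -> {linear V -> V}).
Hypothesis mulx_gen : forall i k, mulx i (gen k) = 0 \/ exists2 l, mulx i (gen k) = gen l &
  (forall j, xe l j = (a i j)%:R + xe k j) /\ ye l =1 ye k.
Hypothesis muly_gen : forall j k, muly j (gen k) = 0 \/ exists2 l, muly j (gen k) = gen l &
  xe l =1 xe k /\ (forall i, ye l i = (i == j)%:R + ye k i).
Hypothesis divy_gen : forall j k, divy j (gen k) = 0 \/ exists2 l, divy j (gen k) = gen l &
  xe l =1 xe k /\ (forall i, ye l i = - (i == j)%:R + ye k i).
Hypothesis mulxC : forall i i' x, mulx i (mulx i' x) = mulx i' (mulx i x).
Hypothesis mulyC : forall j l x, muly j (muly l x) = muly l (muly j x).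
Hypothesis mulx_muly : forall i j x, mulx i (muly j x) = muly j (mulx i x).
Hypothesis mulx_muly_eq0 : forall i j x, (a i j)%:R *: mulx i (muly j x) = 0.
Hypothesis muly_divyC : forall j l x, j != l -> muly j (divy l x) = divy l (muly j x).
Hypothesis muly_divy : forall j k, muly j (divy j (gen k)) = (1 <= ye k j)%R%:R *: gen k.
Hypothesis divy_muly : forall j k, divy j (muly j (gen k)) = (xe k j == 0)%R%:R *: gen k.
Implicit Types (k : B) (S : {set 'I_d}) (P Q : ext V).

Lemma basis_linear_eq (W : lmodType C) (f g : {linear V -> W}) :
  (forall k, f (gen k) = g (gen k)) -> f =1 g.
Proof.
move=> fg x; rewrite [x]sum_gen !linear_sum; apply: eq_bigr => k _.
by rewrite !linearZ fg.
Qed.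

Lemma ext_gen_eq (W : lmodType C) (f g : {linear ext V -> W}) :
  (forall S k, f (edelta S (gen k)) = g (edelta S (gen k))) -> f =1 g.
Proof.
move=> fg; apply: ext_linear_eq => S v.
rewrite -[LHS]/((f \o edelta S) v) -[RHS]/((g \o edelta S) v).
by apply: basis_linear_eq => k; exact: fg.
Qed.

(** Multiplication by the logarithmic derivative 'X_j * W^`M(j), where [mulx i]
    multiplies by the [i]-th monomial of W. *)
Definition mulxdW j : V -> V := lincomb (fun i => (a i j)%:R) mulx.
HB.instance Definition _ j := GRing.Linear.on (mulxdW j).

Definition Dwedge : ext V -> ext V := wedge_op (fun j => mulxdW j : {linear V -> V}).
Definition Dcontr : ext V -> ext V := contr_op muly.
Definition Hcontr : ext V -> ext V := wedge_op divy.
HB.instance Definition _ := GRing.Linear.on Dwedge.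
HB.instance Definition _ := GRing.Linear.on Dcontr.
HB.instance Definition _ := GRing.Linear.on Hcontr.

(** The operator d^A, written in the basis of M dual to the v_j. *)
Definition Dtot P : ext V := Dwedge P + Dcontr P.

Fact Dtot_is_linear : linear Dtot.
Proof. by move=> c P Q; rewrite /Dtot !linearP scalerDr addrACA. Qed.
HB.instance Definition _ := GRing.isLinear.Build C (ext V) (ext V) *:%R Dtot Dtot_is_linear.

Lemma mulxdWC j l (x : V) : mulxdW j (mulxdW l x) = mulxdW l (mulxdW j x).
Proof.
apply: (@lincombC _ _ _ _ _ (mulxdW j)) => i /=; symmetry.
by apply: (@lincombC _ _ _ _ _ (mulx i)) => i' /=; exact: mulxC.
Qed.

Lemma mulxdW_muly j l (x : V) : mulxdW j (muly l x) = muly l (mulxdW j x).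
Proof.
by symmetry; apply: (@lincombC _ _ _ _ _ (muly l)) => i /=; rewrite mulx_muly.
Qed.

Lemma mulxdW_muly_eq0 j (x : V) : mulxdW j (muly j x) = 0.
Proof. by apply: big1 => i _ /=; exact: mulx_muly_eq0. Qed.

(** By the Clifford relations only multiplications by both x_j and y_j remain,
    and these are zero. *)
Lemma Dtot2 P : Dtot (Dtot P) = 0.
Proof.
rewrite /Dtot (linearD Dwedge) (linearD Dcontr) /=.
rewrite [Dwedge (Dwedge P)]wedge_op2; last exact: mulxdWC.
rewrite [Dcontr (Dcontr P)]contr_op2; last exact: mulyC.
rewrite add0r addr0 addrC [LHS]contr_wedge_op /= => [|i j x _]; last by rewrite mulxdW_muly.
rewrite big1 // => j _; rewrite [emap _ (emap _ _)]emapC /=; last first.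
  by move=> x; rewrite mulxdW_muly.
by rewrite annih_createD; apply/ffunP => S; rewrite !ffunE mulxdW_muly_eq0.
Qed.

Definition diag (w : {set 'I_d} -> B -> C) : ext V -> ext V :=
  emaps (fun S => scale_gen (w S)).
HB.instance Definition _ w := GRing.Linear.on (diag w).

Lemma diag_gen w S k : diag w (edelta S (gen k)) = w S k *: edelta S (gen k).
Proof. by rewrite [LHS]emaps_edelta scale_genE linearZ. Qed.

Lemma coef_diag w P S k : coef k (diag w P S) = w S k * coef k (P S).
Proof.
rewrite emapsE /=; move: (P S) => x.
rewrite -[LHS]/((coef k \o scale_gen (w S)) x) -[RHS]/((w S k \*: coef k) x).
apply: basis_linear_eq => l /=; rewrite scale_genE linearZ /= !coef_gen.
by case: eqP => [->|_] //; rewrite !scaler0.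
Qed.

Definition supp_in (A : {set 'I_d} -> B -> Prop) P : Prop :=
  forall S k, coef k (P S) != 0 -> A S k.

Lemma supp_in0 A : supp_in A 0.
Proof. by move=> S k; rewrite ext0E (raddf0 (coef k)) eqxx. Qed.

Lemma supp_inD A P Q : supp_in A P -> supp_in A Q -> supp_in A (P + Q).
Proof.
move=> AP AQ S k; rewrite extDE (raddfD (coef k)) /=.
have [P0|/AP//] := eqVneq (coef k (P S)) 0.
by rewrite P0 add0r; exact: AQ.
Qed.

Lemma supp_inZ A c P : supp_in A P -> supp_in A (c *: P).
Proof.
move=> AP S k; rewrite extZE (linearZ_LR (coef k)) /= mulf_eq0 negb_or => /andP[_].
exact: AP.
Qed.

Lemma supp_inB A P Q : supp_in A P -> supp_in A Q -> supp_in A (P - Q).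
Proof. by move=> AP AQ; apply: supp_inD => //; rewrite -scaleN1r; exact: supp_inZ. Qed.

Lemma supp_in_sum A (I : finType) (F : I -> ext V) :
  (forall i, supp_in A (F i)) -> supp_in A (\sum_i F i).
Proof.
by move=> AF; apply: big_ind => //; [exact: supp_in0|exact: supp_inD].
Qed.

Lemma supp_in_gen (A : {set 'I_d} -> B -> Prop) S k : A S k -> supp_in A (edelta S (gen k)).
Proof.
move=> ASk T l; rewrite edeltaE; case: (T =P S) => [->|_]; last by rewrite linear0 eqxx.
by rewrite coef_gen; case: (k =P l) => [<-|_] //; rewrite eqxx.
Qed.

Lemma supp_in_ind A (Pr : ext V -> Prop) : Pr 0 ->
  (forall P Q, Pr P -> Pr Q -> Pr (P + Q)) -> (forall c P, Pr P -> Pr (c *: P)) ->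
  (forall S k, A S k -> Pr (edelta S (gen k))) ->
  forall P, supp_in A P -> Pr P.
Proof.
move=> Pr0 PrD PrZ Prgen P AP; rewrite [P]ext_sum_edelta.
elim/big_ind: _ => // S _; rewrite [P S]sum_gen (raddf_sum (edelta S)) big_seq.
elim/big_ind: _ => // k; move/basis_suppP/AP => Ak /=.
rewrite (linearZ_LR (edelta S)); apply: PrZ; exact: Prgen.
Qed.

Lemma supp_in_map A A' (f : {linear ext V -> ext V}) :
  (forall S k, A S k -> supp_in A' (f (edelta S (gen k)))) ->
  forall P, supp_in A P -> supp_in A' (f P).
Proof.
move=> fAB; apply: supp_in_ind => [|P Q|c P|].
- by rewrite (raddf0 f); exact: supp_in0.
- by rewrite (raddfD f); exact: supp_inD.
- by rewrite (linearZ_LR f); exact: supp_inZ.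
- exact: fAB.
Qed.

Lemma supp_in_eq0 A (f : {linear ext V -> ext V}) :
  (forall S k, A S k -> f (edelta S (gen k)) = 0) ->
  forall P, supp_in A P -> f P = 0.
Proof.
move=> f0; apply: supp_in_ind => [|P Q P0 Q0|c P P0|//].
- by rewrite raddf0.
- by rewrite raddfD /= P0 Q0 addr0.
- by rewrite linearZ_LR P0 scaler0.
Qed.

Lemma ext_gen_comm (f g h l : {linear ext V -> ext V}) :
  (forall S k, f (g (edelta S (gen k))) = h (l (edelta S (gen k)))) ->
  forall P, f (g P) = h (l P).
Proof. by move=> fg P; apply: (@ext_gen_eq _ (f \o g) (h \o l)). Qed.

Lemma supp_in_diag A w P : supp_in A P -> supp_in A (diag w P).
Proof.
by move=> AP S k; rewrite coef_diag mulf_eq0 negb_or => /andP[_]; exact: AP.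
Qed.

(** The coordinates in which dividing by y_j inverts the [j]-th term of the
    contraction part, on one side or the other. *)
Definition unreduced S k (j : 'I_d) : bool :=
  if j \in S then xe k j == 0 else 1 <= ye k j.

Definition defect S k : nat := #|[set j | unreduced S k j]|.

(** The terms in two distinct coordinates cancel; in a single one, multiplying and
    dividing by y_j in either order is the identity or zero. *)
Lemma homotopy P :
  Dcontr (Hcontr P) + Hcontr (Dcontr P) = diag (fun S p => (defect S p)%:R) P.
Proof.
pose L : {linear ext V -> ext V} := (Dcontr \o Hcontr) \+ (Hcontr \o Dcontr).
rewrite -[LHS]/(L P); move: P; apply: ext_gen_eq => S k.
rewrite /= diag_gen [LHS]contr_wedge_op_edelta => [|i j x ij]; last exact: muly_divyC.
transitivity (\sum_j (unreduced S k j)%:R *: edelta S (gen k)).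
  apply: eq_bigr => j _; rewrite -(linearZ_LR (edelta S)) /=; congr (edelta S _).
  by rewrite muly_divy divy_muly /unreduced; case: ifP.
exact: sum_indicator_scale.
Qed.

(** Every term of the contraction part drops an index and raises one y-exponent
    by 1, so it is enough to match the weights along such steps. *)
Lemma diag_Dcontr w w' P :
  (forall S k j l, j \in S -> xe l =1 xe k ->
     (forall i, ye l i = (i == j)%:R + ye k i) -> w (S :\ j) l = w' S k) ->
  diag w (Dcontr P) = Dcontr (diag w' P).
Proof.
move=> ww'; move: P; apply: (@ext_gen_comm (diag w) Dcontr Dcontr (diag w')) => S k /=.
rewrite diag_gen (linearZ_LR Dcontr) /=.
rewrite [Dcontr _]contr_op_edelta (raddf_sum (diag w)) scaler_sumr; apply: eq_bigr => j _ /=.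
case: ifPn => jS; last by rewrite (raddf0 (diag w)) scaler0.
rewrite (linearZ_LR (diag w)) /= scalerA [X in _ = X *: _]mulrC -scalerA; congr (_ *: _).
have [->|[l -> [xl yl]]] := muly_gen j k.
  by rewrite (raddf0 (edelta _)) (raddf0 (diag w)) scaler0.
by rewrite [LHS]diag_gen (ww' S k j l).
Qed.

Lemma diag_Dwedge w w' P :
  (forall S k i j l, j \notin S -> (0 < a i j)%N ->
     (forall h, xe l h = (a i h)%:R + xe k h) -> ye l =1 ye k -> w (j |: S) l = w' S k) ->
  diag w (Dwedge P) = Dwedge (diag w' P).
Proof.
move=> ww'; move: P; apply: (@ext_gen_comm (diag w) Dwedge Dwedge (diag w')) => S k /=.
rewrite diag_gen (linearZ_LR Dwedge) /=.
rewrite [Dwedge _]wedge_op_edelta (raddf_sum (diag w)) scaler_sumr; apply: eq_bigr => j _ /=.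
case: ifPn => jS; first by rewrite (raddf0 (diag w)) scaler0.
rewrite (linearZ_LR (diag w)) /= scalerA [X in _ = X *: _]mulrC -scalerA; congr (_ *: _).
rewrite /mulxdW /lincomb (raddf_sum (edelta _)) (raddf_sum (diag w)) scaler_sumr.
apply: eq_bigr => i _; rewrite /= (linearZ_LR (edelta _)) (linearZ_LR (diag w)) /=.
have [->|aij] := posnP (a i j); first by rewrite !scale0r scaler0.
have [->|[l -> [xl yl]]] := mulx_gen i k.
  by rewrite (raddf0 (edelta _)) (raddf0 (diag w)) !scaler0.
by rewrite diag_gen (ww' S k i j l) // !scalerA mulrC.
Qed.

(** Inverting the eigenvalues of the homotopy where they are nonzero. *)
Definition Einv : ext V -> ext V := diag (fun S p => (defect S p)%:R^-1).
HB.instance Definition _ := GRing.Linear.on Einv.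

(** Multiplying by y_j while removing [j] from [S] does not change whether [j] is
    unreduced, as no basis element involves both x_j and y_j. *)
Lemma Einv_Dcontr P : Einv (Dcontr P) = Dcontr (Einv P).
Proof.
apply: diag_Dcontr => S k j l jS xl yl; suff E : defect (S :\ j) l = defect S k by rewrite E.
congr #|pred_of_set _|; apply/setP => i; rewrite !inE /unreduced !inE xl yl.
have [->|ij] := eqVneq i j; last by rewrite /= add0r.
rewrite jS /= lerDl ye_ge0; apply/esym/eqP; have /eqP := xye0 l j.
rewrite xl yl eqxx mulf_eq0 => /orP[/eqP//|].
by rewrite gt_eqF // ltr_wpDr.
Qed.

(** The basis elements that represent the cohomology of the contraction part. *)
Definition reduced S k : Prop := forall j, ~~ unreduced S k j.

(** The factor c / c is 1 or 0 as c is nonzero or not: only the terms of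
    defect 0 are kept. *)
Definition pi0 P : ext V := P - diag (fun S p => (defect S p)%:R * (defect S p)%:R^-1) P.

Lemma pi0_reduced P : supp_in reduced (pi0 P).
Proof.
move=> S k; rewrite extBE (raddfB (coef k)) /= coef_diag; set c := (defect _ _)%:R.
have [c0 _|c0] := eqVneq c 0; last by rewrite divff // mul1r subrr eqxx.
move=> j; apply/negP => uj; move/eqP: c0; rewrite pnatr_eq0 cards_eq0 => /eqP/setP/(_ j).
by rewrite !inE uj.
Qed.

Lemma EinvD P : Einv (Dcontr (Hcontr P)) = P - pi0 P - Einv (Hcontr (Dcontr P)).
Proof.
have -> : Dcontr (Hcontr P) =
    diag (fun S p => (defect S p)%:R) P - Hcontr (Dcontr P).
  by rewrite -homotopy addrK.
rewrite (raddfB Einv) /=; congr (_ - _); rewrite /pi0 opprB addrCA subrr addr0.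
move: P; apply: (@ext_gen_comm Einv (diag _) (diag _) idfun) => S k /=.
by rewrite !diag_gen (linearZ_LR Einv) /= [Einv _]diag_gen scalerA.
Qed.

(** [total k < n] bounds the y-degree; each step of the reduction lowers it. *)
Definition total k : rat := \sum_j ye k j.
Definition bounded (n : nat) S k : Prop := total k < n%:R.

Lemma bounded0 P : supp_in (bounded 0) P -> P = 0.
Proof.
move=> P0; apply/ffunP => S; rewrite ext0E [P S]sum_gen big1_seq // => k /andP[_].
move/basis_suppP/P0; rewrite /bounded ltNge /total.
by rewrite sumr_ge0.
Qed.

Lemma exists_bounded P : exists n, supp_in (bounded n) P.
Proof.
have widen n n' Q : (n <= n')%N -> supp_in (bounded n) Q -> supp_in (bounded n') Q.
  by move=> nn' Qn S k /Qn; rewrite /bounded => /lt_le_trans; apply; rewrite ler_nat.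
suff H : forall P, supp_in (fun _ _ => True) P -> exists n, supp_in (bounded n) P.
  exact: H.
apply: supp_in_ind => {P}.
- by exists 0%N; exact: supp_in0.
- move=> Q Q' [n Qn] [n' Qn']; exists (maxn n n').
  by apply: supp_inD; [apply: widen Qn|apply: widen Qn']; rewrite ?leq_maxl ?leq_maxr.
- by move=> c Q [n Qn]; exists n; exact: supp_inZ.
move=> S k _; exists (Num.truncn (total k)).+1.
by apply: supp_in_gen; rewrite /bounded truncnS_gt.
Qed.

Lemma Hcontr_bounded n P : supp_in (bounded n.+1) P -> supp_in (bounded n) (Hcontr P).
Proof.
move: P; apply: supp_in_map => S k kn; rewrite /= [Hcontr _]wedge_op_edelta.
apply: supp_in_sum => j; case: ifP => _; first exact: supp_in0.
apply: supp_inZ; have [->|[l -> [_ yl]]] := divy_gen j k.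
  by rewrite linear0; exact: supp_in0.
apply: supp_in_gen; suff E : total l = total k - 1.
  by rewrite /bounded E; move: kn; rewrite /bounded -natr1 => ?; lra.
rewrite /total; under eq_bigr do rewrite yl.
rewrite big_split sumrN /= addrC; congr (_ - _).
by rewrite (bigD1 j) //= eqxx big1 ?addr0 // => i /negPf->.
Qed.

Lemma Dwedge_supp A P : (forall S k i j l, j \notin S -> (0 < a i j)%N ->
     (forall h, xe l h = (a i h)%:R + xe k h) -> ye l =1 ye k -> A S k -> A (j |: S) l) ->
  supp_in A P -> supp_in A (Dwedge P).
Proof.
move=> AD; move: P; apply: supp_in_map => S k Ak; rewrite /= [Dwedge _]wedge_op_edelta.
apply: supp_in_sum => j; case: ifPn => jS; first exact: supp_in0.
apply: supp_inZ; rewrite /= /mulxdW /lincomb (raddf_sum (edelta _)).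
apply: supp_in_sum => i; rewrite /= (linearZ_LR (edelta _)) /=.
have [->|aij] := posnP (a i j); first by rewrite scale0r; exact: supp_in0.
apply: supp_inZ; have [->|[l -> [xl yl]]] := mulx_gen i k.
  by rewrite linear0; exact: supp_in0.
by apply: supp_in_gen; apply: AD xl yl Ak.
Qed.

Lemma Dwedge_bounded n P : supp_in (bounded n) P -> supp_in (bounded n) (Dwedge P).
Proof.
apply: Dwedge_supp => S k i j l _ _ _ yl; rewrite /bounded /total.
by under [X in _ -> X < _]eq_bigr do rewrite yl.
Qed.

Lemma Dwedge_reduced P : supp_in reduced P -> supp_in reduced (Dwedge P).
Proof.
apply: Dwedge_supp => S k i j k' jS aij xk' yk' red l.
have := red l; rewrite /unreduced !inE xk' yk'; have [->|lj] := eqVneq l j.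
  by move=> _; rewrite gt_eqF // ltr_wpDr ?ltr0n.
by case: ifP => // _ x1; rewrite gt_eqF // ltr_wpDl // lt_neqAle eq_sym x1 xe_ge0.
Qed.

Lemma Hcontr_reduced P : supp_in reduced P -> Hcontr P = 0.
Proof.
move: P; apply: (@supp_in_eq0 _ Hcontr) => S k red.
rewrite /= [Hcontr _]wedge_op_edelta big1 // => j _; case: ifPn => // jS.
have [->|[l _ [_ yl]]] := divy_gen j k; first by rewrite linear0 scaler0.
have := red j; have := ye_ge0 l j; rewrite /unreduced (negPf jS) yl eqxx.
by rewrite addrC subr_ge0 => ->.
Qed.

Lemma Dcontr_reduced P : supp_in reduced P -> Dcontr P = 0.
Proof.
move: P; apply: (@supp_in_eq0 _ Dcontr) => S k red.
rewrite /= [Dcontr _]contr_op_edelta big1 // => j _; case: ifPn => // jS.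
have [->|[l _ [xl yl]]] := muly_gen j k; first by rewrite linear0 scaler0.
have /eqP := xye0 l j; have := red j; rewrite /unreduced jS mulf_eq0 xl => /negPf->.
by rewrite yl eqxx /= gt_eqF // ltr_wpDr.
Qed.

Lemma Dtot_reduced P : supp_in reduced P -> supp_in reduced (Dtot P).
Proof.
by move=> Pr; rewrite /Dtot Dcontr_reduced // addr0; exact: Dwedge_reduced.
Qed.

(** A perturbation argument: correcting [P] by the differential of [Einv (Hcontr P)]
    leaves the reduced part of [P] and terms of smaller y-degree, because the
    homotopy lowers this degree and the wedge part preserves it. The hypothesis
    makes the homotopy vanish on [Dtot P]. *)
Lemma reduction P : supp_in reduced (Dtot P) -> exists Q, supp_in reduced (P - Dtot Q).
Proof.
have [n] := exists_bounded P; elim: n P => [|n IH] P Pn DPr.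
  exists 0; rewrite (raddf0 Dtot) subr0 (bounded0 Pn); exact: supp_in0.
pose Q := Einv (Hcontr P).
pose P' := - Einv (Hcontr (Dwedge P)) - Dwedge Q.
have E : P - Dtot Q = pi0 P + P'.
  rewrite /Dtot -Einv_Dcontr EinvD.
  have -> : Dcontr P = Dtot P - Dwedge P by rewrite /Dtot addrC addKr.
  rewrite (raddfB Hcontr) /= (Hcontr_reduced DPr) sub0r (raddfN Einv) /= opprK /P'.
  move: (Dwedge Q) (Einv _) (pi0 P) => x y z.
  have -> : x + (P - z + y) = P + (x - (z - y)).
    by rewrite opprB -addrA (addrCA x P) (addrC (- z) y).
  by rewrite opprD addrA subrr add0r opprB addrA.
have P'n : supp_in (bounded n) P'.
  apply: supp_inB; first rewrite -scaleN1r.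
    by apply: supp_inZ; apply: supp_in_diag; apply: Hcontr_bounded; exact: Dwedge_bounded.
  by apply: Dwedge_bounded; apply: supp_in_diag; exact: Hcontr_bounded.
have DP'r : supp_in reduced (Dtot P').
  have -> : P' = P - Dtot Q - pi0 P by rewrite E addrC addKr.
  rewrite (raddfB Dtot) /= (raddfB Dtot) /= Dtot2 subr0; apply: supp_inB => //.
  by apply: Dtot_reduced; exact: pi0_reduced.
have [Q' Q'r] := IH P' P'n DP'r; exists (Q + Q').
rewrite (raddfD Dtot) opprD addrA E -addrA; apply: supp_inD => //.
exact: pi0_reduced.
Qed.

End Reduction.

(** * The differential in the dual basis *)

Section Complex.
Variables (R : realType) (d : nat) (a : 'M[nat]_d) (G : {fset 'rV[R[i]]_d}).
Local Notation C := R[i].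
Local Notation V := (cone_module a G).
Local Notation expo := (expo a).
Implicit Types (m n : 'rV[rat]_d) (k : basis_index a G) (S : {set 'I_d}).
Hypothesis G_subgroup : subgroup_Aut a G.
Hypothesis a_unit : ratmx a \in unitmx.

Definition mulx i : V -> V := mono_mul (ugen i) 0.
Definition muly j : V -> V := mono_mul 0 (vgen j).
(** Monomials not divisible by v_j are sent to zero, as their quotients leave the
    cone. *)
Definition divy j : V -> V := mono_mul 0 (- vgen j).
HB.instance Definition _ i := GRing.Linear.on (mulx i).
HB.instance Definition _ j := GRing.Linear.on (muly j).
HB.instance Definition _ j := GRing.Linear.on (divy j).

Lemma val_pair k : disjoint_pair a (val k).1 (val k).2.
Proof. by have /(basis_predP a G)[_ _] := val_basis_pred k. Qed.

Lemma vgen_int j l : (vgen j : 'rV[rat]_d) 0 l \is a Num.int.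
Proof. by rewrite mxE; exact: natr_int. Qed.

Lemma latticeN_vgen j n : latticeN G (vgen j + n) <-> latticeN G n.
Proof. by apply: latticeN_shift => l; exact: vgen_int. Qed.

Lemma latticeN_vgenN j n : latticeN G (- vgen j + n) <-> latticeN G n.
Proof. by apply: latticeN_shift => l; rewrite mxE rpredN vgen_int. Qed.

Lemma mulx_gen i k : mulx i (gen C k) = mono a G (ugen i + (val k).1) (val k).2.
Proof. by rewrite /mulx mono_mul_gen add0r. Qed.

Lemma muly_gen j k : muly j (gen C k) = mono a G (val k).1 (vgen j + (val k).2).
Proof. by rewrite /muly mono_mul_gen add0r. Qed.

Lemma divy_gen j k : divy j (gen C k) = mono a G (val k).1 (- vgen j + (val k).2).
Proof. by rewrite /divy mono_mul_gen add0r. Qed.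

Definition nonneg_pair m n : Prop := forall j, 0 <= expo m j /\ 0 <= n 0 j.

Lemma nonneg_val k : nonneg_pair (val k).1 (val k).2.
Proof. by move=> j; have [] := val_pair k j. Qed.

Lemma nonneg_ugen i m n : nonneg_pair m n -> nonneg_pair (ugen i + m) n.
Proof. by move=> mn j; have [? ?] := mn j; rewrite expoD expo_ugen addr_ge0 ?ler0n. Qed.

Lemma nonneg_vgen j m n : nonneg_pair m n -> nonneg_pair m (vgen j + n).
Proof. by move=> mn l; have [? ?] := mn l; rewrite !mxE addr_ge0 ?ler0n. Qed.

Lemma mulx_mono i m n : nonneg_pair m n ->
  mulx i (mono a G m n) = mono a G (ugen i + m) n.
Proof.
move=> mn; rewrite /mulx mono_mul_mono; rewrite add0r; first by [].
move=> /basis_predP[uM nN um]; apply/basis_predP; split; [|by []|].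
  exact/(latticeM_shift G_subgroup a_unit m i).
move=> j; have [m0 n0] := mn j; split=> //; have [_ _] := um j.
rewrite expoD mulrDl expo_ugen => /eqP.
rewrite paddr_eq0 ?mulr_ge0 ?ler0n // => /andP[_ /eqP]; exact.
Qed.

Lemma muly_mono j m n : nonneg_pair m n ->
  muly j (mono a G m n) = mono a G m (vgen j + n).
Proof.
move=> mn; rewrite /muly mono_mul_mono; rewrite add0r; first by [].
move=> /basis_predP[mM nN vn]; apply/basis_predP; split; [by []| |].
  exact/latticeN_vgen/nN.
move=> l; have [m0 n0] := mn l; split=> //; have [_ _] := vn l; rewrite mxE mulrDr => /eqP.
rewrite paddr_eq0 ?mulr_ge0 // ?mxE ?ler0n // => /andP[_ /eqP]; exact.
Qed.

Lemma cone_linear_eq (W : lmodType C) (f g : {linear V -> W}) :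
  (forall k, f (gen C k) = g (gen C k)) -> f =1 g.
Proof. exact: malg_linear_eq. Qed.

Lemma mulxC i i' (x : V) : mulx i (mulx i' x) = mulx i' (mulx i x).
Proof.
rewrite -[LHS]/((mulx i \o mulx i') x) -[RHS]/((mulx i' \o mulx i) x).
apply: cone_linear_eq => k /=; have vk := nonneg_val k.
by rewrite !mulx_gen !(mulx_mono _ (nonneg_ugen _ vk)) addrCA.
Qed.

Lemma mulyC j l (x : V) : muly j (muly l x) = muly l (muly j x).
Proof.
rewrite -[LHS]/((muly j \o muly l) x) -[RHS]/((muly l \o muly j) x).
apply: cone_linear_eq => k /=; have vk := nonneg_val k.
by rewrite !muly_gen !(muly_mono _ (nonneg_vgen _ vk)) addrCA.
Qed.

Lemma mulx_muly i j (x : V) : mulx i (muly j x) = muly j (mulx i x).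
Proof.
rewrite -[LHS]/((mulx i \o muly j) x) -[RHS]/((muly j \o mulx i) x).
apply: cone_linear_eq => k /=; have vk := nonneg_val k.
rewrite mulx_gen muly_gen (mulx_mono _ (nonneg_vgen _ vk)).
by rewrite (muly_mono _ (nonneg_ugen _ vk)).
Qed.

(** If [a i j] is positive, then u_i and v_j have a positive pairing. *)
Lemma mulx_muly_eq0 i j (x : V) : (a i j)%:R *: mulx i (muly j x) = 0.
Proof.
have [->|aij] := posnP (a i j); first by rewrite scale0r.
rewrite -[mulx _ _]/((mulx i \o muly j) x).
have -> : (mulx i \o muly j) x = (\0%R : V -> V) x; last by rewrite scaler0.
apply: cone_linear_eq => k /=; have vk := nonneg_val k.
rewrite muly_gen (mulx_mono _ (nonneg_vgen _ vk)) mono_eq0; first by [].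
move=> /basis_predP[_ _ /(_ j)[_ _]]; rewrite expoD expo_ugen !mxE !eqxx.
have [x0 n0] := vk j; apply/eqP; rewrite mulf_neq0 // gt_eqF //.
  by rewrite ltr_wpDr // ltr0n.
by rewrite ltr_wpDr.
Qed.

Lemma muly_divyC j l (x : V) : j != l -> muly j (divy l x) = divy l (muly j x).
Proof.
move=> jl; rewrite -[LHS]/((muly j \o divy l) x) -[RHS]/((divy l \o muly j) x).
apply: cone_linear_eq => k /=; have vk := val_pair k.
have [kM kN _] := (basis_predP a G _ _).1 (val_basis_pred k).
rewrite divy_gen muly_gen /muly mono_mul_mono; last first.
  rewrite !add0r => /basis_predP[_ _ vn]; apply/basis_predP; split; [by []| |].
    exact/latticeN_vgenN.
  move=> r; have [x0 n0 xn0] := vk r; have := vn r; rewrite !mxE /=.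
  have [->|rj] := eqVneq r j; first by rewrite (negPf jl) oppr0 add0r.
  by rewrite add0r.
rewrite /divy mono_mul_mono; last first.
  rewrite !add0r => /basis_predP[_ _ vn]; apply/basis_predP; split; [by []| |].
    exact/latticeN_vgen.
  move=> r; have [x0 n0 xn0] := vk r; have := vn r; rewrite !mxE /=.
  have [->|rj] := eqVneq r j; first by rewrite (negPf jl) oppr0 add0r.
  by rewrite !add0r.
by rewrite !add0r addrCA.
Qed.

Lemma muly_divy j k :
  muly j (divy j (gen C k)) = ((1 <= (val k).2 0 j)%R%:R : C) *: gen C k.
Proof.
have vk := val_pair k; have [kM kN _] := (basis_predP a G _ _).1 (val_basis_pred k).
rewrite divy_gen; have [n1|n1] := boolP (1 <= (val k).2 0 j).
  rewrite /muly mono_mul_mono; rewrite add0r; last first.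
    move=> _; apply/basis_predP; split; [by []|exact/latticeN_vgenN|].
    move=> l; have [x0 n0 xn0] := vk l; rewrite !mxE /=.
    have [->|lj] := eqVneq l j; last by rewrite oppr0 add0r.
    suff ej : expo (val k).1 j = 0 by rewrite ej mul0r addrC subr_ge0.
    have [_ _ /eqP] := vk j; rewrite mulf_eq0 => /orP[/eqP//|/eqP nj].
    by rewrite nj ler10 in n1.
  by rewrite addrA addrN add0r mono_val scale1r.
rewrite scale0r mono_eq0 ?linear0 // => /basis_predP[_ _ /(_ j)[_]].
by rewrite !mxE !eqxx /= addrC subr_ge0 (negPf n1).
Qed.

Lemma divy_muly j k :
  divy j (muly j (gen C k)) = ((expo (val k).1 j == 0)%R%:R : C) *: gen C k.
Proof.
have vk := val_pair k; have [kM kN _] := (basis_predP a G _ _).1 (val_basis_pred k).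
rewrite muly_gen; have [n1|n1] := eqVneq (expo (val k).1 j) 0.
  rewrite /divy mono_mul_mono; rewrite add0r; last first.
    move=> _; apply/basis_predP; split; [by []|exact/latticeN_vgen|].
    move=> l; have [x0 n0 xn0] := vk l; rewrite !mxE /=.
    have [lj|lj] := eqVneq l j; last by rewrite add0r.
    by rewrite lj n1 mul0r addr_ge0 //; have [_ ->] := vk j.
  by rewrite addrA addNr add0r mono_val scale1r.
rewrite scale0r mono_eq0 ?linear0 // => /basis_predP[_ _ /(_ j)[x0 n0 /eqP]].
have [_ nj _] := vk j; rewrite mulf_eq0 (negPf n1) /=.
by rewrite !mxE !eqxx /= gt_eqF // ltr_wpDr.
Qed.

End Complex.

Section TotalDifferential.
Variables (R : realType) (d : nat) (a : 'M[nat]_d) (G : {fset 'rV[R[i]]_d}).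
Local Notation C := R[i].
Local Notation V := (cone_module a G).
Local Notation ext V := {ffun {set 'I_d} -> V}.
Local Notation mulx := (@mulx R d a G).
Local Notation muly := (@muly R d a G).
Implicit Types (m n : 'rV[rat]_d) (k : basis_index a G) (S : {set 'I_d}) (P Q : ext V).
Hypothesis G_subgroup : subgroup_Aut a G.
Hypothesis a_unit : ratmx a \in unitmx.

Let X i : {linear V -> V} := mulx i.
Let Y j : {linear V -> V} := muly j.
Local Notation Dtot := (Dtot a X Y).

(** The rows are the basis of M dual to the v_j, in the basis of the u_i. *)
Definition dual_basis : 'M[C]_d := map_mx ratr (invmx (ratmx a)).
Definition ugen_basis : 'M[C]_d := map_mx (fun n : nat => n%:R) a.

Lemma ugen_basisE : ugen_basis = map_mx ratr (ratmx a).
Proof. by apply/matrixP => i j; rewrite !mxE ratr_nat. Qed.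

Lemma ugen_dual : ugen_basis *m dual_basis = 1%:M.
Proof. by rewrite ugen_basisE -map_mxM mulmxV // map_mx1. Qed.

Lemma dual_ugen : dual_basis *m ugen_basis = 1%:M.
Proof. by rewrite ugen_basisE -map_mxM mulVmx // map_mx1. Qed.

Lemma wedge_ugen (W : lmodType C) i (P : ext W) : wedge (ugen i) P = create i P.
Proof.
apply/ffunP => S; rewrite !ffunE; case: ifP => iS; last first.
  rewrite big1 // => l lS; rewrite !mxE eqxx /=; case: eqP => [li|_].
    by rewrite -li lS in iS.
  by rewrite rmorph0 mulr0 scale0r.
rewrite (bigD1 i) //= big1 ?addr0 => [|l /andP[_ /negPf li]].
  by rewrite mxE !eqxx rmorph1 mulr1.
by rewrite mxE li andbF rmorph0 mulr0 scale0r.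
Qed.

Lemma contr_vgen (W : lmodType C) j (P : ext W) :
  contr a (vgen j) P = econtr (\row_i ugen_basis i j) P.
Proof.
apply/ffunP => S; rewrite !ffunE sum_ffunE big_mkcond; apply: eq_bigr => i _.
rewrite !ffunE inE; case: (i \in S); rewrite /= ?scaler0 // !mxE.
by rewrite pairing_ugen_vgen ratr_nat scalerA mulrC.
Qed.

Lemma contr_basis_change (W : lmodType C) j (P : ext W) :
  contr a (vgen j) (basis_change dual_basis P) = basis_change dual_basis (annih j P).
Proof.
rewrite contr_vgen; symmetry; apply: basis_change_annih => i.
have := congr1 (fun M : 'M_d => M i j) dual_ugen; rewrite [1%:M _ _]mxE => <-.
by rewrite mxE; apply: eq_bigr => k _; rewrite [(\row__ _) _ _]mxE.
Qed.

Lemma create_basis_change (W : lmodType C) i (P : ext W) :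
  create i (basis_change dual_basis P) =
  basis_change dual_basis (\sum_j (a i j)%:R *: create j P).
Proof.
rewrite (raddf_sum (basis_change _)) /=.
under eq_bigr do rewrite linearZ /= basis_change_create.
rewrite /ewedge; under eq_bigr do rewrite scaler_sumr.
rewrite exchange_big (bigD1 i) //= [X in _ = _ + X]big1 ?addr0 => [|l li].
  under eq_bigr do rewrite scalerA; rewrite -scaler_suml.
  have := congr1 (fun M : 'M_d => M i i) ugen_dual; rewrite !mxE eqxx => E.
  by rewrite (eq_bigr (fun j => ugen_basis i j * dual_basis j i)) ?E ?scale1r // => j _; rewrite !mxE.
under eq_bigr do rewrite scalerA; rewrite -scaler_suml.
have := congr1 (fun M : 'M_d => M i l) ugen_dual; rewrite !mxE eq_sym (negPf li) => E.
by rewrite (eq_bigr (fun j => ugen_basis i j * dual_basis j l)) ?E ?scale0r // => j _; rewrite !mxE.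
Qed.

(** In the dual basis u_i has coordinates [a i j], and contraction by v_j deletes
    the [j]-th basis vector. *)
Lemma dA_basis_change P :
  dA (basis_change dual_basis P) = basis_change dual_basis (Dtot P).
Proof.
rewrite /dA (linearD (basis_change _)); congr (_ + _).
  transitivity (\sum_i create i (basis_change dual_basis (emap (mulx i) P))).
    apply: eq_bigr => i _; rewrite wedge_ugen -emap_basis_change -emap_create.
    by apply/ffunP => S; rewrite !ffunE.
  under eq_bigr do rewrite create_basis_change.
  rewrite -(raddf_sum (basis_change _)) /=; congr (basis_change _ _).
  rewrite exchange_big; apply: eq_bigr => j _ /=.
  under eq_bigr do rewrite -linearZ_LR; rewrite -(raddf_sum (create j)); congr (create _ _).
  by apply/ffunP => S; rewrite sum_ffunE !ffunE; apply: eq_bigr => i _; rewrite !ffunE.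
rewrite (raddf_sum (basis_change _)); apply: eq_bigr => j _ /=; rewrite contr_basis_change.
by rewrite -emap_annih -emap_basis_change; apply/ffunP => S; rewrite !ffunE.
Qed.

Lemma basis_changeVK (W : lmodType C) : cancel (@basis_change _ _ W ugen_basis) (basis_change dual_basis).
Proof. exact: basis_changeK ugen_dual. Qed.

Lemma basis_changeKV (W : lmodType C) : cancel (@basis_change _ _ W dual_basis) (basis_change ugen_basis).
Proof. exact: basis_changeK dual_ugen. Qed.

Lemma Dtot_cone2 P : Dtot (Dtot P) = 0.
Proof.
apply: Dtot2.
- exact: mulxC.
- exact: mulyC.
- exact: mulx_muly.
- exact: mulx_muly_eq0.
Qed.

Lemma dA2 P : dA (dA P) = 0.
Proof.
rewrite -(basis_changeVK P) dA_basis_change dA_basis_change.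
by rewrite Dtot_cone2 (raddf0 (basis_change _)).
Qed.

End TotalDifferential.

(** * Polynomials and their monomials *)

Section PolynomialLinear.
Variables (C : comNzRingType) (d : nat).
Local Notation Cx := (mpoly.mpoly d C).
Implicit Types (p f : Cx) (e m : 'X_{1..d}).

Section LinearExtension.
Variables (W : lmodType C) (phi : 'X_{1..d} -> W).

Definition mlin f : W := \sum_(e <- msupp f) f@_e *: phi e.

Lemma mlinwE k f : (msize f <= k)%N -> mlin f = \sum_(e : 'X_{1..d < k}) f@_e *: phi e.
Proof.
move=> fk; pose I : subFinType _ := 'X_{1..d < k}.
rewrite /mlin (big_mksub I) //=; first last.
- by move=> x /msize_mdeg_lt /leq_trans; apply.
- by rewrite msupp_uniq.
by rewrite big_rmcond //= => i; move/memN_msupp_eq0 ->; rewrite scale0r.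
Qed.

Fact mlin_is_linear : linear mlin.
Proof.
move=> c f p; pose k := maxn (msize (c *: f + p)) (maxn (msize f) (msize p)).
rewrite !(@mlinwE k) ?leq_max ?leqnn ?orbT //.
rewrite scaler_sumr -big_split; apply: eq_bigr => e _ /=.
by rewrite mcoeffD mcoeffZ scalerDl scalerA.
Qed.
HB.instance Definition _ := GRing.isLinear.Build C Cx W *:%R mlin mlin_is_linear.

Lemma mlinX e : mlin 'X_[e] = phi e.
Proof. by rewrite /mlin msuppX big_seq1 mcoeffX eqxx scale1r. Qed.

End LinearExtension.

Lemma mpoly_linear_eq (W : lmodType C) (f g : {linear Cx -> W}) :
  (forall e, f 'X_[e] = g 'X_[e]) -> f =1 g.
Proof.
move=> fg p; rewrite [p]mpolyE !linear_sum; apply: eq_bigr => e _.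
by rewrite !linearZ fg.
Qed.

Definition pfilter (P : pred 'X_{1..d}) : Cx -> Cx :=
  mlin (fun e => if P e then 'X_[e] else 0).
HB.instance Definition _ P := GRing.Linear.on (pfilter P).

Lemma mcoeff_pfilter P f e : (pfilter P f)@_e = if P e then f@_e else 0.
Proof.
rewrite /pfilter /mlin (raddf_sum (mcoeff e)) /=; case: (boolP (P e)) => Pe.
  rewrite [in RHS](mpolyE f) (raddf_sum (mcoeff e)) /=; apply: eq_bigr => m _.
  rewrite !mcoeffZ; case: ifP => Pm //.
  by rewrite mcoeff0 mcoeffX; case: eqP => [E|//]; rewrite -E Pm in Pe.
rewrite big1 // => m _; rewrite mcoeffZ; case: ifP => Pm; last by rewrite mcoeff0 mulr0.
by rewrite mcoeffX; case: eqP => [E|_]; [rewrite -E Pm in Pe|rewrite mulr0].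
Qed.

Lemma pfilter_id (P : pred 'X_{1..d}) f : (forall e, f@_e != 0 -> P e) -> pfilter P f = f.
Proof.
move=> fP; apply/mpolyP => e; rewrite mcoeff_pfilter; case: ifP => // /negP Pe.
by have [->//|/fP] := eqVneq f@_e 0.
Qed.

Lemma mnm_divK e m : (forall j, (m j <= e j)%N) -> (m + (e - m) = e)%MM.
Proof. by move=> me; apply/mnmP => j; rewrite mnmDE mnmBE subnKC. Qed.

(** Division by a monomial, discarding the terms it does not divide. *)
Definition divX m f : Cx := mlin (fun e => 'X_[e - m]) f.

Lemma divXK m f : (forall e j, f@_e != 0 -> (m j <= e j)%N) -> f = 'X_[m] * divX m f.
Proof.
move=> fm; rewrite /divX /mlin {1}[f]mpolyE mulr_sumr big_seq [RHS]big_seq.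
apply: eq_bigr => e; rewrite mcoeff_msupp => fe.
by rewrite -scalerAr -mpolyXD mnm_divK // => j; exact: fm fe.
Qed.

Lemma mcoeff_mulX m f e : ('X_[m] * f)@_e =
  if [forall j, (m j <= e j)%N] then f@_(e - m) else 0.
Proof.
case: ifPn => [/forallP me|/forallP me].
  by rewrite -{1}(mnm_divK me) mulrC mcoeffMX.
apply/memN_msupp_eq0/negP => /msuppM_le /allpairsP[[m' e'] /= []].
rewrite msuppX inE => /eqP-> _ E; apply: me => j.
by rewrite E mnmDE leq_addr.
Qed.

Lemma supp_mulX m f e : ('X_[m] * f)@_e != 0 ->
  (forall j, (m j <= e j)%N) /\ f@_(e - m) != 0.
Proof. by rewrite mcoeff_mulX; case: ifP => [/forallP|]; rewrite ?eqxx. Qed.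

Lemma mulX_inj m : injective ( *%R ('X_[m] : Cx)).
Proof.
move=> f p fp; apply/mpolyP => e.
have := congr1 (mcoeff (m + e)) fp.
by rewrite ![ 'X_[m] * _]mulrC !mcoeffMX.
Qed.

End PolynomialLinear.

(** * Reduction of the cone complex *)

Section ConeReduction.
Variables (R : realType) (d : nat) (a : 'M[nat]_d) (G : {fset 'rV[R[i]]_d}).
Local Notation C := R[i].
Local Notation V := (cone_module a G).
Local Notation ext V := {ffun {set 'I_d} -> V}.
Implicit Types (k : basis_index a G) (S : {set 'I_d}) (P Q : ext V).
Hypothesis G_subgroup : subgroup_Aut a G.
Hypothesis a_unit : ratmx a \in unitmx.
Let X i : {linear V -> V} := @mulx R d a G i.
Let Y j : {linear V -> V} := @muly R d a G j.
Let T j : {linear V -> V} := @divy R d a G j.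

Definition cgen k : V := gen C k.

Definition cone_lin (W : lmodType C) (phi : basis_index a G -> W) : V -> W :=
  malg_lin phi.

Fact cone_lin_is_linear (W : lmodType C) phi : linear (@cone_lin W phi).
Proof. exact: malg_lin_is_linear. Qed.
HB.instance Definition _ (W : lmodType C) phi :=
  GRing.isLinear.Build C V W *:%R (cone_lin phi) (@cone_lin_is_linear W phi).

Lemma cone_lin_gen (W : lmodType C) (phi : basis_index a G -> W) k :
  cone_lin phi (cgen k) = phi k.
Proof. exact: malg_lin_gen. Qed.

Definition coef k (x : V) : C^o := monalg.mcoeff k x.

Fact coef_is_linear k : linear (coef k).
Proof. by move=> c x y; rewrite /coef monalg.mcoeffD monalg.mcoeffZ. Qed.
HB.instance Definition _ k :=
  GRing.isLinear.Build C V C^o *:%R (coef k) (coef_is_linear k).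

Lemma coef_cgen k l : coef l (cgen k) = (k == l)%:R.
Proof. exact: mcoeff_gen. Qed.

Lemma cone_sum_gen (x : V) : x = \sum_(k <- monalg.msupp x) coef k x *: cgen k.
Proof. exact: malg_sum_gen. Qed.

Lemma cone_suppP (x : V) k : k \in (monalg.msupp x : seq _) -> coef k x != 0.
Proof. by rewrite /coef monalg.mcoeff_neq0. Qed.

Definition cscale (w : basis_index a G -> C) : {linear V -> V} :=
  cone_lin (fun k => w k *: cgen k).

Lemma cscaleE w k : cscale w (cgen k) = w k *: cgen k.
Proof. exact: cone_lin_gen. Qed.

Definition cxe k j : rat := expo a (val k).1 j.
Definition cye k j : rat := (val k).2 0 j.

Lemma mono_cgen m n : mono a G m n = 0 \/
  exists2 k : basis_index a G, mono a G m n = cgen k & val k = (m, n).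
Proof. by have [[E _]|[k kE E]] := monoP a G m n; [left|right; exists k]. Qed.

Lemma mulx_cgen i k : mulx i (cgen k) = 0 \/ exists2 l, mulx i (cgen k) = cgen l &
  (forall j, cxe l j = (a i j)%:R + cxe k j) /\ cye l =1 cye k.
Proof.
rewrite mulx_gen; have [->|[l -> lE]] := mono_cgen (ugen i + (val k).1) (val k).2.
  by left.
right; exists l => //; split=> j; rewrite /cxe /cye lE //=.
by rewrite expoD expo_ugen.
Qed.

Lemma muly_cgen j k : muly j (cgen k) = 0 \/ exists2 l, muly j (cgen k) = cgen l &
  cxe l =1 cxe k /\ (forall i, cye l i = (i == j)%:R + cye k i).
Proof.
rewrite muly_gen; have [->|[l -> lE]] := mono_cgen (val k).1 (vgen j + (val k).2).
  by left.
by right; exists l => //; split=> i; rewrite /cxe /cye lE //= !mxE.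
Qed.

Lemma divy_cgen j k : divy j (cgen k) = 0 \/ exists2 l, divy j (cgen k) = cgen l &
  cxe l =1 cxe k /\ (forall i, cye l i = - (i == j)%:R + cye k i).
Proof.
rewrite divy_gen; have [->|[l -> lE]] := mono_cgen (val k).1 (- vgen j + (val k).2).
  by left.
by right; exists l => //; split=> i; rewrite /cxe /cye lE //= !mxE.
Qed.

Definition csupp_in (A : {set 'I_d} -> basis_index a G -> Prop) P :=
  supp_in (fun k => coef k : {linear V -> C^o}) A P.
Definition creduced (S : {set 'I_d}) k := reduced cxe cye S k.

Lemma cone_reduction P : csupp_in creduced (Dtot a X Y P) ->
  exists Q, csupp_in creduced (P - Dtot a X Y Q).
Proof.
apply: (@reduction _ _ _ _ cgen (fun k => coef k) (fun x => monalg.msupp x)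
  coef_cgen cone_sum_gen cone_suppP cscale cscaleE cxe cye _ _ _ a X Y T).
- by move=> k j; have [] := val_pair k j.
- by move=> k j; have [] := val_pair k j.
- by move=> k j; have [] := val_pair k j.
- exact: mulx_cgen.
- exact: muly_cgen.
- exact: divy_cgen.
- exact: mulxC.
- exact: mulyC.
- exact: mulx_muly.
- exact: mulx_muly_eq0.
- exact: muly_divyC.
- exact: muly_divy.
- exact: divy_muly.
Qed.

Definition cdiag (w : {set 'I_d} -> basis_index a G -> C) : ext V -> ext V := diag cscale w.
HB.instance Definition _ w := GRing.Linear.on (cdiag w).

Lemma coef_cdiag w P S k : coef k (cdiag w P S) = w S k * coef k (P S).
Proof.
exact: (coef_diag (coef := fun k => coef k : {linear V -> C^o}) coef_cgen cone_sum_gen cscaleE).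
Qed.

Lemma cdiag_Dtot w w' P :
  (forall S k i j l, j \notin S -> (forall h, cxe l h = (a i h)%:R + cxe k h) ->
     cye l =1 cye k -> w (j |: S) l = w' S k) ->
  (forall S k j l, j \in S -> cxe l =1 cxe k ->
     (forall i, cye l i = (i == j)%:R + cye k i) -> w (S :\ j) l = w' S k) ->
  cdiag w (Dtot a X Y P) = Dtot a X Y (cdiag w' P).
Proof.
move=> wX wY; rewrite /cdiag [LHS](raddfD (diag cscale w)) /=; congr (_ + _).
  apply: (diag_Dwedge cone_sum_gen cscaleE mulx_cgen) => S k i j l jS _; exact: wX.
exact: (diag_Dcontr cone_sum_gen cscaleE muly_cgen).
Qed.

End ConeReduction.

(** * The Koszul complex of a sector *)

Section RegularVariables.
Variables (C : idomainType) (d : nat).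
Local Notation Cx := (mpoly.mpoly d C).
Variable N : 'I_d -> nat.

Definition some_ge (s : seq 'I_d) (e : 'X_{1..d}) := has (fun j => (N j <= e j)%N) s.

(** The ideal generated by powers of variables is spanned by monomials. *)
Lemma in_ideal_varP (s : seq 'I_d) (p : Cx) :
  in_ideal [seq 'X_j ^+ N j | j <- s] p <-> (forall e, p@_e != 0 -> some_ge s e).
Proof.
elim: s p => [|j s IH] p /=.
  split=> [-> e|p0]; first by rewrite mcoeff0 eqxx.
  apply/mpolyP => e; rewrite mcoeff0; have [//|/p0] := eqVneq p@_e 0; exact.
rewrite mpolyXn; split=> [[q /IH pq] e pe|ps].
  rewrite /some_ge /=; case: leqP => //= Nj; apply: pq.
  rewrite mcoeffB mcoeff_mulX ifF ?subr0 //; apply/negP => /forallP/(_ j).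
  by rewrite mulmnE mnm1E eqxx mul1n leqNgt Nj.
pose P e := (N j <= (e : 'X_{1..d}) j)%N.
exists (divX (U_(j) *+ N j)%MM (pfilter P p)); apply/IH => e.
rewrite -divXK => [|e' i]; last first.
  rewrite mcoeff_pfilter mulmnE mnm1E; case: ifP => [Pe' _|]; last by rewrite eqxx.
  by case: (j =P i) => [<-|_]; rewrite ?mul1n.
rewrite mcoeffB mcoeff_pfilter /P; case: leqP => [_|Ne]; first by rewrite subrr eqxx.
by rewrite subr0 => /ps; rewrite /some_ge /= leqNgt Ne.
Qed.

Lemma regular_seq_var (s : seq 'I_d) : uniq s ->
  regular_seq [seq ('X_j : Cx) ^+ N j | j <- s].
Proof.
elim: s => //= j s IH /andP[js us]; split; first exact: IH.
move=> p /in_ideal_varP zp; apply/in_ideal_varP => e pe.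
have := zp (U_(j) *+ N j + e)%MM; rewrite mpolyXn mulrC mcoeffMX => /(_ pe).
case/hasP => i is_ ; rewrite mnmDE mulmnE mnm1E => Ni; apply/hasP; exists i => //.
by move: Ni; case: eqP => [ji|_] //; rewrite ji is_ in js.
Qed.

End RegularVariables.

Section SectorCohomology.
Variables (R : realType) (d : nat) (a : 'M[nat]_d).
Local Notation C := R[i].
Local Notation Cx := (mpoly.mpoly d C).
Local Notation ext V := {ffun {set 'I_d} -> V}.
Implicit Types (e : 'X_{1..d}) (S : {set 'I_d}) (p f : Cx) (w : ext Cx).

Lemma sign_scaleE n f : (-1 : C) ^+ n *: f = (-1) ^+ n * f.
Proof. by rewrite -[in LHS]signr_odd -[in RHS]signr_odd scaler_sign mulr_sign. Qed.

Definition mulp p f : Cx := p * f.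
Fact mulp_is_linear p : linear (mulp p).
Proof. by move=> c f h; rewrite /mulp mulrDr scalerAr. Qed.
HB.instance Definition _ p := GRing.isLinear.Build C Cx Cx *:%R (mulp p) (mulp_is_linear p).

Definition kosz (p : 'I_d -> Cx) : ext Cx -> ext Cx :=
  wedge_op (fun j => mulp (p j) : {linear Cx -> Cx}).

Lemma koszE (p : 'I_d -> Cx) (w : ext Cx) S : kosz p w S =
  \sum_(j in S) (-1) ^+ below S j * (p j * w (S :\ j)).
Proof.
rewrite sum_ffunE [RHS]big_mkcond; apply: eq_bigr => j _; rewrite !ffunE.
by case: ifP => _ //; rewrite /mulp sign_scaleE.
Qed.

Lemma kosz_ewedge (p : 'I_d -> Cx) (w : ext Cx) S :
  kosz p w S = ewedge (\row_j p j) (w : {ffun {set 'I_d} -> Cx^o}) S.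
Proof.
rewrite koszE sum_ffunE big_mkcond; apply: eq_bigr => j _; rewrite !ffunE mxE.
by case: ifP => _; rewrite ?scaler0 // mulrCA.
Qed.

(** Multiplication by the product of the variables of [S] turns the
    logarithmic differentials into the ordinary ones. *)
Definition log_form (w : ext Cx) : ext Cx := [ffun S => 'X_[setm S] * w S].

Lemma log_formE (w : ext Cx) S : log_form w S = 'X_[setm S] * w S.
Proof. by rewrite ffunE. Qed.

Lemma setm_setD1 S j : j \in S -> setm S = (U_(j) + setm (S :\ j))%MM.
Proof.
move=> jS; apply/mnmP => k; rewrite mnmDE mnm1E !mnmE !inE eq_sym.
by case: (k =P j) => [->|_]; rewrite ?jS.
Qed.

Lemma kosz_log (p : 'I_d -> Cx) (w : ext Cx) :
  kosz (fun j => 'X_j * p j) (log_form w) = log_form (kosz p w).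
Proof.
apply/ffunP => S; rewrite log_formE.
rewrite [LHS]koszE.
rewrite [kosz p w S]koszE.
rewrite mulr_sumr.
apply: eq_bigr => j jS.
rewrite log_formE (setm_setD1 jS) mpolyXD.
ring.
Qed.

(** The situation after the reduction: the module is glued from pieces of
    polynomial rings by the maps [s g], whose partial inverses are the [r g];
    [s g] kills the monomials that are not visible. *)
Variables (V : lmodType C) (mulx muly : 'I_d -> {linear V -> V}).
Variables (I : finType) (F : I -> pred 'I_d) (inv : pred 'X_{1..d}).
Variables (s : I -> {linear Cx -> V}) (r : I -> {linear V -> Cx}).
Local Notation D := (Dtot a mulx muly).

Definition visible g e := inv e && [forall j, ~~ F g j ==> (e j == 0%N)].

Hypothesis inv_row : forall i e, inv (rowm a i + e)%MM = inv e.
Hypothesis rs : forall g h f, r h (s g f) = if h == g then pfilter (visible g) f else 0.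
Hypothesis s_mulx : forall i g f, mulx i (s g f) = s g ('X_[rowm a i] * f).
Hypothesis s_muly : forall j g f, F g j -> muly j (s g ('X_j * f)) = 0.
Hypothesis s_invisible : forall g e, ~~ visible g e -> s g 'X_[e] = 0.

Variable red : ext V -> Prop.
Hypothesis red_s : forall g w,
  (forall S e, (w S)@_e != 0 -> visible g e -> forall j, j \in S -> (0 < e j)%N) ->
  red (emap (s g) w).
Hypothesis redD : forall P Q, red P -> red Q -> red (P + Q).
Hypothesis red0 : red 0.
Hypothesis red_sum : forall Q, red Q -> Q = \sum_g emap (s g) (emap (r g) Q).
Hypothesis red_r : forall Q g S e, red Q -> (r g (Q S))@_e != 0 ->
  visible g e /\ forall j, j \in S -> (0 < e j)%N.
Hypothesis reduce : forall P, red (D P) -> exists Q, red (P - D Q).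
Hypothesis D2 : forall P, D (D P) = 0.

Hypothesis a_unit : ratmx a \in unitmx.
Hypothesis W_nondeg : nondegenerate_potential R a.
Hypothesis F_partner : forall g i k, ~~ F g k -> a i k = 1%N ->
  exists2 l, l != k & (0 < a i l)%N && ~~ F g l.

Definition FS g : {set 'I_d} := [set j | F g j].
Local Notation W g := (restricted R a (F g)).
Local Notation dW g := (fun j : 'I_d => (W g)^`M(j)).
Local Notation logdW g := (fun j : 'I_d => 'X_j * (W g)^`M(j)).

Lemma visibleP g e : reflect (inv e /\ forall j, ~~ F g j -> e j = 0%N) (visible g e).
Proof.
apply: (iffP andP) => [[ie /forallP Fe]|[ie Fe]]; split=> //.
  by move=> j Fj; have := Fe j; rewrite Fj => /eqP.
by apply/forallP => j; apply/implyP => Fj; rewrite Fe.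
Qed.

Lemma dW_eq0 g j : ~~ F g j -> (W g)^`M(j) = 0.
Proof.
move=> Fj; rewrite (raddf_sum (mderiv j)) big1 // => i /innerP Fi /=.
rewrite mderivX mnmE; have [->|/Fi] := posnP (a i j); first by rewrite scale0r.
by rewrite (negPf Fj).
Qed.

Lemma visible_row g i e : inner a (F g) i -> visible g (rowm a i + e)%MM = visible g e.
Proof.
move=> /innerP Fi; apply/visibleP/visibleP; rewrite inv_row => -[ie Fe]; split=> // j Fj.
  by have := Fe j Fj; rewrite mnmDE => /eqP; rewrite addn_eq0 => /andP[_ /eqP].
rewrite mnmDE mnmE Fe // addn0; have [//|/Fi] := posnP (a i j); by rewrite (negPf Fj).
Qed.

Lemma s_filter g f : s g (pfilter (visible g) f) = s g f.
Proof.
rewrite -[LHS]/((s g \o pfilter (visible g)) f); apply: mpoly_linear_eq => e /=.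
by rewrite [pfilter _ _]mlinX; case: ifPn => // /s_invisible->; rewrite linear0.
Qed.

(** The monomials of the potential that leave the variables of [F g] become
    invisible, so that only the restricted potential acts. *)
Lemma s_logdW g j f : \sum_i (a i j)%:R *: mulx i (s g f) = s g ('X_j * (W g)^`M(j) * f).
Proof.
rewrite mulX_deriv mulr_suml linear_sum [RHS]big_mkcond; apply: eq_bigr => i _ /=.
rewrite s_mulx -linearZ /= scalerAl; case: ifPn => // /innerP Fi.
rewrite -s_filter; suff -> : pfilter (visible g) ((a i j)%:R *: 'X_[rowm a i] * f) = 0.
  by rewrite linear0.
apply/mpolyP => e; rewrite mcoeff0 mcoeff_pfilter -scalerAl mcoeffZ mcoeff_mulX.
case: ifP => // /visibleP[_ Fe]; case: ifP => [/forallP le_e|]; last by rewrite mulr0.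
case: Fi => l al; apply: contraT => /Fe el; have := le_e l.
by rewrite el mnmE leqNgt al.
Qed.

(** The image under [log_form] of the forms in the directions of [F g]. *)
Definition log_divisible g (w : ext Cx) : Prop :=
  forall S e, (w S)@_e != 0 -> forall j, j \in S -> F g j /\ (0 < e j)%N.

(** The contraction part vanishes on such forms: it multiplies by y_j terms that
    are divisible by x_j. *)
Lemma D_s g w : log_divisible g w -> D (emap (s g) w) = emap (s g) (kosz (logdW g) w).
Proof.
move=> Hw; rewrite /Dtot.
have -> : Dcontr muly (emap (s g) w) = 0.
  apply: big1 => j _ /=; apply/ffunP => S; rewrite !ffunE; case: ifPn => // jS.
  have [Fj|Fj] := boolP (F g j).
    rewrite (@divXK _ _ U_(j)%MM (w (j |: S))) => [|e k /Hw/(_ j (setU11 _ _))[_ ej]].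
      by rewrite s_muly // scaler0.
    by rewrite mnm1E; case: eqP => [<-|].
  suff -> : w (j |: S) = 0 by rewrite !linear0.
  apply/mpolyP => e; rewrite mcoeff0; have [//|/Hw/(_ j (setU11 _ _))[]] := eqVneq (w (j |: S))@_e 0.
  by rewrite (negPf Fj).
rewrite addr0 /kosz /wedge_op linear_sum; apply: eq_bigr => j _ /=.
rewrite emap_create; congr (create _ _); apply/ffunP => S; rewrite !ffunE.
exact: s_logdW.
Qed.

Lemma log_form_divisible g (w : ext Cx) : (forall S, ~~ (S \subset FS g) -> w S = 0) ->
  log_divisible g (log_form w).
Proof.
move=> wF S e; rewrite log_formE => we j jS; split.
  have [SF|/wF w0] := boolP (S \subset FS g); last by rewrite w0 mulr0 mcoeff0 eqxx in we.
  by have := fintype.subsetP SF j jS; rewrite inE.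
by have [/(_ j)] := supp_mulX we; rewrite mnmE jS.
Qed.

Lemma logdW_filter g j f :
  pfilter (visible g) ('X_j * (W g)^`M(j) * f) = 'X_j * (W g)^`M(j) * pfilter (visible g) f.
Proof.
rewrite -[LHS]/((pfilter (visible g) \o mulp _) f) -[RHS]/((mulp _ \o pfilter (visible g)) f).
apply: mpoly_linear_eq => e /=; rewrite /mulp mulX_deriv !mulr_suml linear_sum.
rewrite [pfilter _ 'X_[e]]mlinX; apply: eq_bigr => i Fi /=.
rewrite -scalerAl -mpolyXD linearZ /= [pfilter _ _]mlinX visible_row //.
by rewrite -scalerAl; case: ifP; rewrite ?mpolyXD ?mulr0.
Qed.

(** A combination of the derivatives is the Koszul differential of a form whose
    components each miss one variable. *)
Lemma jacobian_coboundary g (c : 'I_d -> Cx) : exists P,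
  edelta (FS g) (s g ('X_[setm (FS g)] * \sum_(j | F g j) c j * (W g)^`M(j))) = D P.
Proof.
pose w : ext Cx := \sum_(j in FS g) edelta (FS g :\ j) ((-1) ^+ below (FS g) j * c j).
have wF S : ~~ (S \subset FS g) -> w S = 0.
  move=> SF; rewrite sum_ffunE big1 // => j _; rewrite edeltaE; case: eqP => // SE.
  by rewrite SE subD1set in SF.
exists (emap (s g) (log_form w)); rewrite D_s; last exact: log_form_divisible.
rewrite kosz_log -emap_edelta; congr (emap _ _); apply/ffunP => S; rewrite log_formE.
have -> : kosz (dW g) w = edelta (FS g) (\sum_(j | F g j) c j * (W g)^`M(j)).
  rewrite /kosz /w !linear_sum; apply: eq_big => [j|j jF]; first by rewrite inE.
  rewrite /= wedge_op_edelta (bigD1 j) //= setD11 setD1K // [X in _ + X]big1 ?addr0.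
    rewrite -linearZ /= /mulp; congr (edelta _ _).
    rewrite (below_setD1 j jF) ltnn add0n.
    rewrite sign_scaleE mulrCA [X in _ * X]mulrA -exprD addnn.
    by rewrite -signr_odd odd_double mul1r mulrC.
  move=> k kj; rewrite !inE kj /=; case: ifPn => // Fk.
  by rewrite /mulp dW_eq0 // mul0r linear0 scaler0.
by rewrite !edeltaE; case: eqP => [->|_]; rewrite ?mulr0.
Qed.

Lemma sector_cocycle g f : (forall e, f@_e != 0 -> forall j, F g j -> (0 < e j)%N) ->
  D (edelta (FS g) (s g f)) = 0.
Proof.
move=> Hf; rewrite -emap_edelta D_s => [|S e].
  suff -> : kosz (logdW g) (edelta (FS g) f) = 0 by rewrite linear0.
  rewrite /kosz wedge_op_edelta big1 // => j _; case: ifPn; rewrite // inE => Fj.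
  by rewrite /= /mulp dW_eq0 // mulr0 mul0r linear0 scaler0.
rewrite edeltaE; case: (S =P _) => [-> fe j|_]; last by rewrite mcoeff0 eqxx.
by rewrite inE => Fj; split=> //; exact: Hf fe j Fj.
Qed.

Lemma fixed_divX g f S : (forall e, f@_e != 0 -> visible g e /\ forall j, j \in S -> (0 < e j)%N) ->
  f = 'X_[setm S] * divX (setm S) f /\
  (forall e, (divX (setm S) f)@_e != 0 -> forall j, ~~ F g j -> e j = 0%N).
Proof.
move=> Hf; have E : f = 'X_[setm S] * divX (setm S) f.
  by apply: divXK => e j /Hf[_ /(_ j)]; rewrite mnmE; case: (j \in S) => // ->.
split=> // e fe j Fj; have : f@_(setm S + e) != 0 by rewrite E mulrC mcoeffMX.
case/Hf => /visibleP[_ /(_ j Fj)] + _; rewrite mnmDE => /eqP.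
by rewrite addn_eq0 => /andP[_ /eqP].
Qed.

(** The coefficient at [S] of a reduced form is divisible by the variables of [S],
    which can be divided out. *)
Lemma reduced_log g Q : red Q -> exists w : ext Cx,
  [/\ emap (r g) Q = log_form w, log_divisible g (emap (r g) Q),
      (forall S, ~~ (S \subset FS g) -> w S = 0) &
      forall S e, (w S)@_e != 0 -> forall j, ~~ F g j -> e j = 0%N].
Proof.
move=> rQ; have Hr S e := red_r (g := g) (S := S) (e := e) rQ.
exists [ffun S => divX (setm S) (r g (Q S))]; split.
- apply/ffunP => S; rewrite emapE log_formE ffunE; by have [] := @fixed_divX g (r g (Q S)) S (Hr S).
- move=> S e; rewrite emapE => /Hr[/visibleP[_ Fe] He] j jS; split; last exact: He.
  by apply: contraT => /Fe ej; have := He j jS; rewrite ej.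
- move=> S /subsetPn[j jS]; rewrite inE => Fj; rewrite ffunE.
  suff -> : r g (Q S) = 0 by rewrite [divX _ _]linear0.
  apply/mpolyP => e; rewrite mcoeff0; have [//|/Hr[/visibleP[_ /(_ j Fj)] ej]] := eqVneq (r g (Q S))@_e 0.
  by move=> /(_ j jS); rewrite ej.
move=> S e; rewrite ffunE; have [_] := @fixed_divX g (r g (Q S)) S (Hr S); exact.
Qed.

Lemma D_reduced Q : red Q ->
  D Q = \sum_g emap (s g) (kosz (logdW g) (emap (r g) Q)).
Proof.
move=> rQ; rewrite {1}(red_sum rQ) (raddf_sum (Dtot a mulx muly)).
apply: eq_bigr => g _ /=; apply: D_s; by have [w []] := reduced_log g rQ.
Qed.

Lemma emap_r_sum g (w : I -> ext Cx) :
  emap (r g) (\sum_h emap (s h) (w h)) = emap (pfilter (visible g)) (w g).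
Proof.
rewrite linear_sum (bigD1 g) //= big1 => [|h hg]; apply/ffunP => S.
  by rewrite addr0 !emapE rs eqxx.
by rewrite !emapE ext0E rs eq_sym (negPf hg).
Qed.

Lemma r_D_reduced g Q : red Q -> emap (r g) (D Q) = kosz (logdW g) (emap (r g) Q).
Proof.
move=> rQ; rewrite (D_reduced rQ) emap_r_sum; apply/ffunP => S; rewrite emapE [kosz _ _ S]koszE linear_sum.
apply: eq_bigr => j _; rewrite -!sign_scaleE linearZ /= logdW_filter emapE.
by rewrite pfilter_id // => e /(red_r rQ)[].
Qed.

(** A reduced primitive consists of logarithmic forms, whose differential in top
    degree is a combination of derivatives of the restricted potential. *)
Lemma sector_injective (f : I -> Cx) Q :
  (forall g e, (f g)@_e != 0 -> visible g e /\ forall j, F g j -> (0 < e j)%N) ->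
  \sum_g edelta (FS g) (s g (f g)) = D Q ->
  forall g, exists2 c : 'I_d -> Cx,
    forall j e, (c j)@_e != 0 -> forall k, ~~ F g k -> e k = 0%N &
    f g = 'X_[setm (FS g)] * \sum_(j | F g j) c j * (W g)^`M(j).
Proof.
move=> Hf fQ g; have rDQ : red (D Q).
  rewrite -fQ; elim/big_ind: _ => [//|//|h _]; rewrite -emap_edelta; apply: red_s => S e.
  rewrite edeltaE; case: (S =P _) => [-> fe _ j|_]; last by rewrite mcoeff0 eqxx.
  by rewrite inE; have [_] := Hf h e fe; apply.
have [Q0 rQ1] := reduce rDQ; set Q1 := Q - _ in rQ1.
have DQ1 : D Q1 = D Q by rewrite (raddfB (Dtot a mulx muly)) /= D2 subr0.
have := r_D_reduced g rQ1; have [w [rw _ _ wF]] := reduced_log g rQ1.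
rewrite rw kosz_log DQ1 -fQ.
under eq_bigr do rewrite -emap_edelta; rewrite emap_r_sum => /ffunP/(_ (FS g)).
rewrite emapE edeltaE eqxx log_formE pfilter_id => [fE|e]; last by case/(Hf g).
exists (fun j => (-1) ^+ below (FS g) j * w (FS g :\ j)) => [j e|].
  by rewrite -sign_scaleE mcoeffZ mulf_eq0 negb_or => /andP[_]; exact: wF.
rewrite [LHS]fE koszE; congr (_ * _); apply: eq_big => [j|j _]; first by rewrite inE.
by rewrite mulrA mulrAC.
Qed.

(** After reduction a cocycle splits into cocycles of the Koszul complexes of the
    derivatives of the restricted potentials. Some powers of the variables lie in
    the Jacobian ideal and form a regular sequence, so these complexes are exact
    below the top degree. *)
Lemma sector_surjective Q : D Q = 0 -> exists f : I -> Cx,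
  (forall g e, (f g)@_e != 0 -> visible g e /\ forall j, F g j -> (0 < e j)%N) /\
  exists P, Q = D P + \sum_g edelta (FS g) (s g (f g)).
Proof.
move=> DQ; have [|Q0 rQ1] := @reduce Q; first by rewrite DQ.
set Q1 := Q - _ in rQ1; have DQ1 : D Q1 = 0.
  by rewrite (raddfB (Dtot a mulx muly)) /= D2 DQ subrr.
have exact_g g : exists p v, emap (s g) (emap (r g) Q1) =
    D v + edelta (FS g) (s g ('X_[setm (FS g)] * p)).
  have [w [rw rdiv wF _]] := reduced_log g rQ1.
  have wcyc : kosz (dW g) w = 0.
    have := r_D_reduced g rQ1; rewrite DQ1 raddf0 rw kosz_log => /ffunP E.
    apply/ffunP => S; apply: (@mulX_inj _ _ (setm S)); rewrite ext0E mulr0.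
    by have := E S; rewrite ext0E log_formE.
  have /choice[N HN] : forall j, exists n, F g j -> in_jacobian a (F g) ('X_j ^+ n : Cx).
    move=> j; have [Fj|Fj] := boolP (F g j); last by exists 0%N.
    by have [n Pn] := var_power_in_jacobian a_unit W_nondeg (@F_partner g) Fj; exists n.
  have [|||v Hv] := @koszul_exact _ d (\row_j dW g j) [seq 'X_j ^+ N j | j <- enum (FS g)] _ _
      (w : {ffun {set 'I_d} -> Cx^o}).
  - move=> z /mapP[j]; rewrite mem_enum inE => Fj ->; have [c ->] := HN j Fj.
    exists (\row_j if F g j then c j else 0); rewrite big_mkcond; apply: eq_bigr => k _.
    by rewrite !mxE; case: ifP; rewrite ?mulr0 // mulrC.
  - by apply: regular_seq_var; exact: enum_uniq.
  - by apply/ffunP => S; rewrite -kosz_ewedge wcyc !ffunE.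
  (* Only the derivatives along [F g] are nonzero, so that the components of the
     primitive outside [F g] can be dropped. *)
  pose v' : ext Cx := [ffun S : {set 'I_d} => if S \subset FS g then (v S : Cx) else 0].
  have v'F S : ~~ (S \subset FS g) -> v' S = 0 by move=> /negPf SF; rewrite ffunE SF.
  exists (w (FS g) - kosz (dW g) v' (FS g)), (emap (s g) (log_form v')).
  rewrite D_s; last exact: log_form_divisible.
  rewrite kosz_log rw -emap_edelta -linearD /=; congr (emap _ _).
  apply/ffunP => S; rewrite extDE edeltaE !log_formE.
  case: eqP => [->|SF]; first by rewrite -mulrDr addrC subrK.
  rewrite addr0; congr (_ * _).
  have [sSF|sSF] := boolP (S \subset FS g); last first.
    rewrite wF // koszE big1 // => j jS; have [Fj|Fj] := boolP (F g j); last first.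
      by rewrite dW_eq0 // mul0r mulr0.
    rewrite v'F ?mulr0 //; apply: contra sSF => sSF; rewrite -(setD1K jS).
    by rewrite subUset sub1set inE Fj.
  have cS : (#|S| < size [seq ('X_j : Cx) ^+ N j | j <- enum (FS g)])%N.
    by rewrite size_map -cardE; apply: proper_card; rewrite properEneq sSF andbT; exact/eqP.
  transitivity (kosz (dW g) (v : ext Cx) S).
    by rewrite (Hv S cS); symmetry; exact: kosz_ewedge.
  rewrite [LHS]koszE [RHS]koszE; apply: eq_bigr => j jS; congr (_ * (_ * _)).
  by rewrite ffunE ifT //; exact: fintype.subset_trans (subD1set _ _) sSF.
have /choice[p /choice[v pv]] := exact_g.
exists (fun g => pfilter (visible g) ('X_[setm (FS g)] * p g)); split=> [g e|].
  rewrite mcoeff_pfilter; case: ifP => [vis pe|]; last by rewrite eqxx.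
  by split=> // j Fj; have [/(_ j)] := supp_mulX pe; rewrite mnmE inE Fj.
exists (Q0 + \sum_g v g); rewrite (raddfD (Dtot a mulx muly)) /= (raddf_sum (Dtot a mulx muly)) /=.
have -> : Q = D Q0 + Q1 by rewrite addrC subrK.
rewrite -[RHS]addrA; congr (_ + _); rewrite -big_split [LHS](red_sum rQ1).
by apply: eq_bigr => g _; rewrite pv s_filter.
Qed.

End SectorCohomology.

(** * The sectors inside the cone module *)

Section Sectors.
Variables (R : realType) (d : nat) (a : 'M[nat]_d) (G : {fset 'rV[R[i]]_d}).
Local Notation C := R[i].
Local Notation Cx := (mpoly.mpoly d C).
Local Notation V := (cone_module a G).
Local Notation ext V := {ffun {set 'I_d} -> V}.
Implicit Types (g h : G) (k : basis_index a G) (S : {set 'I_d}) (P Q : ext V).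
Implicit Types (e : 'X_{1..d}).
Hypothesis G_subgroup : subgroup_Aut a G.
Hypothesis a_unit : ratmx a \in unitmx.

(** By finiteness of [G], two powers of [g] coincide. *)
Lemma group_order (g : 'rV[C]_d) : g \in G -> exists2 n, (0 < n)%N & forall j, g 0 j ^+ n = 1.
Proof.
have [autG oneG mulG _] := G_subgroup; move=> gG.
have powG n : \row_j (g 0 j ^+ n) \in G.
  elim: n => [|n IH].
    by rewrite (_ : \row_j _ = const_mx 1) //; apply/rowP => j; rewrite !mxE.
  have := mulG _ _ gG IH; rewrite (_ : \row_j (_ * _) = \row_j (g 0 j ^+ n.+1)) //.
  by apply/rowP => j; rewrite !mxE exprS.
pose f (n : 'I_(#|{: G}|.+1)) : G := [` powG n]%fset.
have /injectivePn[n [m nm /(congr1 val)/rowP fnm]] : ~~ injectiveb f.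
  by apply/injectiveP => /leq_card; rewrite card_ord ltnn.
wlog mn : n m nm fnm / (m < n)%N.
  have [mn|nm'|/val_inj E] := ltngtP m n; first by move=> H; exact: (H n m).
    by move=> H; apply: (H m n) => [|j|//]; rewrite 1?eq_sym // fnm.
  by rewrite E eqxx in nm.
exists (n - m)%N => [|j]; first by rewrite subn_gt0.
have [gj _] := autG _ gG; have := fnm j; rewrite !mxE => E.
apply: (mulIf (expf_neq0 m (gj j))); rewrite -exprD subnK ?E ?mul1r //.
exact: ltnW.
Qed.

Lemma ageP (g : 'rV[C]_d) j : g \in G -> 0 <= age g j < 1 /\ cexp2pi R (age g j) = g 0 j.
Proof.
move=> /group_order[n n0 gn]; have [h h01 hE] := unity_root_cexp2pi n0 (gn j).
by rewrite /age; case: xgetP => [x _ []//|/(_ h)[]].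
Qed.

Lemma age_ge0 g j : 0 <= age (val g) j.
Proof. by have [/andP[]] := ageP j (valP g). Qed.

Lemma age_lt1 g j : age (val g) j < 1.
Proof. by have [/andP[]] := ageP j (valP g). Qed.

Lemma cexp2pi_box g : \row_j cexp2pi R (box_point (val g) 0 j) = val g.
Proof. by apply/rowP => j; rewrite !mxE; have [] := ageP j (valP g). Qed.

Lemma box_point_inj g h : box_point (val g) = box_point (val h) -> g = h.
Proof. by move=> E; apply: val_inj; rewrite -cexp2pi_box E cexp2pi_box. Qed.

Lemma latticeN_box g : latticeN G (box_point (val g)).
Proof. by rewrite /latticeN cexp2pi_box; exact: valP. Qed.

Lemma latticeN_vgen0 j : latticeN G (vgen j).
Proof.
have [_ oneG _ _] := G_subgroup; rewrite /latticeN.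
rewrite (_ : \row_j _ = const_mx 1) //; apply/rowP => l; rewrite !mxE.
by rewrite cexp2pi_int // natr_int.
Qed.

(** The pairing of u_i with the box point of [g] is an integer; if [j] were the
    only non-fixed variable of a monomial linear in it, that integer would be an
    age strictly between 0 and 1. *)
Lemma fixed_partner g i j : ~~ fixed (val g) j -> a i j = 1%N ->
  exists2 l, l != j & (0 < a i l)%N && ~~ fixed (val g) l.
Proof.
move=> Fj aij; apply/not_notP => H; case/negP: Fj; rewrite /fixed.
have := pairing_ugen_int G_subgroup a_unit i (latticeN_box g).
rewrite pairing_expo (bigD1 j) //= big1 => [|l lj]; last first.
  rewrite expo_ugen mxE; have [->|al] := posnP (a i l); first by rewrite mul0r.
  suff /eqP-> : age (val g) l == 0 by rewrite mulr0.
  by apply/negP => /negP Fl; apply: H; exists l; rewrite // al.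
rewrite addr0 expo_ugen mxE aij mul1r => /intrP[n nE].
have := age_ge0 g j; have := age_lt1 g j; rewrite nE.
rewrite -[1]/(1%:~R) -[X in X <= _]/(0%:~R) ltr_int ler_int => n1 n0.
by have -> : n = 0 by lia.
Qed.

Definition invariant_mnm e := [forall g : G, \prod_j (val g) 0 j ^+ e j == 1].

Lemma invariant_row i e : invariant_mnm (rowm a i + e)%MM = invariant_mnm e.
Proof.
apply: eq_forallb => g; under eq_bigr do rewrite mnmDE exprD; rewrite big_split /=.
have := row_invariant G_subgroup a_unit i (valP g).
by under eq_bigr do rewrite -[a i _](mnmE (fun j => a i j)); move=> ->; rewrite mul1r.
Qed.

(** The point of M_Q that pairs to [e j] with v_j. *)
Definition mpoint e : 'rV[rat]_d := (\row_j (e j)%:R) *m invmx (ratmx a).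

Lemma expo_mpoint e j : expo a (mpoint e) j = (e j)%:R.
Proof. by rewrite expoE mulmxKV // mxE. Qed.

Lemma mpointD e e' : mpoint (e + e')%MM = mpoint e + mpoint e'.
Proof. by rewrite -mulmxDl; congr (_ *m _); apply/rowP => j; rewrite !mxE mnmDE natrD. Qed.

Lemma mpoint_row i : mpoint (rowm a i) = ugen i.
Proof.
rewrite /mpoint (_ : \row_j _ = ugen i *m ratmx a) ?mulmxK //.
by apply/rowP => j; rewrite -rowE !mxE mnmE.
Qed.

(** For [n] in N, exp (2 pi i m.n) is the character by which the corresponding
    element of [G] acts on the monomial of [m]. *)
Lemma latticeM_mpoint e : latticeM a G (mpoint e) <-> invariant_mnm e.
Proof.
have pE n : cexp2pi R (pairing a (mpoint e) n) = \prod_j cexp2pi R (n 0 j) ^+ e j.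
  rewrite pairing_expo cexp2pi_sum; apply: eq_bigr => j _.
  by rewrite expo_mpoint mulr_natl cexp2pi_mulrn.
split=> [eM|/forallP ie n nN].
  apply/forallP => g; have := eM _ (latticeN_box g) => /(cexp2pi_int R).
  rewrite pE => E; apply/eqP; rewrite -[RHS]E; apply: eq_bigr => j _.
  by have /rowP/(_ j) := cexp2pi_box g; rewrite mxE => ->.
apply: (@cexp2pi_eq1 R); rewrite pE; have /eqP E := ie [` nN]%fset; rewrite -[RHS]E.
by apply: eq_bigr => j _; rewrite mxE.
Qed.

Local Notation visible := (visible (fun g : G => fixed (val g)) invariant_mnm).

Lemma basis_pred_mpoint g e : basis_pred a G (mpoint e, box_point (val g)) <-> visible g e.
Proof.
split=> [/basis_predP[/latticeM_mpoint ie _ eg]|/visibleP[/latticeM_mpoint eM Fe]].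
  apply/visibleP; split=> // j Fj; have [_ _ /eqP] := eg j.
  rewrite expo_mpoint mxE mulf_eq0 pnatr_eq0 => /orP[/eqP//|].
  by rewrite -/(fixed (val g) j) (negPf Fj).
apply/basis_predP; split=> //; first exact: latticeN_box.
move=> j; rewrite expo_mpoint ler0n mxE age_ge0; split=> //.
by have [/eqP->|/Fe->] := boolP (fixed (val g) j); rewrite ?mulr0 ?mul0r.
Qed.

Definition smap g : Cx -> V :=
  mlin (fun e => mono a G (mpoint e) (box_point (val g)) : V).
HB.instance Definition _ g := GRing.Linear.on (smap g).

Lemma smapX g e : smap g 'X_[e] = mono a G (mpoint e) (box_point (val g)).
Proof. exact: mlinX. Qed.

Lemma sector_imageE g f : sector_image a G (val g) f = smap g f.
Proof. by []. Qed.

Definition expo_mnm k : 'X_{1..d} := [multinom Num.truncn (expo a (val k).1 j) | j < d].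

Lemma expo_mnmE k j : (expo_mnm k j)%:R = expo a (val k).1 j.
Proof.
rewrite mnmE; apply/eqP; rewrite -natrEtruncn.
have [kM _ kk] := (basis_predP a G _ _).1 (val_basis_pred k).
have [x0 _ _] := kk j; rewrite natrEint x0 andbT.
exact/kM/latticeN_vgen0.
Qed.

Lemma mpoint_expo k : mpoint (expo_mnm k) = (val k).1.
Proof.
rewrite /mpoint (_ : \row_j _ = (val k).1 *m ratmx a) ?mulmxK //.
by apply/rowP => j; rewrite mxE expo_mnmE expoE.
Qed.

(** The inverse of [smap g] on the basis elements over the box point of [g]. *)
Definition rmap g : V -> Cx :=
  cone_lin (fun k => if (val k).2 == box_point (val g) then 'X_[expo_mnm k] else 0).
HB.instance Definition _ g := GRing.Linear.on (rmap g).

Lemma rmap_gen g k : rmap g (cgen k) =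
  if (val k).2 == box_point (val g) then 'X_[expo_mnm k] else 0.
Proof. exact: cone_lin_gen. Qed.

Lemma smap_visible g e : visible g e -> exists2 k : basis_index a G,
  smap g 'X_[e] = cgen k & val k = (mpoint e, box_point (val g)).
Proof.
move=> /basis_pred_mpoint eg; rewrite smapX.
by have [[_ []//]|[k kE ->]] := monoP a G (mpoint e) (box_point (val g)); exists k.
Qed.

Lemma smap_invisible g e : ~~ visible g e -> smap g 'X_[e] = 0.
Proof. by move=> /negP eg; rewrite smapX mono_eq0 // => /basis_pred_mpoint. Qed.

Lemma rmap_smap g h f :
  rmap h (smap g f) = if h == g then pfilter (visible g) f else 0.
Proof.
have rsX e : rmap h (smap g 'X_[e]) = if (h == g) && visible g e then 'X_[e] else 0.
  have [ve|ve] := boolP (visible g e); last by rewrite smap_invisible // raddf0 andbF.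
  have [k -> kE] := smap_visible ve; rewrite rmap_gen kE andbT /= (inj_eq box_point_inj) eq_sym.
  case: ifP => // _; congr 'X_[_]; apply/mnmP => j; apply/eqP.
  by rewrite -(eqr_nat rat) expo_mnmE kE /= expo_mpoint.
rewrite -[LHS]/((rmap h \o smap g) f); have [hg|hg] := boolP (h == g).
  by apply: mpoly_linear_eq => e /=; rewrite rsX hg /pfilter mlinX.
rewrite -[RHS]/((\0%R : Cx -> Cx) f).
by apply: mpoly_linear_eq => e /=; rewrite rsX (negPf hg).
Qed.

Lemma nonneg_mpoint g e : nonneg_pair a (mpoint e) (box_point (val g)).
Proof. by move=> j; rewrite expo_mpoint ler0n mxE age_ge0. Qed.

Lemma smap_mulx i g f : mulx i (smap g f) = smap g ('X_[rowm a i] * f).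
Proof.
rewrite -[LHS]/((mulx i \o smap g) f) -[RHS]/((smap g \o mulp 'X_[rowm a i]) f).
apply: mpoly_linear_eq => e /=; rewrite /mulp -mpolyXD !smapX mpointD mpoint_row.
exact/mulx_mono/nonneg_mpoint.
Qed.

Lemma smap_muly j g f : muly j (smap g ('X_j * f)) = 0.
Proof.
rewrite -[LHS]/((muly j \o smap g \o mulp 'X_j) f).
rewrite -[RHS]/((\0%R : Cx -> V) f); apply: mpoly_linear_eq => e /=.
rewrite /mulp -mpolyXD smapX muly_mono; last exact: nonneg_mpoint.
apply: mono_eq0 => /basis_predP[_ _ /(_ j)[_ _ /eqP]].
rewrite expo_mpoint !mxE mnmDE mnm1E !eqxx /= mulf_eq0 pnatr_eq0 /=.
by rewrite gt_eqF // ltr_wpDr // age_ge0.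
Qed.

End Sectors.

(** * Cohomology of the cone complex *)

Section SectorInstances.
Variables (R : realType) (d : nat) (a : 'M[nat]_d) (G : {fset 'rV[R[i]]_d}).
Local Notation C := R[i].
Local Notation Cx := (mpoly.mpoly d C).
Local Notation V := (cone_module a G).
Local Notation ext V := {ffun {set 'I_d} -> V}.
Implicit Types (g h : G) (k : basis_index a G) (S : {set 'I_d}) (P Q : ext V).
Implicit Types (e : 'X_{1..d}) (w : ext Cx).
Hypothesis G_subgroup : subgroup_Aut a G.
Hypothesis a_unit : ratmx a \in unitmx.
Hypothesis W_nondeg : nondegenerate_potential R a.
Let X i : {linear V -> V} := @mulx R d a G i.
Let Y j : {linear V -> V} := @muly R d a G j.
Let s g : {linear Cx -> V} := @smap R d a G g.
Let r g : {linear V -> Cx} := @rmap R d a G g.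
Local Notation F := (fun g : G => fixed (val g)).
Local Notation inv := (@invariant_mnm R d G).
Local Notation visible := (visible F inv).
Local Notation D := (Dtot a X Y).

Lemma coef_smap k g (f : Cx) : coef k (smap a g f) != 0 ->
  exists e, [/\ f@_e != 0, visible g e & val k = (mpoint a e, box_point (val g))].
Proof.
move=> nz; apply/not_notP => H; case/negP: nz; apply/eqP.
have -> : smap a g f = \sum_(e <- msupp f) f@_e *: smap a g 'X_[e].
  rewrite {1}[f]mpolyE (raddf_sum (smap a g)); apply: eq_bigr => e _.
  by rewrite /= (linearZ_LR (smap a g)).
rewrite (raddf_sum (coef k)) big1_seq // => e /andP[_]; rewrite mcoeff_msupp => fe /=.
rewrite (linearZ_LR (coef k)) /=.
have [ve|ve] := boolP (visible g e); last first.
  by rewrite (smap_invisible G_subgroup a_unit) // (raddf0 (coef k)) scaler0.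
have [l -> lE] := smap_visible G_subgroup a_unit ve.
rewrite coef_cgen; case: eqP => [lk|_]; last by rewrite scaler0.
by case: H; exists e; rewrite -lk.
Qed.

Lemma red_smap g w :
  (forall S e, (w S)@_e != 0 -> visible g e -> forall j, j \in S -> (0 < e j)%N) ->
  csupp_in (@creduced R d a G) (emap (s g) w).
Proof.
move=> Hw S k; rewrite emapE => /coef_smap[e [we ve kE]] j.
rewrite /unreduced /cxe /cye kE /= mxE; case: ifPn => jS.
  by rewrite expo_mpoint // pnatr_eq0 -lt0n; exact: Hw we ve j jS.
by rewrite -ltNge (age_lt1 G_subgroup).
Qed.

(** The second component of a reduced basis element has its coordinates in
    [[0, 1)], so it is the box point of the element of [G] that it defines. *)
Lemma reduced_sum Q : csupp_in (@creduced R d a G) Q ->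
  Q = \sum_g emap (s g) (emap (r g) Q).
Proof.
have inst := @supp_in_ind _ d _ _ (@cgen R d a G) (fun k => coef k)
  (fun x => monalg.msupp x) (@cone_sum_gen R d a G) (@cone_suppP R d a G).
move: Q; apply: (inst (@creduced R d a G)
  (fun Q => Q = \sum_g emap (s g) (emap (r g) Q))) => [|P Q EP EQ|c P EP|S k kred].
- by rewrite big1 // => g _; rewrite (raddf0 (emap (r g))) (raddf0 (emap (s g))).
- rewrite {1}EP {1}EQ -big_split; apply: eq_bigr => g _ /=.
  by rewrite (raddfD (emap (r g))) (raddfD (emap (s g))).
- rewrite {1}EP scaler_sumr; apply: eq_bigr => g _ /=.
  by rewrite (linearZ_LR (emap (r g))) (linearZ_LR (emap (s g))).
have [kM kN kk] := (basis_predP a G _ _).1 (val_basis_pred k).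
pose g0 : G := [` kN]%fset.
have k01 j : 0 <= (val k).2 0 j < 1.
  have [x0 n0 /eqP] := kk j; rewrite n0 /= mulf_eq0; have := kred j.
  rewrite /unreduced /cxe /cye; case: ifP => _; first by move=> /negPf-> /= /eqP->.
  by rewrite -ltNge.
have kbox : (val k).2 = box_point (val g0).
  apply/rowP => j; rewrite [RHS]mxE; have [a01 aE] := ageP G_subgroup j (valP g0).
  by apply: (@cexp2pi_inj R) => //; rewrite aE mxE.
rewrite (bigD1 g0) //= [X in _ + X]big1 => [|g gg0].
  rewrite addr0 !emap_edelta; congr (edelta S _); rewrite /= rmap_gen kbox eqxx.
  by rewrite smapX (mpoint_expo G_subgroup a_unit) -kbox mono_val.
rewrite !emap_edelta /= rmap_gen kbox (inj_eq (box_point_inj G_subgroup)) eq_sym.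
by rewrite (negPf gg0) (raddf0 (smap a g)) (raddf0 (edelta S)).
Qed.

Lemma coef_rmap g (x : V) e : (rmap g x)@_e != 0 ->
  exists k, [/\ coef k x != 0, (val k).2 = box_point (val g) & e = expo_mnm k].
Proof.
move=> nz; apply/not_notP => H; case/negP: nz; apply/eqP.
have -> : rmap g x = \sum_(k <- monalg.msupp x) coef k x *: rmap g (cgen k).
  rewrite {1}[x]cone_sum_gen (raddf_sum (rmap g)); apply: eq_bigr => k _.
  by rewrite /= (linearZ_LR (rmap g)).
rewrite (raddf_sum (mcoeff e)) big1_seq // => k /andP[_ kx] /=.
rewrite mcoeffZ rmap_gen; case: eqP => [kE|_]; last by rewrite mcoeff0 mulr0.
rewrite mcoeffX; case: eqP => [ke|_]; last by rewrite mulr0.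
by case: H; exists k; split=> //; exact: cone_suppP.
Qed.

Lemma red_rmap Q g S e : csupp_in (@creduced R d a G) Q -> (r g (Q S))@_e != 0 ->
  visible g e /\ forall j, j \in S -> (0 < e j)%N.
Proof.
move=> Qred /coef_rmap[k [/Qred kred kE ->]]; split.
  apply/(basis_pred_mpoint G_subgroup a_unit).
  by rewrite (mpoint_expo G_subgroup a_unit) -kE -surjective_pairing; exact/asboolP/(valP k).
move=> j jS; have := kred j; rewrite /unreduced jS /cxe.
by rewrite -(expo_mnmE G_subgroup) pnatr_eq0 lt0n.
Qed.

(** The invariants of the sector of [g], described monomial by monomial. *)
Definition sector_term g (f : Cx) : Prop :=
  forall e, f@_e != 0 -> visible g e /\ forall j, F g j -> (0 < e j)%N.

Definition sector_terms (f : G -> Cx) : Prop := forall g, sector_term g (f g).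

Let rs g h (f : Cx) : r h (s g f) = if h == g then pfilter (visible g) f else 0.
Proof. exact: rmap_smap. Qed.

Let s_mulx i g (f : Cx) : X i (s g f) = s g ('X_[rowm a i] * f).
Proof. exact: smap_mulx. Qed.

Let s_muly j g (f : Cx) : F g j -> Y j (s g ('X_j * f)) = 0.
Proof. by move=> _; exact: smap_muly. Qed.

Let s_invisible g e : ~~ visible g e -> s g 'X_[e] = 0.
Proof. exact: smap_invisible. Qed.

Let red0 : csupp_in (@creduced R d a G) 0.
Proof. exact: supp_in0. Qed.

Let redD P Q : csupp_in (@creduced R d a G) P -> csupp_in (@creduced R d a G) Q ->
  csupp_in (@creduced R d a G) (P + Q).
Proof. exact: supp_inD. Qed.

Let reduce P : csupp_in (@creduced R d a G) (D P) ->
  exists Q, csupp_in (@creduced R d a G) (P - D Q).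
Proof. exact: cone_reduction. Qed.

Lemma cone_surjective Q : D Q = 0 -> exists f : G -> Cx, sector_terms f /\
  exists P, Q = D P + \sum_g edelta (FS F g) (s g (f g)).
Proof.
exact: (sector_surjective (invariant_row G_subgroup a_unit) rs s_mulx s_muly
  s_invisible red0 reduced_sum red_rmap reduce (Dtot_cone2 G_subgroup a_unit)
  a_unit W_nondeg (fixed_partner G_subgroup a_unit)).
Qed.

Lemma cone_injective (f : G -> Cx) Q : sector_terms f ->
  \sum_g edelta (FS F g) (s g (f g)) = D Q ->
  forall g, exists2 c : 'I_d -> Cx,
    forall j e, (c j)@_e != 0 -> forall l, ~~ F g l -> e l = 0%N &
    f g = 'X_[setm (FS F g)] * \sum_(j | F g j) c j * (restricted R a (F g))^`M(j).
Proof.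
exact: (sector_injective (invariant_row G_subgroup a_unit) rs s_mulx s_muly
  s_invisible red_smap redD red0 reduced_sum red_rmap reduce
  (Dtot_cone2 G_subgroup a_unit)).
Qed.

Lemma cone_jacobian g (c : 'I_d -> Cx) : exists P,
  edelta (FS F g) (s g ('X_[setm (FS F g)] *
    \sum_(j | F g j) c j * (restricted R a (F g))^`M(j))) = D P.
Proof. exact: (jacobian_coboundary s_mulx s_muly s_invisible). Qed.

Lemma cone_sector_cocycle g (f : Cx) :
  (forall e, f@_e != 0 -> forall j, F g j -> (0 < e j)%N) ->
  D (edelta (FS F g) (s g f)) = 0.
Proof. exact: (sector_cocycle s_mulx s_muly s_invisible). Qed.

End SectorInstances.

(** * Invariants of the Milnor rings *)

Section SubquotientTheory.
Variables (K : nzRingType) (V : lmodType K) (Z B : submodClosed V).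
Local Notation cls := (@quot_class K V Z B).

Lemma quot_classE z : z \in Z -> val (cls z) = (\pi_(lquot B) z)%qT.
Proof. by move=> zZ; rewrite val_insubd; case: ifP => // /asboolP[]; exists z. Qed.

Lemma quot_class_eq z z' : z \in Z -> z' \in Z -> (cls z = cls z') <-> (z - z' \in B).
Proof.
move=> zZ z'Z; split=> [zz'|zz']; first by apply/lquot_eqP; rewrite -!quot_classE // zz'.
by apply: val_inj; rewrite !quot_classE //; exact/lquot_eqP.
Qed.

Lemma quot_classP c z z' : z \in Z -> z' \in Z ->
  cls (c *: z + z') = c *: cls z + cls z'.
Proof.
move=> zZ z'Z; apply: val_inj; rewrite linearP /= !quot_classE ?rpredD ?rpredZ //.
by rewrite lquot_piD lquot_piZ.
Qed.

Lemma quot_class_surj (x : subquot Z B) : exists2 z, z \in Z & x = cls z.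
Proof.
have /asboolP[z zZ xE] := valP x; exists z => //.
by apply: val_inj; rewrite quot_classE.
Qed.

Lemma quot_class0 : cls 0 = 0.
Proof. by have := @quot_classP (-1) 0 0 (rpred0 Z) (rpred0 Z); rewrite scaler0 addr0 scaleN1r addNr. Qed.

Lemma quot_classZ c z : z \in Z -> cls (c *: z) = c *: cls z.
Proof. by move=> zZ; have := quot_classP c zZ (rpred0 Z); rewrite quot_class0 !addr0. Qed.

Lemma quot_classD z z' : z \in Z -> z' \in Z -> cls (z + z') = cls z + cls z'.
Proof. by move=> zZ z'Z; have := quot_classP 1 zZ z'Z; rewrite !scale1r. Qed.

Lemma quot_class_sum (I : Type) (s : seq I) (F : I -> V) : (forall i, F i \in Z) ->
  cls (\sum_(i <- s) F i) = \sum_(i <- s) cls (F i).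
Proof.
move=> FZ; elim: s => [|i s IH]; rewrite ?big_nil ?quot_class0 // !big_cons.
by rewrite quot_classD ?IH // rpred_sum.
Qed.

End SubquotientTheory.

Section MilnorSectors.
Variables (R : realType) (d : nat) (a : 'M[nat]_d) (G : {fset 'rV[R[i]]_d}).
Local Notation C := R[i].
Local Notation Cx := (mpoly.mpoly d C).
Implicit Types (g h : G) (S : {set 'I_d}) (e : 'X_{1..d}) (f p : Cx).
Hypothesis G_subgroup : subgroup_Aut a G.
Hypothesis a_unit : ratmx a \in unitmx.
Local Notation Fg := (fun g : G => fixed (val g)).
Local Notation inv := (@invariant_mnm R d G).

Lemma shift_monoE (g : 'rV[C]_d) : shift_mono g = 'X_[setm [set j | fixed g j]].
Proof.
rewrite mpolyXE_id /shift_mono big_mkcond; apply: eq_bigr => j _.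
by rewrite mnmE inE; case: (fixed g j); rewrite ?expr1 ?expr0.
Qed.

Lemma restricted_potentialE (g : 'rV[C]_d) :
  restricted_potential a g = restricted R a (fixed g).
Proof.
rewrite /restricted_potential potentialE raddf_sum [RHS]big_mkcond; apply: eq_bigr => i _ /=.
rewrite comp_mpolyX.
transitivity (\prod_j ((if fixed g j then 'X_j else 0) : Cx) ^+ rowm a i j).
  by apply: eq_bigr => j _; congr (_ ^+ _); exact: tnth_mktuple.
case: ifPn => [/innerP Fi|].
  rewrite mpolyXE_id; apply: eq_bigr => j _; rewrite mnmE.
  by have [->|/Fi->] := posnP (a i j); rewrite ?expr0.
rewrite negb_forall => /existsP[j]; rewrite negb_imply => /andP[aij /negPf Fj].
by rewrite (bigD1 j) //= Fj mnmE expr0n gtn_eqF // mul0r.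
Qed.

Lemma sector_polyP (g : 'rV[C]_d) f : reflect
  (forall e, f@_e != 0 -> forall j, if fixed g j then (0 < e j)%N else e j == 0%N)
  (f \in sector_poly g).
Proof.
have -> : (f \in sector_poly g) =
  `[< exists2 p, in_fixed_ring g p & f = shift_mono g * p >] by [].
apply: (iffP (asboolP _)) => [[p pF ->] e|Hf].
  rewrite shift_monoE => /supp_mulX[le_e /pF pe] j; have := le_e j.
  rewrite mnmE inE; case: ifPn => // Fj _; have := pe j Fj.
  by rewrite mnmBE mnmE inE (negPf Fj) subn0 => ->.
exists (divX (setm [set j | fixed g j]) f); last first.
  rewrite shift_monoE; apply: divXK => e j /Hf/(_ j).
  by rewrite mnmE inE; case: ifP.
move=> e fe j Fj; have := @divXK _ _ (setm [set j | fixed g j]) f.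
move=> E; have : f@_(setm [set j | fixed g j] + e) != 0.
  rewrite E 1?mulrC ?mcoeffMX // => e' i /Hf/(_ i).
  by rewrite mnmE inE; case: ifP.
by move/Hf/(_ j); rewrite (negPf Fj) mnmDE addn_eq0 => /andP[_ /eqP].
Qed.

Lemma sector_jacP (g : 'rV[C]_d) f : f \in sector_jac a g <-> exists2 c : 'I_d -> Cx,
  forall j, in_fixed_ring g (c j) &
  f = 'X_[setm [set j | fixed g j]] * \sum_(j | fixed g j) c j * (restricted R a (fixed g))^`M(j).
Proof.
rewrite -shift_monoE -restricted_potentialE; split; first by move/asboolP.
by move=> H; apply/asboolP.
Qed.

Lemma mcoeff_diag_act (y : 'rV[C]_d) f e : (diag_act y f)@_e = (\prod_j y 0 j ^+ e j) * f@_e.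
Proof.
pose L1 : {linear Cx -> C^o} := mcoeff e \o diag_act y.
pose L2 : {linear Cx -> C^o} := (\prod_j y 0 j ^+ e j) \*: mcoeff e.
rewrite -[LHS]/(L1 f) -[RHS]/(L2 f); apply: mpoly_linear_eq => e' /=.
rewrite diag_actX mcoeffZ mcoeffX; case: eqP => [->//|_].
by rewrite mulr0 scaler0.
Qed.

Lemma diag_act_invariant f :
  (forall e, f@_e != 0 -> inv e) <-> (forall y, y \in G -> diag_act y f = f).
Proof.
split=> [Hf y yG|Hf e fe].
  apply/mpolyP => e; rewrite mcoeff_diag_act.
  have [->|/Hf/forallP/(_ [` yG]%fset)/eqP->] := eqVneq f@_e 0; by rewrite ?mulr0 ?mul1r.
apply/forallP => g; apply/eqP; apply: (mulIf fe).
by rewrite -mcoeff_diag_act Hf ?mul1r //; exact: valP.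
Qed.

Lemma diag_actM (y : 'rV[C]_d) f p : diag_act y (f * p) = diag_act y f * diag_act y p.
Proof. by rewrite /diag_act rmorphM. Qed.

(** The product of the variable and the derivative is a combination of invariant
    monomials. *)
Lemma diag_act_deriv g j y : y \in G -> fixed (val g) j ->
  diag_act y (restricted R a (fixed (val g)))^`M(j) =
  (y 0 j)^-1 *: (restricted R a (fixed (val g)))^`M(j).
Proof.
move=> yG Fj; have [autG _ _ _] := G_subgroup; have [y0 _] := autG _ yG.
apply: (@mulX_inj _ _ U_(j)); rewrite -scalerAr mulX_deriv.
have : diag_act y ('X_j * (restricted R a (fixed (val g)))^`M(j)) =
    'X_j * (restricted R a (fixed (val g)))^`M(j).
  rewrite mulX_deriv (raddf_sum (diag_act y)); apply: eq_bigr => i _ /=.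
  rewrite linearZ /= diag_actX; congr (_ *: _); rewrite -[RHS]scale1r; congr (_ *: _).
  rewrite -[RHS](row_invariant G_subgroup a_unit i yG).
  by apply: eq_bigr => l _; rewrite mnmE.
rewrite diag_actM diag_actX mulX_deriv => <-; rewrite -scalerAl scalerA.
suff -> : \prod_l y 0 l ^+ U_(j)%MM l = y 0 j by rewrite mulVf ?scale1r.
rewrite (bigD1 j) //= mnm1E eqxx expr1 big1 ?mulr1 // => l /negPf lj.
by rewrite mnm1E eq_sym lj.
Qed.

Lemma sector_jac_act g y f : y \in G -> f \in sector_jac a (val g) ->
  diag_act y f \in sector_jac a (val g).
Proof.
move=> yG /sector_jacP[c cF ->]; apply/sector_jacP.
pose m := setm [set j | fixed (val g) j]; pose u := \prod_j y 0 j ^+ m j.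
exists (fun j => u *: ((y 0 j)^-1 *: diag_act y (c j))) => [j e|].
  rewrite !mcoeffZ mcoeff_diag_act => nz; apply: (cF j).
  by apply: contraNneq nz => ->; rewrite !mulr0.
rewrite diag_actM diag_actX (raddf_sum (diag_act y)) -scalerAl scalerAr scaler_sumr.
congr (_ * _); apply: eq_bigr => j Fj /=; rewrite diag_actM diag_act_deriv //.
by rewrite -scalerAl -scalerAr -scalerAl.
Qed.

Lemma sector_poly_act g y f : f \in sector_poly (val g) -> diag_act y f \in sector_poly (val g).
Proof.
move=> /sector_polyP Hf; apply/sector_polyP => e; rewrite mcoeff_diag_act => nz.
by apply: Hf; apply: contraNneq nz => ->; rewrite mulr0.
Qed.

(** Orthogonality of characters: averaging a monomial over [G] gives zero
    unless it is invariant. *)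
Lemma character_sum e : \sum_(g : G) \prod_j (val g) 0 j ^+ e j =
  if inv e then (#|{: G}|)%:R else 0.
Proof.
case: ifPn => [/forallP ie|].
  rewrite -sum1_card natr_sum; apply: eq_bigr => g _; exact/eqP/ie.
rewrite negb_forall => /existsP[y chi1]; set chi := \prod_j _ in chi1.
have [autG oneG mulG invG] := G_subgroup.
pose t g : G := [` mulG _ _ (valP y) (valP g)]%fset.
have tinj : injective t.
  move=> g h /(congr1 val)/rowP gh; apply/val_inj/rowP => j.
  have := gh j; rewrite !mxE; apply: mulfI.
  by have [] := autG _ (valP y).
set sum := \sum_g _; have sumE : sum = chi * sum.
  rewrite {1}/sum (reindex_inj tinj) mulr_sumr; apply: eq_bigr => g _.
  by rewrite /chi -big_split; apply: eq_bigr => j _; rewrite /= mxE exprMn.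
apply/eqP; have : (1 - chi) * sum == 0 by rewrite mulrBl mul1r -sumE subrr.
by rewrite mulf_eq0 subr_eq0 eq_sym (negPf chi1).
Qed.

Lemma sector_term_poly g f : sector_term g f -> f \in sector_poly (val g).
Proof.
move=> Hf; apply/sector_polyP => e /Hf[/visibleP[_ Fe] He] j.
by case: ifPn => [/He|/Fe->].
Qed.

Lemma sector_termP g f : f \in sector_poly (val g) ->
  (forall y, y \in G -> diag_act y f = f) -> sector_term g f.
Proof.
move=> /sector_polyP Hf /diag_act_invariant inv_f e fe; split.
  apply/visibleP; split; first exact: inv_f.
  by move=> j Fj; have := Hf e fe j; rewrite (negPf Fj) => /eqP.
by move=> j Fj; have := Hf e fe j; rewrite Fj.
Qed.

Lemma sector_term_act g f y : sector_term g f -> y \in G -> diag_act y f = f.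
Proof. by move=> Hf; apply: (diag_act_invariant f).1 => e /Hf[/visibleP[]]. Qed.

Lemma sector_termD c g f f' : sector_term g f -> sector_term g f' -> sector_term g (c *: f + f').
Proof.
move=> Hf Hf' e; rewrite mcoeffD mcoeffZ; have [->|/Hf//] := eqVneq f@_e 0.
by rewrite mulr0 add0r; exact: Hf'.
Qed.

Lemma sector_term0 g : sector_term g 0.
Proof. by move=> e; rewrite mcoeff0 eqxx. Qed.

Lemma sector_term_filter g f : f \in sector_poly (val g) -> sector_term g (pfilter inv f).
Proof.
move=> /sector_polyP Hf e; rewrite mcoeff_pfilter; case: ifP => [ie fe|]; last by rewrite eqxx.
split; last by move=> j Fj; have := Hf e fe j; rewrite Fj.
by apply/visibleP; split=> // j Fj; have := Hf e fe j; rewrite (negPf Fj) => /eqP.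
Qed.

Lemma reynolds f :
  pfilter inv f = (#|{: G}|)%:R^-1 *: \sum_(g : G) diag_act (val g) f.
Proof.
have G0 : (#|{: G}|)%:R != 0 :> C.
  have [_ oneG _ _] := G_subgroup; rewrite pnatr_eq0 -lt0n.
  by apply/card_gt0P; exists [` oneG]%fset.
apply/mpolyP => e; rewrite mcoeff_pfilter mcoeffZ (raddf_sum (mcoeff e)) /=.
under eq_bigr do rewrite mcoeff_diag_act; rewrite -mulr_suml character_sum.
by case: ifP => _; rewrite ?mul0r ?mulr0 // mulKf.
Qed.

Local Notation mclass g := (milnor_class a (val g)).

(** An invariant class is the average of its translates. *)
Lemma milnor_class_average g (h : Cx) : h \in sector_poly (val g) ->
  milnor_invariant G (mclass g h) -> mclass g (pfilter inv h) = mclass g h.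
Proof.
move=> hP inv_h.
have actP (y : G) : diag_act (val y) h \in sector_poly (val g).
  exact: sector_poly_act.
rewrite reynolds {1}/milnor_class quot_classZ; last first.
  by apply: rpred_sum => y _; exact: actP.
rewrite quot_class_sum //.
transitivity ((#|{: G}|)%:R^-1 *: \sum_(y : G) mclass g h).
  congr (_ *: _); apply: eq_bigr => y _; exact: (inv_h _ _ (valP y) hP).
rewrite sumr_const -[mclass g h *+ _]scaler_nat scalerA mulVf ?scale1r // pnatr_eq0 -lt0n.
by have [_ oneG _ _] := G_subgroup; apply/card_gt0P; exists [` oneG]%fset.
Qed.

(** An invariant class has an invariant representative by averaging; conversely
    invariant representatives give invariant classes because the Jacobian ideal
    is stable under [G]. *)
Lemma milnor_invariantP g (l : milnor a (val g)) :
  milnor_invariant G l <-> exists2 f, sector_term g f & l = mclass g f.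
Proof.
split=> [inv_l|[f Hf ->] y h yG hP fh].
  have [h hP lE] := quot_class_surj l; exists (pfilter inv h); first exact: sector_term_filter.
  by rewrite milnor_class_average // -[mclass g h]lE.
rewrite fh; apply/quot_class_eq => //; first exact: sector_poly_act.
have fhj : f - h \in sector_jac a (val g).
  by apply/(quot_class_eq _ (sector_term_poly Hf) hP).
have -> : diag_act y h - h = (f - h) - diag_act y (f - h).
  rewrite (raddfB (diag_act y)) /= (sector_term_act Hf yG) opprB [RHS]addrC.
  by rewrite addrA subrK.
by apply: rpredB => //; exact: sector_jac_act.
Qed.

End MilnorSectors.

(** * Twisting spaces and explicit cocycles *)

Section Chains.
Variables (R : realType) (d : nat) (a : 'M[nat]_d) (G : {fset 'rV[R[i]]_d}).
Local Notation C := R[i].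
Local Notation Cx := (mpoly.mpoly d C).
Local Notation V := (cone_module a G).
Local Notation ext V := {ffun {set 'I_d} -> V}.
Implicit Types (g h : G) (S : {set 'I_d}) (e : 'X_{1..d}).
Hypothesis G_subgroup : subgroup_Aut a G.
Hypothesis a_unit : ratmx a \in unitmx.
Hypothesis W_nondeg : nondegenerate_potential R a.
Local Notation Fg := (fun g : G => fixed (val g)).
Local Notation FS := (FS Fg).
Local Notation mclass g := (milnor_class a (val g)).
Local Notation b := (dual_basis R a).
Local Notation X := (fun i => @mulx R d a G i : {linear V -> V}).
Local Notation Y := (fun j => @muly R d a G j : {linear V -> V}).
Local Notation D := (Dtot a X Y).

(** A generator of the twisting space of [g]: the rows of the dual basis with
    h_j = 0 form a basis of s_g. *)
Definition top_form g : ext C^o := theta b (FS g).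

Lemma top_formE g : top_form g = basis_change b (edelta (FS g) (1 : C^o)).
Proof.
by rewrite basis_change_edelta; apply/ffunP => S; rewrite ffunE /GRing.scale /= mulr1.
Qed.

Lemma card_FS g : #|FS g| = #|fixed (val g)|.
Proof. by rewrite cardsE. Qed.

Lemma twist_top_form g : twist a (val g) (top_form g).
Proof.
split=> [S /card_theta ->|j Fj]; first exact: card_FS.
rewrite top_formE (contr_basis_change a_unit) annih_edelta inE (negPf Fj).
exact: raddf0.
Qed.

Lemma top_form_neq0 g : top_form g != 0.
Proof.
apply/eqP => w0; have := basis_changeKV a_unit (edelta (FS g) (1 : C^o)).
rewrite -top_formE w0 raddf0 => /ffunP/(_ (FS g))/eqP.
by rewrite ext0E edeltaE eqxx eq_sym oner_eq0.
Qed.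

(** In the dual basis contraction by v_j deletes the [j]-th vector, so a form that
    is killed for all h_j <> 0 only involves the vectors with h_j = 0; its degree
    is the number of these. *)
Lemma twist_top_formP g w : twist a (val g) w -> exists c : C, w = c *: top_form g.
Proof.
move=> [w_card w_contr]; pose w' := basis_change (ugen_basis R a) w.
have wE : w = basis_change b w' by rewrite /w' (basis_changeVK a_unit).
have w'_annih j : ~~ fixed (val g) j -> annih j w' = 0.
  move=> Fj; rewrite -[LHS](basis_changeKV a_unit) -(contr_basis_change a_unit) -wE.
  by rewrite w_contr // raddf0.
have w'_top S : S != FS g -> w' S = 0.
  move=> SF; apply/eqP; apply: contraNT SF => w'S.
  have SsubF : S \subset FS g.
    apply/fintype.subsetP => j jS; rewrite inE; apply: contraNT w'S => Fj.
    have /ffunP/(_ (S :\ j)) := w'_annih j Fj; rewrite !ffunE setD11 setD1K // => /eqP.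
    by rewrite scaler_eq0 signr_eq0.
  rewrite eqEcard SsubF card_FS; move: w'S; rewrite ffunE => nz.
  have [T /negP] : exists T, ~ (theta (ugen_basis R a) T S *: w T == 0).
    apply/not_existsP => H; case/negP: nz; rewrite big1 // => T _.
    by apply/eqP; have /contrapT := H T.
  rewrite scaler_eq0 negb_or => /andP[/card_theta -> /w_card ->].
  exact: leqnn.
exists (w' (FS g)); rewrite top_formE -linearZ /= wE; congr (basis_change _ _).
apply/ffunP => S; rewrite extZE edeltaE; case: (S =P FS g) => [->|/eqP/w'_top->].
  by rewrite /GRing.scale /= mulr1.
by rewrite scaler0.
Qed.

(** The cocycle attached to a family of polynomials, the one at [g] having the
    top form of [g] as its exterior part. *)
Definition chain (f : G -> Cx) : ext V :=
  basis_change b (\sum_(g : G) edelta (FS g) (smap a g (f g))).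

Lemma chainP c f f' : chain (fun g => c *: f g + f' g) = c *: chain f + chain f'.
Proof.
rewrite /chain -(linearP (basis_change b)); congr (basis_change _ _).
rewrite scaler_sumr -big_split; apply: eq_bigr => g _ /=.
by rewrite (linearP (smap a g)) (linearP (edelta (FS g))).
Qed.

Lemma tensor_pure (W : lmodType C) (v : W) (w : ext C^o) : tensor v w = pure v w.
Proof. by []. Qed.

Lemma chain_tensor (p : G -> Cx) (c : G -> C) :
  \sum_(g : G) tensor (sector_image a G (val g) (p g)) (c g *: top_form g) =
  chain (fun g => c g *: p g).
Proof.
rewrite /chain (raddf_sum (basis_change b)); apply: eq_bigr => g _ /=.
rewrite basis_change_edelta sector_imageE (linearZ_LR (smap a g)) /=.
by rewrite tensor_pure pureZ.
Qed.

Local Notation coc := (@cocycle R d a G).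
Local Notation cob := (@coboundary R d a G).

Definition coh_class (P : ext V) : cohomology a G := quot_class coc cob P.
Local Notation cls := coh_class.

Lemma coh_class_eq P P' : P \in coc -> P' \in coc ->
  (cls P = cls P') <-> (exists Q, P - P' = dA Q).
Proof.
move=> Pc P'c; have := quot_class_eq cob Pc P'c.
by move=> ->; split=> [/asboolP|H]; [|apply/asboolP].
Qed.

Lemma coh_classP c P P' : P \in coc -> P' \in coc ->
  cls (c *: P + P') = c *: cls P + cls P'.
Proof. exact: quot_classP. Qed.

Lemma coh_class_surj (x : cohomology a G) : exists2 P, P \in coc & x = cls P.
Proof. exact: quot_class_surj. Qed.

Lemma chain_cocycle f : sector_terms f -> chain f \in coc.
Proof.
move=> Hf; rewrite -[_ \in _]/(dA (chain f) == 0) /chain (dA_basis_change a_unit).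
have -> : D (\sum_(g : G) edelta (FS g) (smap a g (f g))) = 0.
  rewrite (raddf_sum (Dtot a X Y)) big1 // => g _ /=.
  by apply: (cone_sector_cocycle G_subgroup a_unit) => e fe; have [_] := Hf g e fe.
by rewrite (raddf0 (basis_change b)) eqxx.
Qed.

Lemma chain_class_eq f f' : sector_terms f -> sector_terms f' ->
  (forall g, mclass g (f g) = mclass g (f' g)) <-> cls (chain f) = cls (chain f').
Proof.
move=> Hf Hf'; have diffE : chain f - chain f' = chain (fun g => - 1 *: f' g + f g).
  by rewrite chainP scaleN1r addrC.
have mE g : mclass g (f g) = mclass g (f' g) <-> f g - f' g \in sector_jac a (val g).
  by apply: quot_class_eq; exact: sector_term_poly.
split=> [ff'|/(coh_class_eq (chain_cocycle Hf) (chain_cocycle Hf'))].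
  apply/(coh_class_eq (chain_cocycle Hf) (chain_cocycle Hf')).
  have /choice[P PE] : forall g, exists P : ext V,
      edelta (FS g) (smap a g (- 1 *: f' g + f g)) = D P.
    move=> g; have /mE/sector_jacP[c _] := ff' g; rewrite scaleN1r addrC => ->.
    exact: (cone_jacobian G_subgroup a_unit g c).
  rewrite diffE; exists (basis_change b (\sum_(g : G) P g)); rewrite (dA_basis_change a_unit).
  rewrite (raddf_sum (Dtot a X Y)) /chain; congr (basis_change _ _).
  by apply: eq_bigr => g _; rewrite PE.
rewrite diffE => -[Q QE] g; apply/mE.
have [Q' Q'E] : exists Q', Q = basis_change b Q'.
  by exists (basis_change (ugen_basis R a) Q); rewrite (basis_changeVK a_unit).
move: QE; rewrite Q'E (dA_basis_change a_unit) => /(can_inj (basis_changeKV a_unit (W := V))) E.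
have [|c cF fE] := cone_injective G_subgroup a_unit _ E g.
  by move=> h; apply: sector_termD.
apply/sector_jacP; exists c; first by move=> j e ce k Fk; exact: cF ce k Fk.
by rewrite -[RHS]fE scaleN1r addrC.
Qed.

Lemma chain_surjective (x : cohomology a G) : exists2 f, sector_terms f & x = cls (chain f).
Proof.
have [P Pcoc ->] := coh_class_surj x.
have [Q QE] : exists Q, P = basis_change b Q.
  by exists (basis_change (ugen_basis R a) P); rewrite (basis_changeVK a_unit).
have DQ : D Q = 0.
  apply: (can_inj (basis_changeKV a_unit (W := V))); rewrite (raddf0 (basis_change b)).
  by rewrite -(dA_basis_change a_unit) -QE; apply/eqP.
have [f [Hf [Q0 Q0E]]] := cone_surjective G_subgroup a_unit W_nondeg DQ.
exists f; first exact: Hf.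
apply/(coh_class_eq Pcoc (chain_cocycle Hf)).
exists (basis_change b Q0); rewrite (dA_basis_change a_unit) QE Q0E (raddfD (basis_change b)) /=.
exact: addrK.
Qed.

Lemma tensor_top_form_inj g (l l' : milnor a (val g)) :
  tensor l (top_form g) = tensor l' (top_form g) -> l = l'.
Proof.
move=> /ffunP E; have /eqP w0 := top_form_neq0 g.
have [S /eqP wS] : exists S, ~ (top_form g S = 0).
  by apply/not_existsP => H; apply: w0; apply/ffunP => S; rewrite ext0E; exact: contrapT (H S).
by have := E S; rewrite !ffunE => /(scalerI wS).
Qed.

(** Averaging makes each first factor invariant, and each second one is a multiple
    of the top form, so the sum collapses to a single tensor. *)
Lemma sector_rep g (x : sector a G (val g)) :
  exists2 f, sector_term g f & sector_val x = tensor (mclass g f) (top_form g).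
Proof.
have : sector_val x \in @sector_pred R d a G (val g) by case: x.
case/asboolP => s + ->; elim: s => [_|[l w] s IH Hs].
  exists 0; first exact: sector_term0.
  by rewrite big_nil /milnor_class quot_class0 tensor_pure pure0.
have [|f Hf E] := IH; first by move=> t ts; apply: Hs; rewrite inE ts orbT.
have [/= /(milnor_invariantP G_subgroup a_unit)[f' Hf' ->] /twist_top_formP[c ->]] :=
  Hs (l, w) (mem_head _ _).
exists (c *: f' + f); first exact: sector_termD.
rewrite big_cons /= E !tensor_pure.
have -> : mclass g (c *: f' + f) = c *: mclass g f' + mclass g f.
  by apply: quot_classP; exact: sector_term_poly.
by rewrite pureP pureZ; congr (_ + _); apply/ffunP => S; rewrite !ffunE scalerA mulrC -scalerA.
Qed.

End Chains.

(** * The isomorphism *)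

Section Isomorphism.
Variables (R : realType) (d : nat) (a : 'M[nat]_d) (G : {fset 'rV[R[i]]_d}).
Local Notation C := R[i].
Local Notation Cx := (mpoly.mpoly d C).
Local Notation V := (cone_module a G).
Local Notation ext V := {ffun {set 'I_d} -> V}.
Implicit Types (g h : G) (S : {set 'I_d}) (e : 'X_{1..d}).
Hypothesis G_subgroup : subgroup_Aut a G.
Hypothesis a_unit : ratmx a \in unitmx.
Hypothesis W_nondeg : nondegenerate_potential R a.
Local Notation mclass g := (milnor_class a (val g)).

Local Notation cls := (@coh_class R d a G).

Definition represents (f : G -> Cx) (F : A_ring a G) :=
  sector_terms f /\ forall g, sector_val (F g) = tensor (mclass g (f g)) (top_form a g).

Lemma sector_class_pred g f : sector_term g f ->
  tensor (mclass g f) (top_form a g) \in @sector_pred R d a G (val g).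
Proof.
move=> Hf; apply/asboolP; exists [:: (mclass g f, top_form a g)].
  move=> t; rewrite mem_seq1 => /eqP ->; split; last exact: twist_top_form.
  by apply/(milnor_invariantP G_subgroup a_unit); exists f.
by rewrite big_seq1.
Qed.

Lemma has_representative F : exists f, represents f F.
Proof.
have /choice[f Hf] : forall g, exists f, sector_term g f /\
    sector_val (F g) = tensor (mclass g f) (top_form a g).
  by move=> g; have [f Hf E] := sector_rep G_subgroup a_unit (F g); exists f.
by exists f; split=> g; have [] := Hf g.
Qed.

Lemma represents_surjective f : sector_terms f -> exists F, represents f F.
Proof.
move=> Hf; exists (fun g => Sector (sector_class_pred (Hf g))).
by split=> // g.
Qed.

Lemma represents_eq f f' F F' : represents f F -> represents f' F' ->
  F = F' <-> cls (chain a f) = cls (chain a f').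
Proof.
move=> [Hf FE] [Hf' FE']; rewrite -(chain_class_eq G_subgroup a_unit Hf Hf').
split=> [FF' g|ff'].
  by apply: (tensor_top_form_inj a_unit); rewrite -FE -FE' FF'.
apply: functional_extensionality_dep => g; apply: val_inj.
by rewrite /= FE FE' ff'.
Qed.

Lemma represents_lincomb c f f' F F' : represents f F -> represents f' F' ->
  represents (fun g => c *: f g + f' g) (c *: F + F').
Proof.
move=> [Hf FE] [Hf' FE']; split=> g; first exact: sector_termD.
have -> : sector_val ((c *: F + F') g) = c *: sector_val (F g) + sector_val (F' g) by [].
have -> : mclass g (c *: f g + f' g) = c *: mclass g (f g) + mclass g (f' g).
  by apply: quot_classP; exact: sector_term_poly.
by rewrite FE FE' !tensor_pure pureP.
Qed.

Definition Phi_fun (F : A_ring a G) : cohomology a G :=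
  cls (chain a (sval (cid (has_representative F)))).

(** By [represents_eq] the class does not depend on the representative. *)
Lemma Phi_funE f F : represents f F -> Phi_fun F = cls (chain a f).
Proof.
by move=> HF; apply/(represents_eq (svalP (cid (has_representative F))) HF).
Qed.

Lemma Phi_fun_is_linear : linear Phi_fun.
Proof.
move=> c F F'; have [f Hf] := has_representative F; have [f' Hf'] := has_representative F'.
rewrite (Phi_funE (represents_lincomb c Hf Hf')) (Phi_funE Hf) (Phi_funE Hf') chainP.
by apply: coh_classP; apply: chain_cocycle => //; [case: Hf|case: Hf'].
Qed.

Lemma Phi_fun_bijective : bijective Phi_fun.
Proof.
have /choice[Psi PsiE] : forall x, exists F, Phi_fun F = x.
  move=> x; have [f Hf ->] := chain_surjective G_subgroup a_unit W_nondeg x.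
  by have [F HF] := represents_surjective Hf; exists F; exact: (Phi_funE HF).
have PsiK F : Psi (Phi_fun F) = F.
  have [f Hf] := has_representative F.
  have [f' Hf'] := has_representative (Psi (Phi_fun F)).
  case: (represents_eq Hf' Hf) => _; apply.
  have E := PsiE (Phi_fun F); move: (Psi _) Hf' E => F' Hf' E.
  have E' := etrans (esym (Phi_funE Hf')) E.
  have E'' := etrans E' (Phi_funE Hf); exact: E''.
exists Psi; [exact: PsiK|exact: PsiE].
Qed.

Lemma mclassZ c g f : sector_term g f -> mclass g (c *: f) = c *: mclass g f.
Proof.
by move=> Hf; apply: quot_classZ; exact: sector_term_poly.
Qed.

Lemma Phi_formula (p : G -> Cx) (w : G -> ext C^o) (F : A_ring a G) :
  (forall g, [/\ p g \in sector_poly (val g), forall y, y \in G -> diag_act y (p g) = p g,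
     twist a (val g) (w g) & sector_val (F g) = tensor (mclass g (p g)) (w g)]) ->
  Phi_fun F = cls (\sum_(g : G) tensor (sector_image a G (val g) (p g)) (w g)).
Proof.
move=> H; have /choice[c cE] : forall g, exists c, w g = c *: top_form a g.
  by move=> g; have [_ _ wT _] := H g; exact: (twist_top_formP a_unit wT).
have pT g : sector_term g (p g).
  by have [pS pI _ _] := H g; apply: sector_termP.
have -> : \sum_(g : G) tensor (sector_image a G (val g) (p g)) (w g) =
    chain a (fun g => c g *: p g).
  by rewrite -chain_tensor; apply: eq_bigr => g _; rewrite cE.
apply: Phi_funE; split=> g.
  by rewrite -[_ *: _]addr0; apply: sector_termD => //; apply: sector_term0.
by have [_ _ _ ->] := H g; rewrite cE mclassZ // !tensor_pure pureZ.
Qed.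

End Isomorphism.

(** * The gradings *)

Section Gradings.
Variables (R : realType) (d : nat) (a : 'M[nat]_d) (G : {fset 'rV[R[i]]_d}).
Local Notation C := R[i].
Local Notation Cx := (mpoly.mpoly d C).
Local Notation V := (cone_module a G).
Local Notation ext V := {ffun {set 'I_d} -> V}.
Implicit Types (g h : G) (S : {set 'I_d}) (e : 'X_{1..d}).
Hypothesis G_subgroup : subgroup_Aut a G.
Hypothesis a_unit : ratmx a \in unitmx.
Local Notation Fg := (fun g : G => fixed (val g)).
Local Notation FS := (FS Fg).
Local Notation mclass g := (milnor_class a (val g)).
Local Notation b := (dual_basis R a).
Local Notation X := (fun i => @mulx R d a G i : {linear V -> V}).
Local Notation Y := (fun j => @muly R d a G j : {linear V -> V}).
Local Notation D := (Dtot a X Y).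

Variables (q : 'I_d -> rat) (deg degv : 'rV[rat]_d).
Hypothesis q_weights : forall i, \sum_j (a i j)%:R * q j = 1.
Hypothesis deg_v : forall j, pairing a deg (vgen j) = 1.
Hypothesis u_degv : forall i, pairing a (ugen i) degv = 1.
Implicit Types (k l : basis_index a G) (P Q : ext V) (f : G -> Cx) (F : A_ring a G).
Local Notation coc := (@cocycle R d a G).
Local Notation cls := (@coh_class R d a G).

(** Both sides solve the linear system with matrix [a] and right-hand side 1. *)
Lemma degv_weights j : degv 0 j = q j.
Proof.
suff E : degv = \row_l q l by rewrite E mxE.
apply: trmx_inj; apply: (can_inj (mulKmx a_unit)); apply/colP => i.
transitivity (1 : rat); last first.
  rewrite mxE -[LHS](q_weights i); apply: eq_bigr => l _; by rewrite !mxE.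
rewrite mxE -[RHS](u_degv i) pairing_expo; apply: eq_bigr => l _.
by rewrite expo_ugen !mxE.
Qed.

Lemma pairing_deg n : pairing a deg n = \sum_j n 0 j.
Proof. by rewrite pairing_expo; apply: eq_bigr => j _; rewrite /expo deg_v mul1r. Qed.

Lemma pairing_degv m : pairing a m degv = \sum_j expo a m j * q j.
Proof. by rewrite pairing_expo; apply: eq_bigr => j _; rewrite degv_weights. Qed.

Definition in_bidegree (r s : rat) S (mn : 'rV[rat]_d * 'rV[rat]_d) : bool :=
  (coh_deg a deg degv mn == r) && (conf_deg a deg degv mn S == s).

(** Since u_i . deg^vee = 1, the cohomological degree increases by one; in the
    conformal degree this is compensated by the exterior degree. *)
Lemma in_bidegree_mulx r s S k l i j : j \notin S ->
  (forall h : 'I_d, cxe l h = (a i h)%:R + cxe k h) -> cye l =1 cye k ->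
  in_bidegree r s (j |: S) (val l) = in_bidegree (r - 1) s S (val k).
Proof.
move=> jS xl yl; rewrite /in_bidegree /coh_deg /conf_deg !pairing_degv !pairing_deg.
have -> : \sum_j expo a (val l).1 j * q j = 1 + \sum_j expo a (val k).1 j * q j.
  rewrite -(q_weights i) -big_split; apply: eq_bigr => h _ /=.
  by rewrite -mulrDl; congr (_ * _); exact: xl.
have -> : \sum_j (val l).2 0 j = \sum_j (val k).2 0 j by apply: eq_bigr => h _; exact: yl.
rewrite cardsU1 jS natrD /=; congr andb; apply/eqP/eqP => E; lra.
Qed.

Lemma in_bidegree_muly r s S k l j : j \in S -> cxe l =1 cxe k ->
  (forall i, cye l i = (i == j)%:R + cye k i) ->
  in_bidegree r s (S :\ j) (val l) = in_bidegree (r - 1) s S (val k).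
Proof.
move=> jS xl yl; rewrite /in_bidegree /coh_deg /conf_deg !pairing_degv !pairing_deg.
have -> : \sum_j expo a (val l).1 j * q j = \sum_j expo a (val k).1 j * q j.
  by apply: eq_bigr => h _; congr (_ * _); exact: xl.
have -> : \sum_j (val l).2 0 j = 1 + \sum_j (val k).2 0 j.
  rewrite (eq_bigr (fun i => (i == j)%:R + (val k).2 0 i)) => [|h _]; last exact: yl.
  rewrite big_split /=; congr (_ + _); rewrite (bigD1 j) //= eqxx big1 ?addr0 //.
  by move=> h /negPf->.
rewrite (cardsD1 j S) jS natrD /=; congr andb; apply/eqP/eqP => E; lra.
Qed.

Definition bideg_part (r s : rat) : ext V -> ext V :=
  cdiag (fun S k => (in_bidegree r s S (val k))%:R).
HB.instance Definition _ r s := GRing.Linear.on (bideg_part r s).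

(** The differential has bidegree (1, 0). *)
Lemma bideg_part_Dtot r s P : bideg_part r s (D P) = D (bideg_part (r - 1) s P).
Proof.
apply: cdiag_Dtot => S k.
  by move=> i j l jS xl yl; rewrite (in_bidegree_mulx _ _ jS xl yl).
by move=> j l jS xl yl; rewrite (in_bidegree_muly _ _ jS xl yl).
Qed.

Lemma bideg_part_id r s P : cplx_bihomog deg degv r s P -> bideg_part r s P = P.
Proof.
move=> HP; apply/ffunP => S; apply/monalg.malgP => k; rewrite -![monalg.mcoeff k _]/(coef k _).
rewrite coef_cdiag; have [->|/HP[cr cs]] := eqVneq (coef k (P S)) 0; first by rewrite mulr0.
by rewrite /in_bidegree cr cs !eqxx mul1r.
Qed.

Lemma basis_change_bihomog bb r s P : cplx_bihomog deg degv r s P ->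
  cplx_bihomog deg degv r s (basis_change bb P).
Proof.
move=> HP S k; rewrite -[monalg.mcoeff k _]/(coef k _) ffunE (raddf_sum (coef k)) /= => nz.
have [T /negP] : exists T, ~ (coef k (theta bb T S *: P T) == 0).
  by apply/not_existsP => H; case/negP: nz; rewrite big1 // => T _; apply/eqP; exact: contrapT (H T).
rewrite (linearZ_LR (coef k)) /= mulf_eq0 negb_or => /andP[/card_theta cST /HP].
by rewrite /conf_deg cST.
Qed.

Definition term_bideg r s g e : bool :=
  in_bidegree r s (FS g) (mpoint a e, box_point (val g)).

Lemma bideg_part_smap r s g (f : Cx) :
  bideg_part r s (edelta (FS g) (smap a g f)) =
  edelta (FS g) (smap a g (pfilter (term_bideg r s g) f)).
Proof.
rewrite [LHS]emaps_edelta; congr (edelta _ _); set w := cscale _.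
rewrite -[LHS]/((w \o smap a g) f) -[RHS]/((smap a g \o pfilter (term_bideg r s g)) f).
apply: mpoly_linear_eq => e /=.
rewrite /pfilter mlinX; have [ve|ve] := boolP (visible Fg (invariant_mnm G) g e); last first.
  by rewrite smap_invisible //; case: ifP; rewrite ?smap_invisible // !raddf0.
have [k kE vk] := smap_visible G_subgroup a_unit ve; rewrite kE cscaleE vk.
rewrite /term_bideg; case: ifP => _; first by rewrite kE scale1r.
by rewrite scale0r (raddf0 (smap a g)).
Qed.

Definition homog_terms r s f := forall g e, (f g)@_e != 0 -> term_bideg r s g e.

Lemma chain_bihomog r s f : homog_terms r s f -> cplx_bihomog deg degv r s (chain a f).
Proof.
move=> Hf; apply: basis_change_bihomog => S k; rewrite -[monalg.mcoeff k _]/(coef k _).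
rewrite sum_ffunE (raddf_sum (coef k)) /= => nz.
have [g /negP] : exists g, ~ (coef k (edelta (FS g) (smap a g (f g)) S) == 0).
  by apply/not_existsP => H; case/negP: nz; rewrite big1 // => g _; apply/eqP; exact: contrapT (H g).
rewrite edeltaE; case: (S =P FS g) => [->|_]; last by rewrite (raddf0 (coef k)) eqxx.
by case/(coef_smap G_subgroup a_unit) => e [/Hf/andP[/eqP er /eqP es] _ ->].
Qed.

(** The bihomogeneous part of a primitive of the difference of the two cocycles is
    a primitive of the difference of their bihomogeneous parts. *)
Lemma chain_bideg_part r s f P : sector_terms f -> P \in coc ->
  cplx_bihomog deg degv r s P -> cls (chain a f) = cls P ->
  cls (chain a (fun g => pfilter (term_bideg r s g) (f g))) = cls P.
Proof.
move=> Hf Pc HP /(coh_class_eq (chain_cocycle G_subgroup a_unit Hf) Pc)[Q QE].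
set f' := fun g => _.
have Hf' : sector_terms f'.
  move=> g e; rewrite mcoeff_pfilter; case: ifP => _; last by rewrite eqxx.
  exact: Hf.
apply/(coh_class_eq (chain_cocycle G_subgroup a_unit Hf') Pc).
have [Q' Q'E] : exists Q', Q = basis_change b Q'.
  by exists (basis_change (ugen_basis R a) Q); rewrite (basis_changeVK a_unit).
have [P' P'E HP'] : exists2 P', P = basis_change b P' & cplx_bihomog deg degv r s P'.
  exists (basis_change (ugen_basis R a) P); first by rewrite (basis_changeVK a_unit).
  exact: basis_change_bihomog.
subst P Q; pose sum_terms (h : G -> Cx) : ext V := \sum_(g : G) edelta (FS g) (smap a g (h g)).
have bcB (x y : ext V) : basis_change b (x - y) = basis_change b x - basis_change b y.
  exact: (raddfB (basis_change b)).

have QE' : sum_terms f - P' = D Q'.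
  apply: (can_inj (basis_changeKV a_unit (W := V))).
  exact: etrans (bcB _ _) (etrans QE (dA_basis_change a_unit _)).
have partE : bideg_part r s (sum_terms f) = sum_terms f'.
  rewrite (raddf_sum (bideg_part r s)); apply: eq_bigr => g _ /=.
  exact: bideg_part_smap.
have QE'' : sum_terms f' - P' = D (bideg_part (r - 1) s Q').
  rewrite -bideg_part_Dtot -QE' [RHS](raddfB (bideg_part r s)) /=.
  by rewrite partE (bideg_part_id HP').
exists (basis_change b (bideg_part (r - 1) s Q')).
by rewrite (dA_basis_change a_unit) -QE'' bcB.
Qed.

(** With h_j = 0 on the fixed coordinates, both equalities are linear relations
    between the sums of the q_j and of the h_j over fixed and non-fixed
    coordinates. *)
Lemma shift_bidegE g e : (forall j, ~~ fixed (val g) j -> e j = 0%N) ->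
  let mn := (mpoint a (setm (FS g) + e), box_point (val g)) in
  let delta := \sum_j (e j)%:R * q j in
  coh_deg a deg degv mn = QA_plus q (val g) delta /\
  conf_deg a deg degv mn (FS g) = QA_minus a q deg degv (val g) delta.
Proof.
move=> eF mn delta; rewrite /coh_deg /conf_deg /QA_minus /QA_plus /QB_plus /QB_minus.
pose sumF := \sum_(j | fixed (val g) j) q j; pose sumN := \sum_(j | ~~ fixed (val g) j) q j.
pose ages := \sum_(j | ~~ fixed (val g) j) age (val g) j.
have -> : pairing a mn.1 degv = sumF + delta.
  rewrite pairing_degv /sumF [X in _ = X + _]big_mkcond /delta -big_split; apply: eq_bigr => j _ /=.
  rewrite expo_mpoint // mnmDE mnmE inE natrD mulrDl.
  by case: fixed; rewrite ?mul1r ?mul0r.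
have -> : pairing a deg mn.2 = ages.
  rewrite pairing_deg /ages [RHS]big_mkcond; apply: eq_bigr => j _; rewrite mxE.
  by case: ifPn => // /negPn/eqP.
have -> : pairing a deg degv = sumF + sumN.
  rewrite pairing_deg (bigID (fixed (val g))) /=.
  by congr (_ + _); apply: eq_bigr => j _; rewrite degv_weights.
have -> : d%:R = #|FS g|%:R + \sum_(j | ~~ fixed (val g) j) 1 :> rat.
  rewrite -[d in LHS]card_ord -(cardsC (FS g)) natrD sumr_const; congr (_ + _%:R).
  by apply: eq_card => j; rewrite !inE.
rewrite !sumrB -/sumN -/ages; move: (\sum_(j | _) 1) => x.
by split; lra.
Qed.

Lemma represents_bihomog r s f F : represents f F -> homog_terms r s f ->
  A_bihomog q deg degv r s F.
Proof.
move=> [Hf FE] Hr g S; have fP := sector_term_poly (Hf g).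
have FgS : sector_val (F g) S = mclass g (top_form a g S *: f g).
  by rewrite FE ffunE mclassZ.
have /asboolP[p pF fE] := fP.
have [p0|] := eqVneq p 0; first by left; rewrite FgS fE p0 mulr0 scaler0 [LHS]quot_class0.
rewrite -msupp_eq0; case E: (msupp p) => [//|e0 t] _; right.
have pe0 : p@_e0 != 0 by rewrite -mcoeff_msupp E mem_head.
have degE e : p@_e != 0 -> term_bideg r s g (setm (FS g) + e)%MM.
  by move=> pe; apply: Hr; rewrite fE shift_monoE mulrC mcoeffMX.
have bidegE e : p@_e != 0 -> QA_plus q (val g) (\sum_j (e j)%:R * q j) = r /\
    QA_minus a q deg degv (val g) (\sum_j (e j)%:R * q j) = s.
  move=> pe; have [|<- <-] := @shift_bidegE g e; first by move=> j; exact: pF.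
  by have /andP[/eqP er /eqP es] := degE e pe.
have [r0 s0] := bidegE _ pe0.
exists (top_form a g S *: p), (\sum_j (e0 j)%:R * q j); split=> //.
- by move=> e; rewrite mcoeffZ mulf_eq0 negb_or => /andP[_]; exact: pF.
- move=> e; rewrite mcoeffZ mulf_eq0 negb_or => /andP[_ /bidegE[re _]].
  by move: re; rewrite -r0 /QA_plus /QB_plus => /addrI.
- by rewrite FgS fE scalerAr.
Qed.

(** Averaging over [G] only discards monomials, so it makes a homogeneous
    representative invariant without changing its degree. *)
Lemma homog_representative r s F : A_bihomog q deg degv r s F ->
  exists2 f, represents f F & homog_terms r s f.
Proof.
move=> HF; suff /choice[f Hf] : forall g, exists f : Cx,
    [/\ sector_term g f, sector_val (F g) = tensor (mclass g f) (top_form a g)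
      & forall e, f@_e != 0 -> term_bideg r s g e].
  by exists f; [split|] => g; have [] := Hf g.
move=> g; have [f Hf FE] := sector_rep G_subgroup a_unit (F g).
have /eqP w0 := top_form_neq0 a_unit g.
have [S /eqP wS] : exists S, ~ (top_form a g S = 0).
  by apply/not_existsP => H; apply: w0; apply/ffunP => S; rewrite ext0E; exact: contrapT (H S).
set c := top_form a g S in wS.
have FgS : sector_val (F g) S = c *: mclass g f by rewrite FE ffunE.
have [F0|[p [delta [pF pdelta FpE rE sE]]]] := HF g S.
  exists 0; split; [exact: sector_term0| |by move=> e; rewrite mcoeff0 eqxx].
  rewrite FE; move: F0; rewrite FgS => /eqP; rewrite scaler_eq0 (negPf wS) => /eqP ->.
  by rewrite /milnor_class quot_class0.
pose h := shift_mono (val g) * p.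
have hP : h \in sector_poly (val g) by apply/asboolP; exists p.
have hE : mclass g h = mclass g (c *: f) by rewrite -FpE FgS mclassZ.
have cf : sector_term g (c *: f) by rewrite -[_ *: _]addr0; apply: sector_termD => //; exact: sector_term0.
have h_inv : milnor_invariant G (mclass g h).
  by apply/(milnor_invariantP G_subgroup a_unit); exists (c *: f).
pose f' := pfilter (@invariant_mnm R d G) h.
have f'T : sector_term g f' by exact: sector_term_filter.
exists (c^-1 *: f'); split.
- by rewrite -[_ *: _]addr0; apply: sector_termD => //; exact: sector_term0.
- rewrite mclassZ // milnor_class_average // hE mclassZ // scalerA mulVf // scale1r; exact: FE.
move=> e; rewrite mcoeffZ mulf_eq0 negb_or mcoeff_pfilter => /andP[_].
case: ifP => _; last by rewrite eqxx.
rewrite /h shift_monoE => /supp_mulX[/mnm_divK eE pe].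
rewrite -eE; have [|er es] := @shift_bidegE g (e - setm (FS g))%MM.
  by move=> j; exact: pF.
by rewrite /term_bideg /in_bidegree er es (pdelta _ pe) rE sE !eqxx.
Qed.

(** A bihomogeneous cocycle in the class of a chain can be replaced by the part
    of that bidegree of the chain, which represents the same element of the
    A ring by injectivity. *)
Lemma Phi_bihomog r s F :
  A_bihomog q deg degv r s F <-> coh_bihomog deg degv r s (Phi_fun G_subgroup a_unit F).
Proof.
split=> [/homog_representative[f fF Hf]|[P [Pc HP PE]]].
  have [Hf' _] := fF; exists (chain a f); split; last exact: Phi_funE.
    exact: chain_cocycle.
  exact: chain_bihomog.
have [f fF] := has_representative G_subgroup a_unit F; have [Hf _] := fF.
have PE' : cls (chain a f) = cls P := etrans (esym (Phi_funE G_subgroup a_unit fF)) PE.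
pose f' g := pfilter (term_bideg r s g) (f g).
have Hf' : sector_terms f'.
  move=> g e; rewrite mcoeff_pfilter; case: ifP => _; last by rewrite eqxx.
  exact: Hf.
have E := chain_bideg_part Hf Pc HP PE'.
have [F' fF'] := represents_surjective G_subgroup a_unit Hf'.
case: (represents_eq G_subgroup a_unit fF' fF) => _ <-; last exact: etrans E (esym PE').
apply: represents_bihomog fF' _ => g e.
by rewrite mcoeff_pfilter; case: ifP => //; rewrite eqxx.
Qed.

End Gradings.

Theorem proposition3p3p6 (R : realType) (d : nat) (a : 'M[nat]_d)
    (q : 'I_d -> rat) (G : {fset 'rV[R[i]]_d}) (deg degv : 'rV[rat]_d)
    (a_invertible : ratmx a \in unitmx)
    (q_gt0 : forall j, 0 < q j)
    (q_weights : forall i, \sum_j (a i j)%:R * q j = 1)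
    (W_nondegenerate : nondegenerate_potential R a)
    (G_subgroup : subgroup_Aut a G)
    (deg_v : forall j, pairing a deg (vgen j) = 1)
    (u_degv : forall i, pairing a (ugen i) degv = 1) :
  [/\ (* d^A is a differential *)
      forall P : {ffun {set 'I_d} -> cone_module a G}, dA (dA P) = 0,
      (* the twisting spaces T_g are one-dimensional *)
      forall g : G, exists2 w0 : {ffun {set 'I_d} -> R[i]^o},
        twist a (val g) w0 /\ w0 != 0
        & forall w, twist a (val g) w -> exists c : R[i], w = c *: w0
    & exists Phi : {linear A_ring a G -> cohomology a G},
      [/\ bijective Phi,
          (* Phi is induced by x^e (x) w |-> [m_e (+) n_g] (x) w *)
          forall (p : G -> mpoly.mpoly d R[i])
                 (w : G -> {ffun {set 'I_d} -> R[i]^o}) (F : A_ring a G),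
            (forall g : G,
               [/\ p g \in sector_poly (val g),
                   forall y, y \in G -> diag_act y (p g) = p g,
                   twist a (val g) (w g)
                 & sector_val (F g)
                   = tensor (milnor_class a (val g) (p g)) (w g)]) ->
            Phi F = quot_class (@cocycle R d a G) (@coboundary R d a G)
              (\sum_(g : G) tensor (sector_image a G (val g) (p g)) (w g))
        & forall (r s : rat) (F : A_ring a G),
            A_bihomog q deg degv r s F <-> coh_bihomog deg degv r s (Phi F)]].
Proof.
split; first exact: (dA2 G_subgroup a_invertible).
  move=> g; exists (top_form a g); last exact: (twist_top_formP a_invertible).
  split; [exact: (twist_top_form a_invertible)|exact: (top_form_neq0 a_invertible)].
pose Phi_linear := GRing.isLinear.Build R[i] (A_ring a G) (cohomology a G) *:%R
  (Phi_fun G_subgroup a_invertible) (Phi_fun_is_linear G_subgroup a_invertible).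
pose Phi : {linear A_ring a G -> cohomology a G} := HB.pack (Phi_fun G_subgroup a_invertible) Phi_linear.
exists Phi; split.
- exact: (Phi_fun_bijective G_subgroup a_invertible W_nondegenerate).
- exact: (Phi_formula G_subgroup a_invertible).
- exact: (Phi_bihomog G_subgroup a_invertible q_weights deg_v u_degv).
Qed.
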